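(* Pure $t$-memory-TR-NNCRSP, with $t\in O(|V|)$ given, is PSPACE-hard. That is, the following problem is PSPACE-hard: given a non-stochastic multiplayer game $\mathcal{G}$ with vertex set $V$ (no nature vertices) in which every player has a terminal reachability objective, a rational $\mu\in[0,1]$, and a natural number $t$ with $t\in O(|V|)$, decide whether there exists a pure $t$-memory strategy $\sigma_0$ of the system such that for every tuple $\bar\sigma_{-0}$ of pure $t$-memory strategies of the environment players for which $(\sigma_0,\bar\sigma_{-0})$ is a 0-fixed Nash equilibrium (deviations ranging over pure $t$-memory strategies), $\mathit{Pay}_0(\sigma_0,\bar\sigma_{-0})\ge\mu$.
   Context: Game arena: a tuple $\mathcal{A}=\langle \Omega, V,(V_i)_{i\in\Omega\cup\{\mathit{nature}\}},\Delta,v_0\rangle$ where $\Omega=\{0,1,\dots,k\}$ is the set of players (player $0$ is the system, players $1,\dots,k$ are the environment players), $V$ is a finite set of vertices partitioned into sets $V_i$, $i\in\Omega\cup\{\mathit{nature}\}$, and $v_0$ is the initial vertex; the game is non-stochastic when $V_{\mathit{nature}}=\emptyset$, in which case $\Delta\subseteq(\bigcup_{i\in\Omega}V_i)\times\{\bot\}\times V$ is just a set of edges. $\mathit{next}(v)$ is the set of successors of $v$, required nonempty. A vertex $v$ is terminal if $\mathit{next}(v)=\{v\}$. Plays are infinite paths $\pi(0)\pi(1)\dots$ from $v_0$. For a set $F$ of terminal vertices, $\mathit{TR}(F)=\{\pi\mid\exists n.\ \pi(n)\in F\}$ is a terminal reachability objective; each player $i$ has such an objective $O_i$, with payoff $1$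 if the play lies in $O_i$ and $0$ otherwise. Strategies: a pure strategy of player $i$ is a function $\sigma_i:V^*V_i\to V$ choosing a successor. $\sigma_i$ is $t$-memory if for all $x\in V^*$ with $|x|>t$ and $v\in V_i$, $\sigma_i(xv)=\sigma_i(zv)$ where $z$ is the suffix of $x$ of length $t$. A strategy profile $\bar\sigma$ determines the play, and $\mathit{Pay}_i(\bar\sigma)$ is player $i$'s payoff on it. $\bar\sigma$ is a 0-fixed Nash equilibrium if for every environment player $i\ne0$ and every allowed strategy $\tau$ of $i$, $\mathit{Pay}_i(\bar\sigma_{-i},\tau)\le\mathit{Pay}_i(\bar\sigma)$, where $(\bar\sigma_{-i},\tau)$ replaces player $i$'s strategy by $\tau$. *)

(* Defs.v *)
From Stdlib Require Import List Arith NArith ZArith QArith.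
From Stdlib Require Import Classical ClassicalDescription.
Import ListNotations.
Open Scope nat_scope.

(* A non-stochastic game arena with terminal reachability objectives.
   Vertices are 0 .. g_nv-1, players are 0 .. g_k (0 = system),
   vertex v belongs to player (nth v g_owner 0), edges are g_edges,
   initial vertex g_v0, player i's objective is TR(nth i g_targets []). *)
Record Game := {
  g_nv      : nat;
  g_k       : nat;
  g_owner   : list nat;
  g_edges   : list (nat * nat);
  g_v0      : nat;
  g_targets : list (list nat)
}.

Definition owner (G : Game) (v : nat) : nat := nth v (g_owner G) 0.
Definition edge (G : Game) (v w : nat) : Prop := In (v, w) (g_edges G).
Definition target (G : Game) (i : nat) : list nat := nth i (g_targets G) [].
Definition is_vertex (G : Game) (v : nat) : Prop := v < g_nv G.
Definition terminal (G : Game) (v : nat) : Prop :=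
  edge G v v /\ forall w, edge G v w -> w = v.

Definition wf_game (G : Game) : Prop :=
  length (g_owner G) = g_nv G /\
  (forall v, is_vertex G v -> owner G v <= g_k G) /\
  (forall v w, edge G v w -> is_vertex G v /\ is_vertex G w) /\
  (forall v, is_vertex G v -> exists w, edge G v w) /\
  is_vertex G (g_v0 G) /\
  length (g_targets G) = S (g_k G) /\
  (forall i v, i <= g_k G -> In v (target G i) -> is_vertex G v /\ terminal G v).

(* A pure strategy sigma_i : V^* V_i -> V, represented as a function of the
   history prefix x and the current vertex v (meaning sigma_i(x v)). *)
Definition strategy := list nat -> nat -> nat.
Definition profile := nat -> strategy.

Definition history (G : Game) (x : list nat) : Prop := Forall (is_vertex G) x.

Definition legal_strategy (G : Game) (i : nat) (s : strategy) : Prop :=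
  forall x v, history G x -> is_vertex G v -> owner G v = i -> edge G v (s x v).

Definition t_memory (G : Game) (i t : nat) (s : strategy) : Prop :=
  forall x v, history G x -> is_vertex G v -> owner G v = i ->
    t < length x -> s x v = s (skipn (length x - t) x) v.

Definition pure_tmem_strategy (G : Game) (t i : nat) (s : strategy) : Prop :=
  legal_strategy G i s /\ t_memory G i t s.

Fixpoint hist (G : Game) (p : profile) (n : nat) : list nat :=
  match n with
  | 0 => [g_v0 G]
  | S m => let h := hist G p m in
           let v := last h (g_v0 G) in
           h ++ [p (owner G v) (removelast h) v]
  end.

Definition play (G : Game) (p : profile) (n : nat) : nat := last (hist G p n) (g_v0 G).

Definition wins (G : Game) (p : profile) (i : nat) : Prop :=
  exists n, In (play G p n) (target G i).

Definition Pay (G : Game) (p : profile) (i : nat) : Q :=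
  if excluded_middle_informative (wins G p i) then 1%Q else 0%Q.

Definition update (p : profile) (i : nat) (s : strategy) : profile :=
  fun j => if Nat.eqb j i then s else p j.

Definition zero_fixed_NE (G : Game) (t : nat) (p : profile) : Prop :=
  forall i, 1 <= i <= g_k G -> forall tau, pure_tmem_strategy G t i tau ->
    Qle (Pay G (update p i tau) i) (Pay G p i).

Definition combine (s0 : strategy) (env : profile) : profile :=
  fun j => if Nat.eqb j 0 then s0 else env j.

Record Instance := {
  i_game : Game;
  i_mu   : Q;
  i_t    : nat
}.

Definition wf_instance (I : Instance) : Prop :=
  wf_game (i_game I) /\ Qle 0%Q (i_mu I) /\ Qle (i_mu I) 1%Q.

Definition NNCRSP_answer (I : Instance) : Prop :=
  let G := i_game I in let t := i_t I in
  exists s0, pure_tmem_strategy G t 0 s0 /\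
    forall env : profile,
      (forall i, 1 <= i <= g_k G -> pure_tmem_strategy G t i (env i)) ->
      zero_fixed_NE G t (combine s0 env) ->
      Qle (i_mu I) (Pay G (combine s0 env) 0).

Fixpoint pos_bits (p : positive) : list bool :=
  match p with
  | xH => [true]
  | xO q => false :: pos_bits q
  | xI q => true :: pos_bits q
  end.

Definition nat_bits (n : nat) : list bool :=
  match N.of_nat n with N0 => [] | Npos p => pos_bits p end.

(* self-delimiting binary encoding of a natural number *)
Definition enc_nat (n : nat) : list bool :=
  flat_map (fun b => [true; b]) (nat_bits n) ++ [false].

Definition enc_list {A} (e : A -> list bool) (l : list A) : list bool :=
  enc_nat (length l) ++ flat_map e l.

Definition enc_pair (vw : nat * nat) : list bool := enc_nat (fst vw) ++ enc_nat (snd vw).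

Definition enc_Z (z : Z) : list bool :=
  [Z.ltb z 0] ++ enc_nat (Z.abs_nat z).

Definition enc_Q (q : Q) : list bool := enc_Z (Qnum q) ++ enc_nat (Pos.to_nat (Qden q)).

Definition enc_game (G : Game) : list bool :=
  enc_nat (g_nv G) ++ enc_nat (g_k G) ++ enc_list enc_nat (g_owner G) ++
  enc_list enc_pair (g_edges G) ++ enc_nat (g_v0 G) ++
  enc_list (enc_list enc_nat) (g_targets G).

Definition enc_instance (I : Instance) : list bool :=
  enc_game (i_game I) ++ enc_Q (i_mu I) ++ enc_nat (i_t I).

Definition language := list bool -> Prop.

(* single-tape TM over tape alphabet {0,1,blank} (blank = None);
   states 0 .. tm_nst-1, start state 0, accepting state tm_acc;
   tm_delta q a = None means halt; Some (q', a', right?) otherwise. *)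
Record TM := {
  tm_nst   : nat;
  tm_delta : nat -> option bool -> option (nat * option bool * bool);
  tm_acc   : nat
}.

Definition wf_TM (M : TM) : Prop :=
  0 < tm_nst M /\ tm_acc M < tm_nst M /\
  forall q a q' a' d, q < tm_nst M -> tm_delta M q a = Some (q', a', d) -> q' < tm_nst M.

(* configuration: state, left part of tape (reversed), tape from the head on *)
Definition config := (nat * list (option bool) * list (option bool))%type.

Definition init_config (x : list bool) : config := (0, [], map Some x).

Definition step (M : TM) (c : config) : option config :=
  match c with
  | (q, L, R) =>
    match tm_delta M q (hd None R) with
    | None => None
    | Some (q', a, true) => Some (q', a :: L, tl R)
    | Some (q', a, false) =>
        match L with
        | [] => Some (q', [], a :: tl R)
        | b :: L' => Some (q', L', b :: a :: tl R)
        end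
    end
  end.

Fixpoint steps (M : TM) (n : nat) (c : config) : option config :=
  match n with
  | 0 => Some c
  | S m => match step M c with Some c' => steps M m c' | None => None end
  end.

Definition halted (M : TM) (c : config) : Prop := step M c = None.
Definition cstate (c : config) : nat := fst (fst c).
Definition cspace (c : config) : nat := length (snd (fst c)) + length (snd c) + 1.

Fixpoint output (R : list (option bool)) : list bool :=
  match R with Some b :: R' => b :: output R' | _ => [] end.

Definition poly (k n : nat) : nat := n ^ k + k.

Definition PSPACE (L : language) : Prop :=
  exists (M : TM) (k : nat), wf_TM M /\
    forall x, exists n c, steps M n (init_config x) = Some c /\ halted M c /\
      (cstate c = tm_acc M <-> L x) /\
      forall m c', m <= n -> steps M m (init_config x) = Some c' ->
        cspace c' <= poly k (length x).

Definition polytime_computable (f : list bool -> list bool) : Prop :=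
  exists (M : TM) (k : nat), wf_TM M /\
    forall x, exists n c, n <= poly k (length x) /\
      steps M n (init_config x) = Some c /\ halted M c /\ output (snd c) = f x.

Definition PSPACE_hard (L : language) : Prop :=
  forall L', PSPACE L' ->
    exists f, polytime_computable f /\ forall x, L' x <-> L (f x).

Definition tmem_TR_NNCRSP (c : nat) : language :=
  fun w => exists I, enc_instance I = w /\ wf_instance I /\
    i_t I <= c * g_nv (i_game I) /\ NNCRSP_answer I.

(* Main.v *)
(** A run of a space-bounded machine is a run of a one-dimensional cellular automaton on words of
    polynomial length [W], and it can be stopped after [2^m] steps, [m = g * W], because a
    deterministic run that reaches a fixed point at all does so within the number of words over
    [g] symbols.  Savitch's midpoint argument turns "the word reached after [2^m] steps is
    accepting" into an alternating game of polynomially many moves whose final condition is a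
    conjunction of clauses on the moves made.

    The clause game becomes a synthesis instance as follows.  Every possible move has a vertex
    owned by an environment player of its own, who may leave there for an exit terminal at which
    both that player and the system win.  After all moves, player 1 picks a clause and the play
    ends in the terminal of that clause; it is a win for every environment player except those
    whose move meets the clause.  If some move of the play meets the clause, its owner gains by
    leaving, so there is no equilibrium; otherwise nobody who loses was ever asked to move, and
    the play is an equilibrium that the system loses.  With memory as large as the number of
    vertices the strategies see the whole history.

    Polynomial time is established by compiling a small language of nested bounded loops that
    print numbers to a machine with finitely many string registers, and that machine to a
    one-tape Turing machine keeping the registers side by side, separated by blanks. *)
Require Import Defs.
From Stdlib Require Import List Arith NArith ZArith QArith Lia Bool.
From Stdlib Require Import Classical FunctionalExtensionality.
Import ListNotations.
Open Scope nat_scope.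

(** * Turing machines with an arbitrary finite state type *)

(** Moves of the environment become universal because player 1 wins at every clause terminal: on a
    play that ends there player 1 has nothing to gain, so every refutation found by the environment
    passes the equilibrium test. A reachability objective cannot mention the values chosen on the
    way; only a player standing for one move and one value can have a target that encodes which
    clauses this choice meets.

    A cellular automaton is used because its step is checked cell by cell against three neighbours,
    so that a clause has at most four literals. All clauses are indexed by a round, a position and
    one of a fixed number of templates. Move and clause numbers are then mixed-radix numbers: nested
    loops enumerate them in order, and the instance can be printed without being stored.

    The exponent [g * W] comes from [g ^ W <= 2 ^ (g * W)]. A play of the game is decided after at
    most [2 * P + 1] moves, fewer than there are vertices; hence memory [g_nv] forgets nothing that
    matters, and the constant in the bound on [t] is 1. *)

Section Numbering.
Context {St : Type} (St_eq : forall a b : St, {a = b} + {a <> b}).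
Context (dl : St -> option bool -> option (St * option bool * bool)).

Definition conf := (St * list (option bool) * list (option bool))%type.

Definition sstep (c : conf) : option conf :=
  match c with
  | (q, L, R) =>
    match dl q (hd None R) with
    | None => None
    | Some (q', a, true) => Some (q', a :: L, tl R)
    | Some (q', a, false) =>
        match L with
        | [] => Some (q', [], a :: tl R)
        | b :: L' => Some (q', L', b :: a :: tl R)
        end
    end
  end.

Fixpoint ssteps (n : nat) (c : conf) : option conf :=
  match n with
  | 0 => Some c
  | S m => match sstep c with Some c' => ssteps m c' | None => None end
  end.

Lemma ssteps_app n1 n2 c c1 :
  ssteps n1 c = Some c1 -> ssteps (n1 + n2) c = ssteps n2 c1.
Proof.
  revert c; induction n1 as [|n1 IH]; simpl; intros c H.
  - now injection H as ->.
  - destruct (sstep c); [now apply IH | discriminate].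
Qed.

Fixpoint idx (s : St) (l : list St) : nat :=
  match l with
  | [] => 0
  | x :: l' => if St_eq x s then 0 else S (idx s l')
  end.

Lemma idx_head s l : idx s (s :: l) = 0.
Proof. simpl. now destruct (St_eq s s). Qed.

Lemma idx_nth s l : In s l -> nth_error l (idx s l) = Some s.
Proof.
  induction l as [|x l IH]; simpl; [easy|].
  destruct (St_eq x s) as [->|Hn]; [easy|].
  intros [->|H]; [easy | now apply IH].
Qed.

Lemma idx_lt s l : In s l -> idx s l < length l.
Proof.
  intros H. apply nth_error_Some. now rewrite idx_nth.
Qed.

(** Machines start in state 0, so the intended initial state has to come first in [states]. *)
Definition numbered (states : list St) : TM := {|
  tm_nst := length states;
  tm_delta := fun q a =>
    match nth_error states q with
    | None => None
    | Some s =>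
      match dl s a with
      | None => None
      | Some (s', a', d) => Some (idx s' states, a', d)
      end
    end;
  tm_acc := 0 |}.

Definition dl_closed (states : list St) : Prop :=
  forall s a s' a' d, In s states -> dl s a = Some (s', a', d) -> In s' states.

Lemma numbered_wf states : states <> [] -> dl_closed states -> wf_TM (numbered states).
Proof.
  intros Hne Hc. assert (0 < length states) by (destruct states; simpl; [easy | lia]).
  split; [easy|]; split; [easy|].
  intros q a q' a' d Hq H0. simpl in *.
  destruct (nth_error states q) as [s|] eqn:E; [|discriminate].
  destruct (dl s a) as [[[s' b] e]|] eqn:E2; [|discriminate].
  injection H0 as <- <- <-. apply idx_lt. eapply Hc; [eapply nth_error_In|]; eauto.
Qed.

Lemma numbered_step states s L R : In s states ->
  step (numbered states) (idx s states, L, R) =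
  match sstep (s, L, R) with
  | Some (s', L', R') => Some (idx s' states, L', R')
  | None => None
  end.
Proof.
  intros H. unfold step, sstep. simpl. rewrite idx_nth by easy.
  destruct (dl s (hd None R)) as [[[s' b] []]|]; destruct L; easy.
Qed.

Lemma sstep_closed states s L R s' L' R' : dl_closed states -> In s states ->
  sstep (s, L, R) = Some (s', L', R') -> In s' states.
Proof.
  intros Hc Hi. unfold sstep.
  destruct (dl s (hd None R)) as [[[s1 b] []]|] eqn:E; destruct L; try discriminate;
    intros H; injection H as <- <- <-; eapply Hc; eauto.
Qed.

Lemma numbered_steps states : dl_closed states -> forall n s L R s' L' R', In s states ->
  ssteps n (s, L, R) = Some (s', L', R') ->
  steps (numbered states) n (idx s states, L, R) = Some (idx s' states, L', R') /\ In s' states.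
Proof.
  intros Hc. induction n as [|n IH]; intros s L R s' L' R' Hi H; cbn [steps ssteps] in *.
  - injection H as <- <- <-. easy.
  - rewrite (numbered_step states s L R Hi).
    destruct (sstep (s, L, R)) as [[[s1 L1] R1]|] eqn:E; [|discriminate].
    apply IH; [|exact H]. eapply sstep_closed; eauto.
Qed.
End Numbering.

(** * Tapes up to trailing blanks *)

Definition blank_eq (R R' : list (option bool)) : Prop :=
  forall j, nth j R None = nth j R' None.

Lemma hd_nth (R : list (option bool)) : hd None R = nth 0 R None.
Proof. now destruct R. Qed.

Lemma tl_nth (R : list (option bool)) j : nth j (tl R) None = nth (S j) R None.
Proof. destruct R; [now destruct j | easy]. Qed.

Lemma blank_eq_tl R R' : blank_eq R R' -> blank_eq (tl R) (tl R').
Proof. intros H j. now rewrite !tl_nth. Qed.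

Lemma blank_eq_cons a R R' : blank_eq R R' -> blank_eq (a :: R) (a :: R').
Proof. intros H [|j]; simpl; [easy | apply H]. Qed.

(** Reading past the end of the tape list yields blanks, so explicit trailing blanks are invisible
    to a run. This allows the simulation to assume the separators of the empty registers on a tape
    that holds the input only. *)
Lemma steps_blank_eq M n q L R R' q1 L1 R1 : blank_eq R R' ->
  steps M n (q, L, R) = Some (q1, L1, R1) ->
  exists R1', blank_eq R1 R1' /\ steps M n (q, L, R') = Some (q1, L1, R1').
Proof.
  revert q L R R'. induction n as [|n IH]; intros q L R R' He H.
  - injection H as <- <- <-. exists R'. easy.
  - cbn [steps] in *. unfold step in *.
    assert (Eh : hd None R = hd None R') by (rewrite !hd_nth; apply He).
    rewrite <- Eh. pose proof (blank_eq_tl _ _ He) as Ht.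
    destruct (tm_delta M q (hd None R)) as [[[q' a] []]|]; [| |discriminate].
    + eapply IH; eauto.
    + destruct L; eapply IH; eauto; repeat apply blank_eq_cons; easy.
Qed.

Lemma output_blank_eq R R' : blank_eq R R' -> output R = output R'.
Proof.
  revert R'. induction R as [|a R IH]; intros R' He.
  - destruct R' as [|[b|] R']; try easy. specialize (He 0). discriminate.
  - destruct R' as [|a' R'].
    + specialize (He 0). simpl in He. now subst a.
    + pose proof (He 0) as H0. simpl in H0. subst a'. destruct a; [|easy].
      simpl. f_equal. apply IH. intros j. apply (He (S j)).
Qed.

(** * Machines with string registers *)

Inductive cmd :=
| Skip
| Push (i : nat) (b : bool)
| Seq (c1 c2 : cmd)
| Pop (i : nat) (cE c0 c1 : cmd)
| While (i : nat) (c0 c1 : cmd).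

Definition store := nat -> list bool.

Definition upd (s : store) (i : nat) (w : list bool) : store :=
  fun j => if Nat.eqb j i then w else s j.

Inductive exec : cmd -> store -> store -> nat -> Prop :=
| XSkip s : exec Skip s s 1
| XPush i b s : exec (Push i b) s (upd s i (b :: s i)) 1
| XSeq c1 c2 s s1 s2 (t1 t2 : nat) :
    exec c1 s s1 t1 -> exec c2 s1 s2 t2 -> exec (Seq c1 c2) s s2 (1 + t1 + t2)
| XPopE i cE c0 c1 s s' (t : nat) :
    s i = [] -> exec cE s s' t -> exec (Pop i cE c0 c1) s s' (1 + t)
| XPopB i cE c0 c1 (b : bool) w s s' (t : nat) :
    s i = b :: w -> exec (if b then c1 else c0) (upd s i w) s' t ->
    exec (Pop i cE c0 c1) s s' (1 + t)
| XWhileE i c0 c1 s : s i = [] -> exec (While i c0 c1) s s 1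
| XWhileB i c0 c1 (b : bool) w s s1 s2 (t1 t2 : nat) :
    s i = b :: w -> exec (if b then c1 else c0) (upd s i w) s1 t1 ->
    exec (While i c0 c1) s1 s2 t2 -> exec (While i c0 c1) s s2 (1 + t1 + t2).

Fixpoint regs_below (N : nat) (c : cmd) : Prop :=
  match c with
  | Skip => True
  | Push i _ => i < N
  | Seq c1 c2 => regs_below N c1 /\ regs_below N c2
  | Pop i cE c0 c1 => i < N /\ regs_below N cE /\ regs_below N c0 /\ regs_below N c1
  | While i c0 c1 => i < N /\ regs_below N c0 /\ regs_below N c1
  end.

Fixpoint reg_bound (c : cmd) : nat :=
  match c with
  | Skip => 0
  | Push i _ => S i
  | Seq c1 c2 => reg_bound c1 + reg_bound c2
  | Pop i cE c0 c1 => S i + reg_bound cE + reg_bound c0 + reg_bound c1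
  | While i c0 c1 => S i + reg_bound c0 + reg_bound c1
  end.

Lemma regs_below_bound c N : reg_bound c <= N -> regs_below N c.
Proof.
  revert N; induction c; simpl; intros N H; repeat split; try lia;
    match goal with IH : _ |- regs_below _ _ => apply IH; lia end.
Qed.

(* Control states of the simulating machine: the continuation still to be run, and the phase
   of the primitive operation at its head.  [Ins] and [Del] shift the rest of the tape by one
   cell, carrying the displaced symbol; numbers count the blank separators still to cross. *)
Inductive micro :=
| Start
| Seek (n : nat)
| Ins (a : option bool) (n : nat)
| Turn
| Peek
| ToEnd (n : nat)
| Del (a : option bool) (n : nat)
| Back (n : nat).

Definition mstate := (list cmd * micro)%type.

Lemma mstate_eq (a b : mstate) : {a = b} + {a <> b}.
Proof. repeat decide equality. Defined.

(* The empty continuation makes the head walk to register 1, the output, and stop there. *)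
Definition head_reg (k : list cmd) : nat :=
  match k with
  | Push i _ :: _ | Pop i _ _ _ :: _ | While i _ _ :: _ => i
  | _ => 1
  end.

Definition on_done (k : list cmd) : list cmd :=
  match k with
  | Skip :: k' | Push _ _ :: k' => k'
  | _ => []
  end.

Definition on_empty (k : list cmd) : list cmd :=
  match k with
  | Pop _ cE _ _ :: k' => cE :: k'
  | While _ _ _ :: k' => k'
  | _ => []
  end.

Definition on_bit (b : bool) (k : list cmd) : list cmd :=
  match k with
  | Pop _ _ c0 c1 :: k' => (if b then c1 else c0) :: k'
  | While _ c0 c1 :: _ => (if b then c1 else c0) :: k
  | _ => []
  end.

(** In phase [Start], and when [Back] ends, the head is on cell 0, where a left move stays put; this
    is how the machine changes state without moving. [Del] learns the popped bit only at the end: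
    shifting symbols leftwards over the register, it arrives at the separator holding the bit that
    was squeezed out. *)
Definition mdelta (N : nat) (st : mstate) (a : option bool) : option (mstate * option bool * bool) :=
  let (k, mu) := st in
  match mu with
  | Start =>
      match k with
      | Skip :: k' => Some ((k', Start), a, false)
      | Seq c1 c2 :: k' => Some ((c1 :: c2 :: k', Start), a, false)
      | _ => Some ((k, Seek (head_reg k)), a, false)
      end
  | Seek n =>
      match a, n with
      | None, 0 =>
          Some ((k, match k with Push i b :: _ => Ins (Some b) (N - 1 - i) | _ => Peek end), a, true)
      | None, S n' => Some ((k, Seek n'), a, true)
      | Some _, _ => Some ((k, Seek n), a, true)
      end
  | Ins c n =>
      match a, n with
      | None, 0 => Some ((on_done k, Turn), c, true)
      | None, S n' => Some ((k, Ins a n'), c, true)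
      | Some _, _ => Some ((k, Ins a n), c, true)
      end
  | Turn => Some ((k, Back (N - 1)), a, false)
  | Peek =>
      match k, a with
      | [], _ => None
      | _, None => Some ((on_empty k, Back (head_reg k)), a, false)
      | _, Some _ => Some ((k, ToEnd (N - 1 - head_reg k)), a, true)
      end
  | ToEnd n =>
      match a, n with
      | None, 0 => Some ((k, Del None (N - 1 - head_reg k)), a, false)
      | None, S n' => Some ((k, ToEnd n'), a, true)
      | Some _, _ => Some ((k, ToEnd n), a, true)
      end
  | Del c n =>
      match a, n with
      | None, 0 =>
          let k' := on_bit (match c with Some b => b | None => false end) k in
          match head_reg k with
          | 0 => Some ((k', Start), a, false)
          | S i => Some ((k', Back i), a, false)
          end
      | None, S n' => Some ((k, Del a n'), c, false)
      | Some _, _ => Some ((k, Del a n), c, false)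
      end
  | Back n =>
      match a, n with
      | None, 0 => Some ((k, Start), a, false)
      | None, S n' => Some ((k, Back n'), a, false)
      | Some _, _ => Some ((k, Back n), a, false)
      end
  end.

(** The continuations that can arise while [c] runs on top of [k], until [k] itself is left. They
    are finitely many because a loop body returns to the very continuation its loop was started
    from, so nothing grows with the number of iterations. *)
Fixpoint subk (c : cmd) (k : list cmd) : list (list cmd) :=
  (c :: k) ::
  match c with
  | Skip | Push _ _ => []
  | Seq c1 c2 => subk c1 (c2 :: k) ++ subk c2 k
  | Pop _ cE c0 c1 => subk cE k ++ subk c0 k ++ subk c1 k
  | While _ c0 c1 => subk c0 (c :: k) ++ subk c1 (c :: k)
  end.

Definition succs (k : list cmd) : list (list cmd) :=
  match k with
  | [] => []
  | Skip :: k' | Push _ _ :: k' => [k']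
  | Seq c1 c2 :: k' => [c1 :: c2 :: k']
  | Pop _ cE c0 c1 :: k' => [cE :: k'; c0 :: k'; c1 :: k']
  | While _ c0 c1 :: k' => [k'; c0 :: k; c1 :: k]
  end.

Lemma subk_head c k : In (c :: k) (subk c k).
Proof. destruct c; left; reflexivity. Qed.

Lemma subk_succs c : forall k k1 k2, In k1 (subk c k) -> In k2 (succs k1) ->
  In k2 (subk c k) \/ k2 = k.
Proof.
  induction c; intros k k1 k2 H1 H2; simpl in H1;
    (destruct H1 as [<-|H1]; [simpl in H2|]).
  - intuition.
  - easy.
  - intuition.
  - easy.
  - destruct H2 as [<-|[]]. left. simpl. right. apply in_or_app. left. apply subk_head.
  - simpl. apply in_app_or in H1. destruct H1 as [H1|H1].
    + destruct (IHc1 _ _ _ H1 H2) as [H| ->].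
      * left. right. apply in_or_app; auto.
      * left. right. apply in_or_app. right. apply subk_head.
    + destruct (IHc2 _ _ _ H1 H2) as [H| ->]; [|auto]. left. right. apply in_or_app; auto.
  - left. simpl. right. rewrite !in_app_iff. 
    destruct H2 as [<-|[<-|[<-|[]]]]; auto using subk_head.
  - simpl. rewrite !in_app_iff in *. destruct H1 as [H1|[H1|H1]].
    + destruct (IHc1 _ _ _ H1 H2) as [H| ->]; auto.
    + destruct (IHc2 _ _ _ H1 H2) as [H| ->]; auto.
    + destruct (IHc3 _ _ _ H1 H2) as [H| ->]; auto.
  - simpl. rewrite !in_app_iff. destruct H2 as [<-|[<-|[<-|[]]]]; auto using subk_head.
  - simpl. rewrite !in_app_iff in *. destruct H1 as [H1|H1].
    + destruct (IHc1 _ _ _ H1 H2) as [H| ->]; auto.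
    + destruct (IHc2 _ _ _ H1 H2) as [H| ->]; auto.
Qed.

Lemma subk_regs N c : forall k k1, regs_below N c -> Forall (regs_below N) k ->
  In k1 (subk c k) -> Forall (regs_below N) k1.
Proof.
  induction c; intros k k1 Hc Hk H1; simpl in H1; (destruct H1 as [<-|H1]; [now constructor|]);
    simpl in Hc.
  - easy.
  - easy.
  - destruct Hc. apply in_app_or in H1. destruct H1 as [H1|H1].
    + eapply IHc1; [easy| |exact H1]. now constructor.
    + eapply IHc2; eauto.
  - rewrite !in_app_iff in H1. destruct H1 as [H1|[H1|H1]].
    + eapply IHc1; [| |exact H1]; tauto.
    + eapply IHc2; [| |exact H1]; tauto.
    + eapply IHc3; [| |exact H1]; tauto.
  - rewrite !in_app_iff in H1. destruct H1 as [H1|H1].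
    + eapply IHc1; [| |exact H1]; [tauto|]. constructor; simpl; tauto.
    + eapply IHc2; [| |exact H1]; [tauto|]. constructor; simpl; tauto.
Qed.

Definition micros (N : nat) : list micro :=
  [Start; Turn; Peek] ++
  flat_map (fun n => [Seek n; ToEnd n; Back n] ++
    flat_map (fun a => [Ins a n; Del a n]) [None; Some false; Some true]) (seq 0 N).

Lemma in_micros N mu : In mu (micros N) <->
  match mu with
  | Start | Turn | Peek => True
  | Seek n | ToEnd n | Back n | Ins _ n | Del _ n => n < N
  end.
Proof.
  unfold micros. split.
  - intros H. apply in_app_or in H. destruct H as [H|H].
    + simpl in H. now repeat (destruct H as [<-|H]; [easy|]).
    + apply in_flat_map in H. destruct H as [n [H1 H2]]. apply in_seq in H1.
      simpl in H2. repeat (destruct H2 as [<-|H2]; [lia|]). easy.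
  - intros H.
    assert (G : forall n, n < N -> In n (seq 0 N)) by (intros; apply in_seq; lia).
    destruct mu as [|n|a n| | |n|a n|n]; try (simpl; tauto); apply in_or_app; right;
      apply in_flat_map; exists n; (split; [now apply G|]); simpl; try tauto;
      destruct a as [[]|]; tauto.
Qed.

(** The input begins on cell 0, which has to become the separator of register 0: the first act is to
    insert a blank in front of it. The leading [Skip] is what [on_done] then discards, leaving [p]
    to run. *)
Definition mstart (N : nat) (p : cmd) : mstate := ([Skip; p], Ins None (N - 1)).

Definition mstates (N : nat) (p : cmd) : list mstate :=
  mstart N p :: list_prod (subk (Seq Skip p) [] ++ [[]]) (micros N).

Lemma in_mstates N p k mu : 0 < N ->
  In (k, mu) (mstates N p) <-> In k (subk (Seq Skip p) [] ++ [[]]) /\ In mu (micros N).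
Proof.
  intros HN. unfold mstates. split.
  - intros [H|H]; [|now apply in_prod_iff].
    injection H as <- <-. split; [simpl; tauto | apply in_micros; lia].
  - intros H. right. now apply in_prod_iff.
Qed.

Lemma mdelta_succs N k mu a k' mu' a' d : mdelta N (k, mu) a = Some ((k', mu'), a', d) ->
  k' = k \/ In k' (succs k) \/ k' = [].
Proof.
  destruct k as [|[] k]; destruct mu as [|n|o n| | |n|o n|n]; destruct a as [[]|]; simpl;
    try destruct n; simpl; try destruct i; simpl; intros H; try discriminate;
    injection H as <- <- <- <-; simpl; auto; destruct o as [[]|]; simpl; auto 6.
Qed.

Lemma mstates_closed N p : 1 < N -> regs_below N p -> dl_closed (mdelta N) (mstates N p).
Proof.
  intros HN Hp [k mu] a [k' mu'] a' d Hi H.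
  rewrite in_mstates in * by lia. destruct Hi as [Hk Hm]. split.
  - apply in_app_or in Hk. apply in_or_app.
    destruct (mdelta_succs _ _ _ _ _ _ _ _ H) as [->|[Hs| ->]]; [tauto| |simpl; tauto].
    destruct Hk as [Hk|[<-|[]]]; [|easy].
    destruct (subk_succs _ _ _ _ Hk Hs) as [?| ->]; simpl; tauto.
  - assert (Hr : head_reg k < N).
    { apply in_app_or in Hk. destruct Hk as [Hk|[<-|[]]]; [|simpl; lia].
      apply (subk_regs N) in Hk; [|simpl; tauto|constructor].
      destruct k as [|[] k]; simpl; try lia; inversion Hk; simpl in *; tauto. }
    apply in_micros. apply in_micros in Hm. clear Hk.
    destruct mu; simpl in H.
    + destruct k as [|[] k]; injection H as <- <- <- <-; easy.
    + destruct a; [|destruct n]; injection H as <- <- <- <-; try lia. destruct k as [|[] k]; lia.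
    + destruct a; [|destruct n]; injection H as <- <- <- <-; easy || lia.
    + injection H as <- <- <- <-. lia.
    + destruct k as [|c k]; [discriminate|]. destruct a; injection H as <- <- <- <-; cbn in *; lia.
    + destruct a; [|destruct n]; injection H as <- <- <- <-; lia.
    + destruct a; [|destruct n; [destruct (head_reg k)|]]; injection H as <- <- <- <-; easy || lia.
    + destruct a; [|destruct n]; injection H as <- <- <- <-; easy || lia.
Qed.

(** * Layout of the registers on the tape *)

Fixpoint nones (u : list (option bool)) : nat :=
  match u with
  | [] => 0
  | None :: u' => S (nones u')
  | Some _ :: u' => nones u'
  end.

Lemma nones_app u v : nones (u ++ v) = nones u + nones v.
Proof. induction u as [|[]]; simpl; congruence. Qed.

Lemma nones_rev u : nones (rev u) = nones u.
Proof. induction u as [|[] u IH]; simpl; rewrite ?nones_app, ?IH; simpl; lia. Qed.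

Lemma nones_some w : nones (map Some w) = 0.
Proof. induction w; simpl; auto. Qed.

Definition tape (l : list (list bool)) : list (option bool) :=
  flat_map (fun w => None :: map Some w) l.

Lemma nones_tape l : nones (tape l) = length l.
Proof.
  induction l as [|w l IH]; [easy|]. cbn. fold (tape l). now rewrite nones_app, nones_some, IH.
Qed.

Lemma tape_app l1 l2 : tape (l1 ++ l2) = tape l1 ++ tape l2.
Proof. apply flat_map_app. Qed.

Definition blanks (m : nat) : list (option bool) := repeat None m.

Lemma hd_blanks m : hd None (blanks m) = None.
Proof. now destruct m. Qed.

Lemma tl_blanks m : tl (blanks m) = blanks (m - 1).
Proof. destruct m; [easy|]. simpl. now rewrite Nat.sub_0_r. Qed.

Definition stape (N : nat) (s : store) : list (option bool) := tape (map s (seq 0 N)).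

Lemma map_upd_notin s i w l : ~ In i l -> map (upd s i w) l = map s l.
Proof.
  intros H. apply map_ext_in. intros j Hj. unfold upd.
  destruct (Nat.eqb_spec j i); [now subst | easy].
Qed.

(** The same [pre] and [post] serve for every content of register [i], so one splitting describes
    the tape before and after an operation on it. *)
Lemma stape_split N s i : i < N -> exists pre post,
  nones pre = i /\ nones post = N - 1 - i /\
  (forall w, stape N (upd s i w) = pre ++ None :: map Some w ++ post) /\
  (pre = [] \/ exists pre', pre = None :: pre') /\
  (post = [] \/ exists post', post = None :: post') /\
  stape N s = pre ++ None :: map Some (s i) ++ post.
Proof.
  intros Hi. exists (tape (map s (seq 0 i))), (tape (map s (seq (S i) (N - 1 - i)))).
  assert (E : seq 0 N = seq 0 i ++ i :: seq (S i) (N - 1 - i)).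
  { replace N with (i + S (N - 1 - i)) at 1 by lia. now rewrite seq_app. }
  rewrite !nones_tape, !length_map, !length_seq. repeat split.
  - intros w. unfold stape. rewrite E, map_app, tape_app. simpl map at 2.
    rewrite !map_upd_notin by (rewrite in_seq; lia).
    unfold upd at 1. rewrite Nat.eqb_refl. reflexivity.
  - destruct (seq 0 i); [now left | right; simpl; eauto].
  - destruct (seq (S i) _); [now left | right; simpl; eauto].
  - unfold stape. rewrite E, map_app, tape_app. reflexivity.
Qed.

(** * Runs of the simulating machine and their lengths *)

Section Runs.
Context (N : nat).
Notation dl := (mdelta N).
Notation msteps := (ssteps dl).

(** Here [v] is the scanned cell followed by the cells to its left. This is the shape after a left
    move, including the one at cell 0, where [v] is empty and the head stays on [R]. *)
Definition lconf (st : mstate) (v R : list (option bool)) : conf :=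
  match v with
  | [] => (st, [], R)
  | a :: v' => (st, v', a :: R)
  end.

Definition reach (B : nat) (c c' : conf) : Prop := exists n, n <= B /\ msteps n c = Some c'.

Lemma reach_trans B1 B2 c c1 c2 : reach B1 c c1 -> reach B2 c1 c2 -> reach (B1 + B2) c c2.
Proof.
  intros [n1 [H1 E1]] [n2 [H2 E2]]. exists (n1 + n2). split; [lia|].
  now rewrite (ssteps_app _ _ _ _ _ E1).
Qed.

Lemma reach_le B B' c c' : B <= B' -> reach B c c' -> reach B' c c'.
Proof. intros H [n [H1 E1]]. exists n. split; [lia | easy]. Qed.

Lemma reach_refl c : reach 0 c c.
Proof. now exists 0. Qed.

Lemma reach_right st L R st' a : dl st (hd None R) = Some (st', a, true) ->
  reach 1 (st, L, R) (st', a :: L, tl R).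
Proof. intros H. exists 1. split; [lia|]. simpl. now rewrite H. Qed.

Lemma reach_left st L R st' a : dl st (hd None R) = Some (st', a, false) ->
  reach 1 (st, L, R) (lconf st' L (a :: tl R)).
Proof. intros H. exists 1. split; [lia|]. simpl. rewrite H. now destruct L. Qed.

Lemma reach_lleft st v x R st' a : dl st x = Some (st', a, false) ->
  reach 1 (lconf st (x :: v) R) (lconf st' v (a :: R)).
Proof. intros H. now apply (reach_left st v (x :: R)). Qed.

Lemma seek_run k u : forall n L R,
  reach (length u) ((k, Seek (nones u + n)), L, u ++ R) ((k, Seek n), rev u ++ L, R).
Proof.
  induction u as [|a u IH]; intros n L R; [apply reach_refl|].
  apply (reach_trans 1 (length u) _ ((k, Seek (nones u + n)), a :: L, u ++ R)).
  - apply (reach_right _ _ ((a :: u) ++ R)). now destruct a.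
  - simpl. rewrite <- app_assoc. apply IH.
Qed.

Lemma toend_run k u : forall n L R,
  reach (length u) ((k, ToEnd (nones u + n)), L, u ++ R) ((k, ToEnd n), rev u ++ L, R).
Proof.
  induction u as [|a u IH]; intros n L R; [apply reach_refl|].
  apply (reach_trans 1 (length u) _ ((k, ToEnd (nones u + n)), a :: L, u ++ R)).
  - apply (reach_right _ _ ((a :: u) ++ R)). now destruct a.
  - simpl. rewrite <- app_assoc. apply IH.
Qed.

Lemma ins_run k u : forall a n L m, nones u = n ->
  reach (S (length u)) ((k, Ins a n), L, u ++ blanks m)
    ((on_done k, Turn), rev (a :: u) ++ L, blanks (m - 1)).
Proof.
  induction u as [|b u IH]; intros a n L m Hn.
  - simpl in Hn. subst n. simpl. rewrite <- tl_blanks. apply reach_right.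
    rewrite hd_blanks. easy.
  - apply (reach_trans 1 (S (length u)) _ ((k, Ins b (nones u)), a :: L, u ++ blanks m)).
    + apply (reach_right _ _ ((b :: u) ++ blanks m)). subst n. now destruct b.
    + specialize (IH b (nones u) (a :: L) m eq_refl). simpl in *.
      rewrite <- !app_assoc in *. simpl in *. exact IH.
Qed.

Lemma back_run k v : forall n R, nones v = n ->
  reach (S (length v)) (lconf (k, Back n) (v ++ [None]) R) ((k, Start), [], None :: rev v ++ R).
Proof.
  induction v as [|a v IH]; intros n R Hn.
  - simpl in Hn. subst n. apply (reach_lleft (k, Back 0) [] None). easy.
  - apply (reach_trans 1 (S (length v)) _ (lconf (k, Back (nones v)) (v ++ [None]) (a :: R))).
    + apply (reach_lleft _ (v ++ [None]) a). subst n. now destruct a.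
    + simpl. rewrite <- app_assoc. apply IH. reflexivity.
Qed.

Lemma del_run k v : forall a n L R,
  reach (length v) (lconf (k, Del a (nones v + n)) (v ++ None :: L) R)
    (lconf (k, Del (last (a :: v) None) n) (None :: L) (rev (removelast (a :: v)) ++ R)).
Proof.
  induction v as [|b v IH]; intros a n L R; [apply reach_refl|].
  apply (reach_trans 1 (length v) _
    (lconf (k, Del b (nones v + n)) (v ++ None :: L) (a :: R))).
  - apply (reach_lleft _ (v ++ None :: L) b). now destruct b.
  - specialize (IH b n L (a :: R)).
    change (last (a :: b :: v) None) with (last (b :: v) None).
    change (removelast (a :: b :: v)) with (a :: removelast (b :: v)).
    simpl rev. rewrite <- app_assoc. exact IH.
Qed.

Lemma back_home k u n R : nones u = S n -> (exists u', u = None :: u') ->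
  reach (length u) (lconf (k, Back n) (rev u) R) ((k, Start), [], u ++ R).
Proof.
  intros Hn [u' ->]. simpl. pose proof (back_run k (rev u') n R) as H.
  rewrite length_rev, nones_rev, rev_involutive in H. apply H. now injection Hn.
Qed.

Lemma turn_run k u m : nones u = N -> 0 < N -> (exists u', u = None :: u') ->
  exists m', reach (S (length u)) ((k, Turn), rev u, blanks m) ((k, Start), [], u ++ blanks m').
Proof.
  intros Hn HN Hu. exists (S (m - 1)).
  apply (reach_trans 1 (length u) _ (lconf (k, Back (N - 1)) (rev u) (None :: blanks (m - 1)))).
  - rewrite <- tl_blanks. apply reach_left. rewrite hd_blanks. easy.
  - apply back_home; [lia | easy].
Qed.

Definition at_home (k : list cmd) (s : store) (m : nat) : conf :=
  ((k, Start), [], stape N s ++ blanks m).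

(** Covers the empty continuation as well: the walk to register 1 is the final phase, which parks
    the head on the output. *)
Lemma seek_reg k s m pre post i w : head_reg k = i ->
  (match k with Skip :: _ | Seq _ _ :: _ => False | _ => True end) ->
  stape N s = pre ++ None :: map Some w ++ post ->
  (pre = [] \/ exists pre', pre = None :: pre') -> nones pre = i ->
  reach (length pre + 2) (at_home k s m)
    ((k, match k with Push i b :: _ => Ins (Some b) (N - 1 - i) | _ => Peek end),
     None :: rev pre, map Some w ++ post ++ blanks m).
Proof.
  intros Hi Hk Es Hpre Hn. unfold at_home. rewrite Es.
  replace (length pre + 2) with (1 + (length pre + 1)) by lia.
  eapply reach_trans; [|eapply reach_trans].
  - apply (reach_left _ _ _ (k, Seek i) None).
    replace (hd None _) with (@None bool).
    + rewrite <- Hi. now destruct k as [|[] k].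
    + destruct Hpre as [->|[pre' ->]]; reflexivity.
  - unfold lconf. rewrite <- app_assoc.
    replace (None :: tl _) with (pre ++ (None :: map Some w ++ post) ++ blanks m)
      by (destruct Hpre as [->|[pre' ->]]; reflexivity).
    replace i with (nones pre + 0) by lia. apply seek_run.
  - rewrite app_nil_r. simpl. rewrite <- app_assoc.
    apply (reach_right (k, Seek 0) (rev pre) (None :: map Some w ++ post ++ blanks m)).
    reflexivity.
Qed.

Lemma push_run i b k s m : i < N -> exists m',
  reach (2 * length (stape N s) + 6) (at_home (Push i b :: k) s m)
    (at_home k (upd s i (b :: s i)) m').
Proof.
  intros Hi. destruct (stape_split N s i Hi) as (pre & post & H1 & H2 & H3 & H4 & H5 & H6).
  specialize (H3 (b :: s i)).
  destruct (turn_run k (stape N (upd s i (b :: s i))) (m - 1)) as [m' Hm'].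
  { unfold stape. now rewrite nones_tape, length_map, length_seq. }
  { lia. }
  { rewrite H3. destruct H4 as [->|[pre' ->]]; simpl; eauto. }
  exists m'. 
  eapply reach_le; [|eapply reach_trans; [|eapply reach_trans]].
  2: { eapply seek_reg; eauto; simpl; auto. }
  2: { rewrite app_assoc. apply ins_run. rewrite nones_app, nones_some. lia. }
  2: { simpl on_done.
       replace (rev (Some b :: map Some (s i) ++ post) ++ None :: rev pre)
         with (rev (stape N (upd s i (b :: s i)))).
       - exact Hm'.
       - rewrite H3, rev_app_distr. simpl. now rewrite <- !app_assoc. }
  rewrite H3, H6. repeat (rewrite ?length_app, ?length_map; simpl). lia.
Qed.

Lemma pop_empty_run i k s m : i < N -> s i = [] -> head_reg k = i ->
  (match k with Pop _ _ _ _ :: _ | While _ _ _ :: _ => True | _ => False end) ->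
  exists m', reach (2 * length (stape N s) + 6) (at_home k s m) (at_home (on_empty k) s m').
Proof.
  intros Hi Hs Hk Hk'.
  destruct (stape_split N s i Hi) as (pre & post & H1 & H2 & _ & H4 & H5 & H6).
  assert (Hm : exists m', None :: tl (post ++ blanks m) = post ++ blanks m' /\
                 hd None (post ++ blanks m) = None).
  { destruct H5 as [->|[post' ->]]; simpl.
    - exists (S (m - 1)). rewrite tl_blanks, hd_blanks. easy.
    - now exists m. }
  destruct Hm as [m' [Em Eh]]. exists m'. rewrite Hs in H6. simpl in H6.
  eapply reach_le; [|eapply reach_trans; [|eapply reach_trans]].
  2: { eapply (seek_reg k s m pre post i []); eauto. now destruct k as [|[] k]. }
  2: { apply (reach_left _ _ _ (on_empty k, Back i) None). simpl. rewrite Eh.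
       subst i. destruct k as [|[] k]; easy. }
  2: { simpl app. rewrite Em.
       replace (None :: rev pre) with (rev (pre ++ [None])) by (now rewrite rev_app_distr).
       replace (at_home (on_empty k) s m')
         with ((on_empty k, Start), @nil (option bool), (pre ++ [None]) ++ (post ++ blanks m')).
       - apply back_home.
         + rewrite nones_app, H1. simpl. lia.
         + destruct H4 as [->|[pre' ->]]; simpl; eauto.
       - unfold at_home. rewrite H6. now rewrite <- !app_assoc. }
  rewrite H6. repeat (rewrite ?length_app, ?length_map; simpl). lia.
Qed.

Lemma pop_bit_run i b w k s m : i < N -> s i = b :: w -> head_reg k = i ->
  (match k with Pop _ _ _ _ :: _ | While _ _ _ :: _ => True | _ => False end) ->
  exists m', reach (3 * length (stape N s) + 6) (at_home k s m)
    (at_home (on_bit b k) (upd s i w) m').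
Proof.
  intros Hi Hs Hk Hk'.
  destruct (stape_split N s i Hi) as (pre & post & H1 & H2 & H3 & H4 & H5 & H6).
  specialize (H3 w). rewrite Hs in H6.
  set (u := map Some w ++ post) in *.
  assert (Hu : nones u = N - 1 - i) by (unfold u; rewrite nones_app, nones_some; lia).
  exists (S (S (m - 1))).
  eapply reach_le; [|eapply reach_trans; [|eapply reach_trans; [|eapply reach_trans;
    [|eapply reach_trans; [|eapply reach_trans; [|eapply reach_trans]]]]]].
  2: { eapply (seek_reg k s m pre post i (b :: w)); eauto. now destruct k as [|[] k]. }
  2: { apply (reach_right _ _ _ (k, ToEnd (N - 1 - i)) (Some b)).
       subst i. destruct k as [|[] k]; easy. }
  2: { simpl tl. rewrite app_assoc. fold u.
       replace (N - 1 - i) with (nones u + 0) by lia. apply toend_run. }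
  2: { apply (reach_left _ _ _ (k, Del None (N - 1 - i)) None). rewrite hd_blanks. now subst i. }
  2: { rewrite tl_blanks.
       replace (rev u ++ Some b :: None :: rev pre)
         with ((rev u ++ [Some b]) ++ None :: rev pre) by (now rewrite <- app_assoc).
       replace (N - 1 - i) with (nones (rev u ++ [Some b]) + 0)
         by (rewrite nones_app, nones_rev; simpl; lia).
       apply del_run. }
  2: { replace (last (None :: rev u ++ [Some b]) None) with (Some b)
         by (rewrite app_comm_cons, last_last; reflexivity).
       rewrite app_comm_cons, removelast_last.
       apply (reach_lleft (k, Del (Some b) 0) (rev pre) None _
         (on_bit b k, match i with 0 => Start | S i' => Back i' end) None).
       simpl. rewrite Hk. destruct i; reflexivity. }
  2: { instantiate (1 := length pre).
       replace (None :: rev (None :: rev u) ++ None :: blanks (m - 1))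
         with (None :: u ++ blanks (S (S (m - 1))))
         by (simpl; rewrite rev_involutive, <- app_assoc; reflexivity).
       replace (at_home (on_bit b k) (upd s i w) (S (S (m - 1))))
         with ((on_bit b k, Start), @nil (option bool), pre ++ (None :: u ++ blanks (S (S (m - 1))))).
       (* Register 0 is special: its separator is cell 0, so the deletion already ends at home. *)
       - destruct H4 as [->|[pre' ->]].
         + simpl in H1. subst i. destruct (head_reg k); [|easy]. apply reach_refl.
         + destruct i as [|i']; [easy|]. apply back_home; [easy | eauto].
       - unfold at_home. rewrite H3. fold u. now rewrite <- !app_assoc. }
  rewrite H6. unfold u. repeat (rewrite ?length_app, ?length_rev, ?length_map; simpl). lia.
Qed.

Lemma stape_upd_length s i w : i < N ->
  length (stape N (upd s i w)) + length (s i) = length (stape N s) + length w.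
Proof.
  intros Hi. destruct (stape_split N s i Hi) as (pre & post & _ & _ & H3 & _ & _ & H6).
  rewrite H3, H6. repeat (rewrite ?length_app, ?length_map; simpl). lia.
Qed.

(** A unit of time adds at most one symbol, so the running time bounds the growth of the tape. *)
Lemma exec_length c s s' t : exec c s s' t -> regs_below N c ->
  length (stape N s') <= length (stape N s) + t.
Proof.
  induction 1; simpl; intros Hr.
  - lia.
  - pose proof (stape_upd_length s i (b :: s i) Hr). simpl in *. lia.
  - specialize (IHexec1 ltac:(tauto)). specialize (IHexec2 ltac:(tauto)). lia.
  - specialize (IHexec ltac:(tauto)). lia.
  - specialize (IHexec ltac:(destruct b; tauto)).
    pose proof (stape_upd_length s i w ltac:(tauto)) as E. rewrite H in E. simpl in E. lia.
  - lia.
  - specialize (IHexec1 ltac:(destruct b; tauto)). specialize (IHexec2 Hr).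
    pose proof (stape_upd_length s i w ltac:(tauto)) as E. rewrite H in E. simpl in E. lia.
Qed.

Lemma stall_run c k' k s m : 0 < N -> mdelta N (c :: k, Start) None = Some ((k', Start), None, false) ->
  reach 1 (at_home (c :: k) s m) (at_home k' s m).
Proof.
  intros HN H. unfold at_home.
  assert (E : exists u, stape N s ++ blanks m = None :: u).
  { unfold stape. destruct N; [lia|]. simpl. eauto. }
  destruct E as [u ->].
  apply (reach_left (c :: k, Start) [] (None :: u) (k', Start) None). exact H.
Qed.

(** A primitive operation costs at most three sweeps of the tape and a constant, and the tape never
    exceeds its initial length by more than [t]. *)
Lemma exec_run c s s' t : exec c s s' t -> regs_below N c -> 0 < N -> forall k m, exists m',
  reach (t * (3 * (length (stape N s) + t) + 6)) (at_home (c :: k) s m) (at_home k s' m').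
Proof.
  intros He Hr HN. revert Hr. induction He; intros Hr k m.
  - exists m. eapply reach_le; [|apply stall_run; auto]. lia.
  - destruct (push_run i b k s m Hr) as [m' H]. exists m'. eapply reach_le; [|exact H]. lia.
  - destruct (IHHe1 (proj1 Hr) (c2 :: k) m) as [m1 H1].
    destruct (IHHe2 (proj2 Hr) k m1) as [m2 H2]. exists m2.
    pose proof (exec_length _ _ _ _ He1 (proj1 Hr)).
    eapply reach_le; [|eapply reach_trans; [|eapply reach_trans; [exact H1|exact H2]]].
    2: { apply stall_run; auto. }
    nia.
  - simpl in Hr.
    destruct (pop_empty_run i (Pop i cE c0 c1 :: k) s m) as [m1 H1]; simpl; try tauto.
    destruct (IHHe ltac:(tauto) k m1) as [m2 H2]. exists m2.
    eapply reach_le; [|eapply reach_trans; [exact H1|exact H2]]. nia.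
  - simpl in Hr.
    destruct (pop_bit_run i b w (Pop i cE c0 c1 :: k) s m) as [m1 H1]; simpl; try tauto.
    destruct (IHHe ltac:(destruct b; tauto) k m1) as [m2 H2]. exists m2.
    pose proof (stape_upd_length s i w ltac:(tauto)) as E. rewrite H in E. simpl in E.
    eapply reach_le; [|eapply reach_trans; [exact H1|exact H2]]. nia.
  - simpl in Hr.
    destruct (pop_empty_run i (While i c0 c1 :: k) s m) as [m1 H1]; simpl; try tauto.
    exists m1. eapply reach_le; [|exact H1]. nia.
  - pose proof Hr as Hr'. simpl in Hr.
    destruct (pop_bit_run i b w (While i c0 c1 :: k) s m) as [m1 H1]; simpl; try tauto.
    destruct (IHHe1 ltac:(destruct b; tauto) (While i c0 c1 :: k) m1) as [m2 H2].
    destruct (IHHe2 Hr' k m2) as [m3 H3]. exists m3.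
    pose proof (stape_upd_length s i w ltac:(tauto)) as E. rewrite H in E. simpl in E.
    pose proof (exec_length _ _ _ _ He1 ltac:(destruct b; tauto)).
    eapply reach_le; [|eapply reach_trans; [exact H1|eapply reach_trans; [exact H2|exact H3]]]. nia.
Qed.
End Runs.

(** * Polynomial bounds *)

Definition poly_bounded (F : nat -> nat) : Prop := exists k, forall n, F n <= (n + 2) ^ k.

Lemma pow2_gt n : n < 2 ^ n.
Proof. apply Nat.pow_gt_lin_r. lia. Qed.

Lemma poly_bounded_const c : poly_bounded (fun _ => c).
Proof.
  exists c. intros n. pose proof (pow2_gt c).
  pose proof (Nat.pow_le_mono_l 2 (n + 2) c ltac:(lia)). lia.
Qed.

Lemma poly_bounded_id : poly_bounded (fun n => n).
Proof. exists 1. intros n. simpl. lia. Qed.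

Lemma poly_bounded_mul F G : poly_bounded F -> poly_bounded G -> poly_bounded (fun n => F n * G n).
Proof.
  intros [a Ha] [b Hb]. exists (a + b). intros n. rewrite Nat.pow_add_r. now apply Nat.mul_le_mono.
Qed.

(** The base [n + 2] is at least 2, so one more power absorbs a sum; this is why no coefficients
    appear in [poly_bounded]. *)
Lemma poly_bounded_add F G : poly_bounded F -> poly_bounded G -> poly_bounded (fun n => F n + G n).
Proof.
  intros [a Ha] [b Hb]. exists (S (a + b)). intros n. specialize (Ha n). specialize (Hb n).
  pose proof (Nat.pow_le_mono_r (n + 2) a (a + b) ltac:(lia) ltac:(lia)).
  pose proof (Nat.pow_le_mono_r (n + 2) b (a + b) ltac:(lia) ltac:(lia)).
  simpl. nia.
Qed.

Lemma poly_bounded_pow k : poly_bounded (fun n => (n + 2) ^ k).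
Proof. now exists k. Qed.

Lemma poly_bounded_comp F k : poly_bounded F -> poly_bounded (fun n => (F n + 2) ^ k).
Proof.
  intros HF. induction k as [|k IH].
  - apply (poly_bounded_const 1).
  - apply poly_bounded_mul; [|exact IH].
    apply poly_bounded_add; [easy | apply poly_bounded_const].
Qed.

Lemma poly_bounded_poly F : poly_bounded F -> exists k, forall n, F n <= poly k n.
Proof.
  intros [k Hk]. exists (2 * k + 3 ^ k). intros n. unfold poly.
  (* From 2 on, [n + 2 <= n ^ 2] trades the shifted base for a doubled exponent; the additive term
     [3 ^ k] pays for [n <= 1]. *)
  destruct (le_lt_dec n 1) as [Hn|Hn].
  - pose proof (Nat.pow_le_mono_l (n + 2) 3 k ltac:(lia)). specialize (Hk n). lia.
  - pose proof (Nat.pow_le_mono_l (n + 2) (n ^ 2) k ltac:(simpl; nia)) as H.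
    rewrite <- Nat.pow_mul_r in H.
    pose proof (Nat.pow_le_mono_r n (2 * k) (2 * k + 3 ^ k) ltac:(lia) ltac:(lia)).
    specialize (Hk n). lia.
Qed.

Ltac poly_bound := repeat first
  [ apply poly_bounded_const | apply poly_bounded_id | apply poly_bounded_pow
  | apply poly_bounded_add | apply poly_bounded_mul | apply poly_bounded_comp | eassumption ].

Definition init_store (x : list bool) : store := fun j => if Nat.eqb j 0 then x else [].

Lemma stape_init N x : 0 < N -> stape N (init_store x) = None :: map Some x ++ blanks (N - 1).
Proof.
  intros HN. destruct N as [|N]; [lia|]. unfold stape, tape. simpl. f_equal. f_equal.
  rewrite Nat.sub_0_r.
  assert (G : forall m l, 0 < m ->
    flat_map (fun w => None :: map Some w) (map (init_store x) (seq m l)) = blanks l).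
  { intros m l; revert m; induction l as [|l IH]; intros m Hm; [easy|]. simpl.
    unfold init_store at 1. destruct (Nat.eqb_spec m 0); [lia|]. simpl.
    change (blanks (S l)) with (None :: blanks l). f_equal. apply IH. lia. }
  apply G. lia.
Qed.

Lemma nones_blanks m : nones (blanks m) = m.
Proof. unfold blanks. induction m; simpl; congruence. Qed.

Lemma blank_eq_blanks u m : blank_eq u (u ++ blanks m).
Proof.
  intros j. destruct (le_lt_dec (length u) j) as [H|H].
  - rewrite app_nth2, nth_overflow by easy. symmetry. unfold blanks.
    destruct (le_lt_dec m (j - length u)).
    + apply nth_overflow. rewrite repeat_length. easy.
    + now apply nth_repeat_lt.
  - now rewrite app_nth1.
Qed.

Lemma output_some w post : hd None post = None -> output (map Some w ++ post) = w.
Proof.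
  intros H. induction w; simpl; [|congruence]. destruct post as [|[]]; easy.
Qed.

Lemma exec_polytime (p : cmd) (f : list bool -> list bool) (T : nat -> nat) :
  poly_bounded T ->
  (forall x, exists s t, exec p (init_store x) s t /\ s 1 = f x /\ t <= T (length x)) ->
  polytime_computable f.
Proof.
  intros HT Hp. set (N := 2 + reg_bound p).
  assert (HN : 1 < N) by (unfold N; lia).
  assert (Hr : regs_below N p) by (apply regs_below_bound; unfold N; lia).
  (* The four summands pay for inserting the first blank, going home, running [p], and walking to
     the output register. *)
  set (F := fun n => (n + N + 3) + (n + N + 3) + T n * (3 * (n + N + T n) + 6) + (n + N + T n + 2)).
  assert (HF : poly_bounded F) by (unfold F; poly_bound).
  destruct (poly_bounded_poly F HF) as [k Hk].
  exists (numbered mstate_eq (mdelta N) (mstates N p)), k. split.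
  { apply numbered_wf; [easy | now apply mstates_closed]. }
  intros x. destruct (Hp x) as (s & t & He & Hs & Ht).
  pose proof (stape_init N x ltac:(lia)) as Ei.
  set (u := map Some x ++ blanks (N - 1)) in *.
  assert (Hu : nones u = N - 1) by (unfold u; rewrite nones_app, nones_some, nones_blanks; lia).
  assert (Hl : length u = length x + (N - 1))
    by (unfold u, blanks; rewrite length_app, length_map, repeat_length; easy).
  pose proof (ins_run N [Skip; p] u None (N - 1) [] 0 Hu) as R1.
  destruct (turn_run N [p] (None :: u) 0) as [m1 R2]; [simpl; lia | lia | eauto |].
  destruct (exec_run N p _ _ _ He Hr ltac:(lia) [] m1) as [m2 R3].
  destruct (stape_split N s 1 HN) as (pre & post & H1 & H2 & _ & H4 & H5 & H6).
  pose proof (seek_reg N [] s m2 pre post 1 (s 1) eq_refl I H6 H4 H1) as R4.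
  unfold at_home in R3 at 1. rewrite Ei in R3.
  simpl on_done in R1. rewrite app_nil_r in R1. simpl blanks in R1. rewrite app_nil_r in R1.
  pose proof (reach_trans _ _ _ _ _ _ R1 R2) as Q.
  pose proof (reach_trans _ _ _ _ _ _ Q R3) as Q'.
  pose proof (reach_trans _ _ _ _ _ _ Q' R4) as [n [Hn E]]. clear R1 R2 R3 R4 Q Q'.
  simpl in E.
  destruct (numbered_steps mstate_eq (mdelta N) (mstates N p) (mstates_closed N p HN Hr)
    _ _ _ _ _ _ _ (or_introl eq_refl) E) as [E' Hin].
  (* The genuine initial tape ends with the input, without the [N - 1] blanks that the layout writes
     out. *)
  destruct (steps_blank_eq _ _ _ _ u (map Some x) _ _ _
    (fun j => eq_sym (blank_eq_blanks (map Some x) (N - 1) j)) E') as [R' [HR' E'']].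
  exists n. eexists. split; [|split; [|split]].
  - eapply Nat.le_trans; [exact Hn|]. eapply Nat.le_trans; [|apply Hk].
    pose proof (exec_length N _ _ _ _ He Hr) as Hlen. rewrite Ei, H6 in Hlen.
    repeat (rewrite ?length_app, ?length_map in Hlen; simpl in Hlen). cbn [length]. unfold F.
    pose proof (Nat.mul_le_mono t (T (length x)) (3 * (S (length u) + t) + 6)
      (3 * (length x + N + T (length x)) + 6) ltac:(lia) ltac:(lia)). lia.
  - assert (E0 : idx mstate_eq (mstart N p) (mstates N p) = 0)
      by apply idx_head.
    rewrite E0 in E''. exact E''.
  - unfold halted. rewrite (numbered_step mstate_eq (mdelta N) (mstates N p)); easy.
  - rewrite <- Hs. simpl snd. rewrite <- (output_blank_eq _ _ HR'). apply output_some.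
    destruct H5 as [->|[post' ->]]; [apply hd_blanks | easy].
Qed.

(** * A loop language for printing numbers *)

(* [EVar l] is the variable bound by the [l]-th enclosing loop, counted from the outermost. *)
Inductive expr :=
| ECst (c : nat)
| ELen
| EVar (l : nat)
| EAdd (e1 e2 : expr)
| ESub (e1 e2 : expr)
| ESum (e b : expr)
| EIfZ (e e1 e2 : expr)
| EBit (e : expr).

Inductive gen :=
| GNil
| GNat (e : expr)
| GSeq (g1 g2 : gen)
| GFor (e : expr) (g : gen).

Fixpoint eval (x : list bool) (env : list nat) (e : expr) : nat :=
  match e with
  | ECst c => c
  | ELen => length x
  | EVar l => nth l env 0
  | EAdd e1 e2 => eval x env e1 + eval x env e2
  | ESub e1 e2 => eval x env e1 - eval x env e2
  | ESum e b => list_sum (map (fun v => eval x (env ++ [v]) b) (seq 0 (eval x env e)))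
  | EIfZ e e1 e2 => if Nat.eqb (eval x env e) 0 then eval x env e1 else eval x env e2
  | EBit e => if nth (eval x env e) x false then 1 else 0
  end.

Fixpoint emit (x : list bool) (env : list nat) (g : gen) : list bool :=
  match g with
  | GNil => []
  | GNat e => enc_nat (eval x env e)
  | GSeq g1 g2 => emit x env g1 ++ emit x env g2
  | GFor e g => flat_map (fun v => emit x (env ++ [v]) g) (seq 0 (eval x env e))
  end.

(* Registers: 0 holds the input, 1 the output, 2 the reversed output under construction,
   3 stays empty; numbers are kept in unary. *)
Definition loop (i : nat) (c : cmd) : cmd := While i c c.

Fixpoint pushes (n acc : nat) : cmd :=
  match n with
  | 0 => Skip
  | S n' => Seq (Push acc true) (pushes n' acc)
  end.

(** Reading destroys a register: its content is parked in [f] in reverse, and reversed again on the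
    way back. *)
Definition copy (r f acc : nat) : cmd :=
  Seq (While r (Seq (Push f false) (Push acc true)) (Seq (Push f true) (Push acc true)))
      (While f (Push r false) (Push r true)).

Definition fork (r d1 d2 : nat) : cmd :=
  While r (Seq (Push d1 false) (Push d2 false)) (Seq (Push d1 true) (Push d2 true)).

Definition move (r d : nat) : cmd := While r (Push d false) (Push d true).

(** The value is pushed in unary on top of [acc], so addition is sequencing and the body of a sum
    accumulates directly. Registers from [f] on are scratch space, empty on entry and on exit. A
    variable beyond [rho] reads the empty register 3, in agreement with the default 0 in [eval]. *)
Fixpoint comp (e : expr) (rho : list nat) (f acc : nat) : cmd :=
  match e with
  | ECst c => pushes c acc
  | ELen => copy 0 f acc
  | EVar l => copy (nth l rho 3) f acc
  | EAdd e1 e2 => Seq (comp e1 rho f acc) (comp e2 rho f acc)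
  | ESub e1 e2 =>
      Seq (comp e1 rho (f + 2) f) (Seq (comp e2 rho (f + 2) (f + 1))
        (Seq (loop (f + 1) (Pop f Skip Skip Skip)) (loop f (Push acc true))))
  | ESum e b =>
      Seq (comp e rho (f + 2) f)
        (Seq (loop f (Seq (comp b (rho ++ [f + 1]) (f + 2) acc) (Push (f + 1) true)))
          (loop (f + 1) Skip))
  | EIfZ e e1 e2 =>
      let c2 := Seq (loop f Skip) (comp e2 rho f acc) in
      Seq (comp e rho (f + 1) f) (Pop f (comp e1 rho f acc) c2 c2)
  | EBit e =>
      Seq (comp e rho (f + 3) f) (Seq (move 0 (f + 1)) (Seq (fork (f + 1) 0 (f + 2))
        (Seq (loop f (Pop (f + 2) Skip Skip Skip))
          (Seq (Pop (f + 2) Skip Skip (Push acc true)) (loop (f + 2) Skip)))))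
  end.

(** [While] and [Pop] each take one unit, so an iteration accounts for two; a [Pop] that finds
    nothing shows that the number was odd and leaves the remainder in [f + 2]. *)
Definition halve (f : nat) : cmd :=
  loop f (Pop f (Push (f + 2) true) (Push (f + 1) true) (Push (f + 1) true)).

(** Least significant bit first, each preceded by the marker [true], as in [enc_nat]. The unit
    consumed by the loop test is pushed back before halving. *)
Definition emit_bits (f : nat) : cmd :=
  loop f (Seq (Push f true) (Seq (Push 2 true) (Seq (halve f)
    (Seq (Pop (f + 2) (Push 2 false) (Push 2 true) (Push 2 true)) (loop (f + 1) (Push f true)))))).

Fixpoint comp_gen (g : gen) (rho : list nat) (f : nat) : cmd :=
  match g with
  | GNil => Skip
  | GNat e => Seq (comp e rho (f + 3) f) (Seq (emit_bits f) (Push 2 false))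
  | GSeq g1 g2 => Seq (comp_gen g1 rho f) (comp_gen g2 rho f)
  | GFor e g =>
      Seq (comp e rho (f + 2) f)
        (Seq (loop f (Seq (comp_gen g (rho ++ [f + 1]) (f + 2)) (Push (f + 1) true)))
          (loop (f + 1) Skip))
  end.

Definition gen_cmd (g : gen) : cmd := Seq (comp_gen g [] 4) (move 2 1).

Local Notation U n := (repeat true n).

Lemma upd_same s i w : upd s i w i = w.
Proof. unfold upd. now rewrite Nat.eqb_refl. Qed.

Lemma upd_other s i w j : j <> i -> upd s i w j = s j.
Proof. intros H. unfold upd. now destruct (Nat.eqb_spec j i). Qed.

Lemma U_app n l : U n ++ true :: l = true :: U n ++ l.
Proof. induction n; simpl; congruence. Qed.

Ltac upd_cases :=
  unfold upd; repeat match goal with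
  | |- context [Nat.eqb ?a ?b] => destruct (Nat.eqb_spec a b); try lia; try congruence
  end.

Ltac store_ext :=
  let j := fresh "j" in
  apply functional_extensionality; intros j; upd_cases; subst; try congruence; try lia; try reflexivity.

Definition runs (c : cmd) (s s' : store) (B : nat) : Prop := exists t, exec c s s' t /\ t <= B.

Lemma runs_conv c s s1 s2 B : runs c s s1 B -> s1 = s2 -> runs c s s2 B.
Proof. now intros H <-. Qed.

Lemma runs_le c s s' B B' : runs c s s' B -> B <= B' -> runs c s s' B'.
Proof. intros [t [H1 H2]] H. exists t. split; [easy | lia]. Qed.

Lemma runs_seq c1 c2 s s1 s2 B1 B2 :
  runs c1 s s1 B1 -> runs c2 s1 s2 B2 -> runs (Seq c1 c2) s s2 (1 + B1 + B2).
Proof.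
  intros [t1 [H1 L1]] [t2 [H2 L2]]. exists (1 + t1 + t2).
  split; [econstructor; eauto | lia].
Qed.

Lemma runs_push i b s : runs (Push i b) s (upd s i (b :: s i)) 1.
Proof. exists 1. split; [constructor | lia]. Qed.

Lemma runs_skip s : runs Skip s s 1.
Proof. exists 1. split; [constructor | lia]. Qed.

Lemma runs_if_skip (b : bool) s : runs (if b then Skip else Skip) s s 1.
Proof. destruct b; apply runs_skip. Qed.

Lemma runs_while_nil i c0 c1 s : s i = [] -> runs (While i c0 c1) s s 1.
Proof. intros H. exists 1. split; [now constructor | lia]. Qed.

Lemma runs_while_cons i c0 c1 (b : bool) w s s1 s2 B1 B2 : s i = b :: w ->
  runs (if b then c1 else c0) (upd s i w) s1 B1 -> runs (While i c0 c1) s1 s2 B2 ->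
  runs (While i c0 c1) s s2 (1 + B1 + B2).
Proof.
  intros H [t1 [H1 L1]] [t2 [H2 L2]]. exists (1 + t1 + t2).
  split; [econstructor; eauto | lia].
Qed.

Lemma runs_pop_nil i cE c0 c1 s s' B : s i = [] -> runs cE s s' B ->
  runs (Pop i cE c0 c1) s s' (1 + B).
Proof. intros H [t [H1 L1]]. exists (1 + t). split; [now constructor | lia]. Qed.

Lemma runs_pop_cons i cE c0 c1 (b : bool) w s s' B : s i = b :: w ->
  runs (if b then c1 else c0) (upd s i w) s' B -> runs (Pop i cE c0 c1) s s' (1 + B).
Proof. intros H [t [H1 L1]]. exists (1 + t). split; [eapply XPopB; eauto | lia]. Qed.

Lemma runs_loop i c (st : nat -> store) n C :
  (forall k, k < n -> exists w, st k i = true :: w /\ runs c (upd (st k) i w) (st (S k)) C) ->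
  st n i = [] -> runs (loop i c) (st 0) (st n) (n * (C + 1) + 1).
Proof.
  revert st. induction n as [|n IH]; intros st Hk Hn.
  - now apply runs_while_nil.
  - destruct (Hk 0 ltac:(lia)) as [w [Hw Hr]].
    eapply runs_le; [eapply (runs_while_cons i c c true w); [exact Hw|exact Hr|]|].
    + apply (IH (fun k => st (S k))); [|easy]. intros k Hlt. apply Hk. lia.
    + lia.
Qed.

Lemma runs_clear i s : runs (loop i Skip) s (upd s i []) (2 * length (s i) + 1).
Proof.
  remember (s i) as w eqn:E. revert s E. induction w as [|b w IH]; intros s E.
  - eapply runs_conv; [now apply runs_while_nil|]. store_ext.
  - eapply runs_conv; [eapply runs_le; [eapply (runs_while_cons i _ _ b w); [easy| |]|]|].
    + destruct b; apply runs_skip.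
    + apply IH. now rewrite upd_same.
    + simpl. lia.
    + store_ext.
Qed.

Lemma runs_pushes n acc s : runs (pushes n acc) s (upd s acc (U n ++ s acc)) (2 * n + 1).
Proof.
  revert s. induction n as [|n IH]; intros s; simpl pushes.
  - eapply runs_conv; [apply runs_skip|]. store_ext.
  - eapply runs_conv; [eapply runs_le; [eapply runs_seq; [apply runs_push|apply IH]|]|].
    + lia.
    + store_ext. simpl. now rewrite U_app.
Qed.

Lemma runs_move r d s : r <> d ->
  runs (move r d) s (upd (upd s r []) d (rev (s r) ++ s d)) (2 * length (s r) + 1).
Proof.
  intros Hd. remember (s r) as w eqn:E. revert s E. induction w as [|b w IH]; intros s E.
  - eapply runs_conv; [now apply runs_while_nil|]. store_ext.
  - eapply runs_conv; [eapply runs_le; [eapply (runs_while_cons r _ _ b w); [easy| |]|]|].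
    + instantiate (1 := 1). instantiate (1 := upd (upd s r w) d (b :: upd s r w d)).
      destruct b; apply runs_push.
    + apply IH. now rewrite upd_other, upd_same.
    + simpl. lia.
    + store_ext. simpl. now rewrite <- app_assoc.
Qed.

Lemma runs_fork r d1 d2 s : r <> d1 -> r <> d2 -> d1 <> d2 ->
  runs (fork r d1 d2) s
    (upd (upd (upd s r []) d1 (rev (s r) ++ s d1)) d2 (rev (s r) ++ s d2)) (4 * length (s r) + 1).
Proof.
  intros H1 H2 H3. remember (s r) as w eqn:E. revert s E. induction w as [|b w IH]; intros s E.
  - eapply runs_conv; [now apply runs_while_nil|]. store_ext; easy.
  - eapply runs_conv; [eapply runs_le; [eapply (runs_while_cons r _ _ b w); [easy| |]|]|].
    + instantiate (1 := 3).
      instantiate (1 := upd (upd (upd s r w) d1 (b :: s d1)) d2 (b :: s d2)).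
      eapply runs_conv with (s1 := upd (upd (upd s r w) d1 (b :: upd s r w d1)) d2
        (b :: upd (upd s r w) d1 (b :: upd s r w d1) d2)).
      * destruct b; eapply (runs_seq _ _ _ _ _ 1 1); apply runs_push.
      * store_ext.
    + apply IH. now rewrite !upd_other, upd_same by easy.
    + simpl. lia.
    + store_ext; simpl; now rewrite <- app_assoc.
Qed.

Lemma runs_copy r f acc s : r <> f -> r <> acc -> f <> acc -> s f = [] ->
  runs (copy r f acc) s (upd s acc (U (length (s r)) ++ s acc)) (6 * length (s r) + 3).
Proof.
  intros H1 H2 H3 H4.
  assert (G : forall w s, s r = w ->
    runs (While r (Seq (Push f false) (Push acc true)) (Seq (Push f true) (Push acc true))) s
      (upd (upd (upd s r []) f (rev w ++ s f)) acc (U (length w) ++ s acc)) (4 * length w + 1)).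
  { clear s H4. induction w as [|b w IH]; intros s E.
    - eapply runs_conv; [now apply runs_while_nil|]. store_ext; easy.
    - eapply runs_conv; [eapply runs_le; [eapply (runs_while_cons r _ _ b w); [easy| |]|]|].
      + instantiate (1 := 3).
        instantiate (1 := upd (upd (upd s r w) f (b :: s f)) acc (true :: s acc)).
        eapply runs_conv with (s1 := upd (upd (upd s r w) f (b :: upd s r w f)) acc
          (true :: upd (upd s r w) f (b :: upd s r w f) acc)).
        * destruct b; eapply (runs_seq _ _ _ _ _ 1 1); apply runs_push.
        * store_ext.
      + apply IH. now rewrite !upd_other, upd_same by easy.
      + simpl. lia.
      + store_ext; simpl; [now rewrite U_app | now rewrite <- app_assoc]. }
  eapply runs_conv; [eapply runs_le; [eapply runs_seq; [apply G; reflexivity|apply runs_move; easy]|]|].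
  - rewrite upd_other, upd_same, length_app, length_rev by easy. rewrite H4. simpl. lia.
  - store_ext. now rewrite H4, !app_nil_r, rev_involutive.
Qed.

(** * Correctness and cost of compiled programs *)

Definition inv (x : list bool) (env rho : list nat) (f : nat) (s : store) : Prop :=
  s 0 = x /\ s 3 = [] /\ length env = length rho /\
  (forall l, s (nth l rho 3) = U (nth l env 0)) /\
  (forall r, f <= r -> s r = []) /\ Forall (fun r => 3 < r < f) rho /\ 3 < f.

Lemma inv_var x env rho f s l : inv x env rho f s -> 2 < nth l rho 3 < f.
Proof.
  intros (_ & _ & _ & _ & _ & H & Hf). destruct (le_lt_dec (length rho) l) as [Hl|Hl].
  - rewrite nth_overflow by easy. lia.
  - rewrite Forall_forall in H. specialize (H (nth l rho 3) (nth_In _ _ Hl)). lia.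
Qed.

Lemma inv_upd x env rho f f' s r w : inv x env rho f s -> f <= r < f' ->
  inv x env rho f' (upd s r w).
Proof.
  intros Hi Hr. pose proof Hi as (H1 & H2 & H3 & H4 & H5 & H6 & H7).
  repeat split; try lia.
  - now rewrite upd_other by lia.
  - now rewrite upd_other by lia.
  - intros l. pose proof (inv_var _ _ _ _ _ l Hi). now rewrite upd_other by lia.
  - intros r' Hr'. rewrite upd_other by lia. apply H5. lia.
  - eapply Forall_impl; [|exact H6]. simpl. lia.
Qed.

Lemma inv_le x env rho f f' s : inv x env rho f s -> f <= f' -> inv x env rho f' s.
Proof.
  intros (H1 & H2 & H3 & H4 & H5 & H6 & H7) Hf. repeat split; try easy; try lia.
  - intros r Hr. apply H5. lia.
  - eapply Forall_impl; [|exact H6]. simpl. lia.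
Qed.

Definition acc_ok (rho : list nat) (f acc : nat) : Prop :=
  1 < acc < f /\ acc <> 3 /\ ~ In acc rho.

Lemma inv_acc x env rho f s acc w : inv x env rho f s -> acc_ok rho f acc ->
  inv x env rho f (upd s acc w).
Proof.
  intros Hi (A1 & A2 & A3). pose proof Hi as (H1 & H2 & H3 & H4 & H5 & H6 & H7).
  repeat split; try lia; try easy.
  - now rewrite upd_other by lia.
  - now rewrite upd_other by lia.
  - intros l. rewrite upd_other; [easy|]. intros E. destruct (le_lt_dec (length rho) l) as [Hl|Hl].
    + rewrite nth_overflow in E by easy. lia.
    + apply A3. rewrite <- E. now apply nth_In.
  - intros r Hr. rewrite upd_other by lia. now apply H5.
Qed.

Lemma inv_bind x env rho f f' s r v : inv x env rho f s -> f <= r < f' ->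
  inv x (env ++ [v]) (rho ++ [r]) f' (upd s r (U v)).
Proof.
  intros Hi Hr. pose proof Hi as (_ & _ & L & H & _).
  destruct (inv_upd _ _ _ _ f' _ r (U v) Hi Hr) as (H1 & H2 & H3 & H4 & H5 & H6 & H7).
  repeat split; try easy.
  - rewrite !length_app. simpl. lia.
  - intros l. destruct (lt_eq_lt_dec l (length rho)) as [[Hl|Hl]|Hl].
    + rewrite !app_nth1 by lia. apply H4.
    + rewrite !app_nth2 by lia. rewrite L, Hl, Nat.sub_diag. simpl. apply upd_same.
    + rewrite !nth_overflow by (rewrite length_app; simpl; lia). exact H2.
  - apply Forall_app. split; [easy|]. constructor; [|easy].
    destruct Hi as (_ & _ & _ & _ & _ & _ & Hf). lia.
Qed.

Definition rho_ok (rho : list nat) (f : nat) : Prop := Forall (fun r => 3 < r < f) rho /\ 3 < f.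

Lemma rho_ok_le rho f f' : rho_ok rho f -> f <= f' -> rho_ok rho f'.
Proof. intros [H1 H2] H. split; [|lia]. eapply Forall_impl; [|exact H1]. simpl. lia. Qed.

Lemma rho_ok_bind rho f f' r : rho_ok rho f -> f <= r < f' -> rho_ok (rho ++ [r]) f'.
Proof.
  intros H Hr. destruct (rho_ok_le _ _ f' H ltac:(lia)) as [H1 H2]. destruct H.
  split; [|easy]. apply Forall_app. split; [easy|]. repeat constructor; lia.
Qed.

Lemma acc_fresh rho f f' r : rho_ok rho f -> f <= r < f' -> acc_ok rho f' r.
Proof.
  intros [H Hf] Hr. repeat split; try lia.
  intros E. rewrite Forall_forall in H. specialize (H r E). lia.
Qed.

Lemma acc_ok_le rho f f' acc : acc_ok rho f acc -> f <= f' -> acc_ok rho f' acc.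
Proof. intros (H1 & H2 & H3) H. repeat split; easy || lia. Qed.

Lemma acc_ok_bind rho f f' acc r : acc_ok rho f acc -> f <= r < f' -> acc_ok (rho ++ [r]) f' acc.
Proof.
  intros (H1 & H2 & H3) H. repeat split; try lia. rewrite in_app_iff. intros [?|[?|[]]]; [easy | lia].
Qed.

Definition small (B : nat) (x : list bool) (env : list nat) : Prop :=
  length x <= B /\ Forall (fun v => v <= B) env.

Lemma small_le B B' x env : small B x env -> B <= B' -> small B' x env.
Proof. intros [H1 H2] H. split; [lia|]. eapply Forall_impl; [|exact H2]. simpl. lia. Qed.

Lemma small_snoc B x env v : small B x env -> v <= B -> small B x (env ++ [v]).
Proof. intros [H1 H2] H. split; [easy|]. apply Forall_app. auto. Qed.

Lemma list_sum_le (F : nat -> nat) l C : (forall v, In v l -> F v <= C) ->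
  list_sum (map F l) <= length l * C.
Proof.
  induction l as [|a l IH]; intros H; simpl; [lia|].
  pose proof (H a (or_introl eq_refl)). specialize (IH (fun v Hv => H v (or_intror Hv))). lia.
Qed.

Lemma eval_bounded e : exists k, forall x env B, small B x env -> eval x env e <= (B + 2) ^ k.
Proof.
  enough (exists F, poly_bounded F /\ forall x env B, small B x env -> eval x env e <= F B)
    as (F & [k Hk] & H).
  { exists k. intros x env B Hs. specialize (H x env B Hs). specialize (Hk B). lia. }
  induction e as [c| |l|e1 (F1 & P1 & H1) e2 (F2 & P2 & H2)|e1 (F1 & P1 & H1) e2 (F2 & P2 & H2)
    |e1 (F1 & P1 & H1) e2 (F2 & [k2 P2] & H2)|e (F & P & H) e1 (F1 & P1 & H1) e2 (F2 & P2 & H2)|e IH].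
  - exists (fun _ => c). split; [poly_bound | easy].
  - exists (fun B => B). split; [poly_bound|]. intros x env B [Hx _]. exact Hx.
  - exists (fun B => B). split; [poly_bound|]. intros x env B [_ Hs]. simpl.
    destruct (le_lt_dec (length env) l) as [Hl|Hl]; [rewrite nth_overflow by easy; lia|].
    rewrite Forall_forall in Hs. apply Hs. now apply nth_In.
  - exists (fun B => F1 B + F2 B). split; [poly_bound|]. intros x env B Hs. simpl.
    specialize (H1 x env B Hs). specialize (H2 x env B Hs). lia.
  - exists F1. split; [easy|]. intros x env B Hs. simpl. specialize (H1 x env B Hs). lia.
  (* The summation variable can be as large as [F1 B], so the bound for the body is taken at
     [B + F1 B]. *)
  - exists (fun B => F1 B * ((B + F1 B) + 2) ^ k2). split; [poly_bound|].
    intros x env B Hs. simpl. pose proof (H1 x env B Hs) as E1.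
    etransitivity; [apply list_sum_le with (C := ((B + F1 B) + 2) ^ k2)|].
    + intros v Hv. apply in_seq in Hv. etransitivity; [apply H2|apply P2].
      apply small_snoc; [eapply small_le; [exact Hs | lia] | lia].
    + rewrite length_seq. now apply Nat.mul_le_mono_r.
  - exists (fun B => F1 B + F2 B). split; [poly_bound|]. intros x env B Hs. simpl.
    specialize (H1 x env B Hs). specialize (H2 x env B Hs). destruct (Nat.eqb _ _); lia.
  - exists (fun _ => 1). split; [poly_bound|]. intros x env B _. simpl. destruct (nth _ _ _); lia.
Qed.

Lemma runs_comp e : forall rho f acc, rho_ok rho f -> acc_ok rho f acc ->
  exists F, poly_bounded F /\ forall x env s B, inv x env rho f s -> small B x env ->
  runs (comp e rho f acc) s (upd s acc (U (eval x env e) ++ s acc)) (F B).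
Proof.
  assert (Gc : forall r f acc, r <> f -> r <> acc -> f <> acc -> forall x env rho s B,
    inv x env rho f s -> length (s r) <= B ->
    runs (copy r f acc) s (upd s acc (U (length (s r)) ++ s acc)) (6 * B + 3)).
  { intros r f acc H1 H2 H3 x env rho s B Hi Hl. eapply runs_le; [apply runs_copy; try easy|lia].
    apply Hi. lia. }
  induction e as [c| |l|e1 IH1 e2 IH2|e1 IH1 e2 IH2|e1 IH1 e2 IH2|e IH e1 IH1 e2 IH2|e IH];
    intros rho f acc Hr Ha; pose proof Ha as (A1 & A2 & A3).
  - exists (fun _ => 2 * c + 1). split; [poly_bound|]. intros. apply runs_pushes.
  - exists (fun B => 6 * B + 3). split; [poly_bound|]. intros x env s B Hi Hs.
    pose proof Hi as (<- & _). eapply (Gc 0 f acc); try lia; [exact Hi | apply Hs].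
  - exists (fun B => 6 * B + 3). split; [poly_bound|]. intros x env s B Hi Hs.
    pose proof (inv_var _ _ _ _ _ l Hi) as Hv. pose proof Hi as (_ & _ & _ & H4 & _).
    simpl. specialize (H4 l).
    replace (nth l env 0) with (length (s (nth l rho 3))) by (rewrite H4; apply repeat_length).
    eapply (Gc (nth l rho 3) f acc); try lia; [|exact Hi|].
    + intros E. destruct (le_lt_dec (length rho) l) as [Hl|Hl].
      * rewrite nth_overflow in E by easy. lia.
      * apply A3. rewrite <- E. now apply nth_In.
    + rewrite H4, repeat_length. destruct Hs as [_ Hs].
      destruct (le_lt_dec (length env) l) as [Hl|Hl]; [rewrite nth_overflow by easy; lia|].
      rewrite Forall_forall in Hs. apply Hs. now apply nth_In.
  - destruct (IH1 rho f acc Hr Ha) as (F1 & P1 & H1).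
    destruct (IH2 rho f acc Hr Ha) as (F2 & P2 & H2).
    exists (fun B => 1 + F1 B + F2 B). split; [poly_bound|]. intros x env s B Hi Hs.
    eapply runs_conv; [eapply runs_seq; [apply H1; [exact Hi|exact Hs]|apply H2; [|exact Hs]]|].
    + now apply inv_acc.
    + store_ext. simpl. rewrite app_assoc, <- repeat_app. do 2 f_equal. lia.
  - destruct (IH1 rho (f + 2) f) as (F1 & P1 & H1);
      [apply (rho_ok_le _ f); [easy | lia] | eapply acc_fresh; [exact Hr | lia] |].
    destruct (IH2 rho (f + 2) (f + 1)) as (F2 & P2 & H2);
      [apply (rho_ok_le _ f); [easy | lia] | eapply acc_fresh; [exact Hr | lia] |].
    destruct (eval_bounded e1) as [k1 E1]. destruct (eval_bounded e2) as [k2 E2].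
    exists (fun B => 3 + F1 B + F2 B + ((B + 2) ^ k2 * 3 + 1) + ((B + 2) ^ k1 * 2 + 1)).
    split; [poly_bound|]. intros x env s B Hi Hs.
    specialize (E1 x env B Hs). specialize (E2 x env B Hs). simpl eval.
    assert (Hf : forall r, f <= r -> s r = []) by apply Hi.
    set (v1 := eval x env e1) in *. set (v2 := eval x env e2) in *.
    eapply runs_conv; [eapply runs_le; [eapply runs_seq;
      [apply H1; [apply (inv_le _ _ _ f); [exact Hi|lia]|exact Hs]|
      eapply runs_seq; [apply H2; [|exact Hs]|eapply runs_seq]]|]|].
    + apply (inv_upd _ _ _ f); [exact Hi | lia].
    + fold v1 v2. rewrite (upd_other s f) by lia. rewrite !Hf, !app_nil_r by lia.
      (* Each unit of [v2] cancels one of [v1]; a [Pop] of the empty register does nothing, which is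
         exactly the truncation of the difference. *)
      set (st := fun k => upd (upd s f (U (v1 - k))) (f + 1) (U (v2 - k))).
      replace (upd (upd s f (U v1)) (f + 1) (U v2)) with (st 0)
        by (unfold st; now rewrite !Nat.sub_0_r).
      apply (runs_loop _ _ st v2 2); unfold st.
      * intros k Hk. exists (U (v2 - S k)). rewrite upd_same. split.
        { now replace (v2 - k) with (S (v2 - S k)) by lia. }
        destruct (v1 - k) as [|d] eqn:Ed.
        -- eapply runs_conv; [apply runs_pop_nil; [|apply runs_skip]|].
           ++ now rewrite !upd_other, upd_same by lia.
           ++ replace (v1 - S k) with 0 by lia. store_ext.
        -- eapply runs_conv; [apply (runs_pop_cons _ _ _ _ true (U d)); [|apply runs_skip]|].
           ++ now rewrite !upd_other, upd_same by lia.
           ++ replace (v1 - S k) with d by lia. store_ext.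
      * rewrite upd_same. now rewrite Nat.sub_diag.
    + cbv beta. set (st := fun k => upd (upd s f (U (v1 - v2 - k))) acc (U k ++ s acc)).
      replace (upd (upd s f (U (v1 - v2))) (f + 1) (U (v2 - v2))) with (st 0).
      * apply (runs_loop _ _ st (v1 - v2) 1); unfold st.
        -- intros k Hk. exists (U (v1 - v2 - S k)). rewrite upd_other, upd_same by lia. split.
           { now replace (v1 - v2 - k) with (S (v1 - v2 - S k)) by lia. }
           eapply runs_conv; [apply runs_push|]. store_ext.
        -- rewrite upd_other, upd_same by lia. now rewrite Nat.sub_diag.
      * unfold st. rewrite !Nat.sub_0_r, Nat.sub_diag. store_ext; try (rewrite Hf by lia); easy.
    + fold v1 v2. nia.
    + simpl. rewrite Nat.sub_diag. store_ext; try (rewrite Hf by lia); easy.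
  - destruct (IH1 rho (f + 2) f) as (F1 & P1 & H1);
      [apply (rho_ok_le _ f); [easy | lia] | eapply acc_fresh; [exact Hr | lia] |].
    destruct (IH2 (rho ++ [f + 1]) (f + 2) acc) as (F2 & [k2 P2] & H2);
      [apply (rho_ok_bind _ f); [easy | lia] | apply (acc_ok_bind _ f); [easy | lia] |].
    destruct (eval_bounded e1) as [k1 E1].
    exists (fun B => 3 + F1 B + ((B + 2) ^ k1 * ((2 + (B + (B + 2) ^ k1 + 2) ^ k2) + 1) + 1)
      + (2 * (B + 2) ^ k1 + 1)).
    split; [poly_bound|]. intros x env s B Hi Hs.
    specialize (E1 x env B Hs). simpl eval.
    assert (Hf : forall r, f <= r -> s r = []) by apply Hi.
    set (v1 := eval x env e1) in *.
    set (sm := fun k => list_sum (map (fun v => eval x (env ++ [v]) e2) (seq 0 k))).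
    (* After [k] iterations [f] counts those still to come, [f + 1] is the loop variable, and [acc]
       has received the partial sum. *)
    set (st := fun k => upd (upd (upd s f (U (v1 - k))) (f + 1) (U k)) acc (U (sm k) ++ s acc)).
    eapply runs_conv; [eapply runs_le; [eapply runs_seq;
      [apply H1; [apply (inv_le _ _ _ f); [exact Hi|lia]|exact Hs]|
      eapply runs_seq; [|apply runs_clear]]|]|].
    + fold v1. rewrite Hf, app_nil_r by lia.
      replace (upd s f (U v1)) with (st 0).
      2: { unfold st, sm. simpl. rewrite Nat.sub_0_r. store_ext; try (rewrite Hf by lia); easy. }
      apply (runs_loop _ _ st v1 (2 + (B + (B + 2) ^ k1 + 2) ^ k2)).
      * intros k Hk. exists (U (v1 - S k)). unfold st at 1. rewrite !upd_other, upd_same by lia. split.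
        { now replace (v1 - k) with (S (v1 - S k)) by lia. }
        eapply runs_conv; [eapply runs_le; [eapply runs_seq; [apply (H2 x (env ++ [k]))|apply runs_push]|]|].
        -- replace (upd (st k) f (U (v1 - S k)))
             with (upd (upd (upd s f (U (v1 - S k))) acc (U (sm k) ++ s acc)) (f + 1) (U k)).
           ++ apply (inv_bind _ _ _ (f + 1)); [|lia].
              apply inv_acc; [|now apply (acc_ok_le _ f); [|lia]].
              apply (inv_upd _ _ _ f); [exact Hi | lia].
           ++ unfold st. store_ext.
        -- apply small_snoc with (B := B + (B + 2) ^ k1); [|lia].
           apply (small_le B); [easy | lia].
        -- specialize (P2 (B + (B + 2) ^ k1)). lia.
        -- unfold st. store_ext.
           unfold sm. rewrite seq_S, map_app, list_sum_app. simpl.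
           rewrite Nat.add_0_r, app_assoc, <- repeat_app. do 2 f_equal. lia.
      * unfold st. rewrite !upd_other, upd_same by lia. now rewrite Nat.sub_diag.
    + unfold st. rewrite upd_other, upd_same, repeat_length by lia. nia.
    + unfold st. rewrite Nat.sub_diag. fold (sm v1). store_ext; try (rewrite Hf by lia); easy.
  - destruct (IH rho (f + 1) f) as (F & P & H);
      [apply (rho_ok_le _ f); [easy | lia] | eapply acc_fresh; [exact Hr | lia] |].
    destruct (IH1 rho f acc Hr Ha) as (F1 & P1 & H1).
    destruct (IH2 rho f acc Hr Ha) as (F2 & P2 & H2).
    destruct (eval_bounded e) as [k E].
    exists (fun B => 5 + F B + F1 B + F2 B + 2 * (B + 2) ^ k).
    split; [poly_bound|]. intros x env s B Hi Hs. specialize (E x env B Hs). simpl eval.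
    assert (Hf : forall r, f <= r -> s r = []) by apply Hi.
    eapply runs_le; [eapply runs_seq; [apply H; [apply (inv_le _ _ _ f); [exact Hi|lia]|exact Hs]|]|].
    + instantiate (1 := 3 + F1 B + F2 B + 2 * (B + 2) ^ k).
      rewrite Hf, app_nil_r by lia. destruct (eval x env e) as [|v] eqn:Ev; simpl Nat.eqb; cbv iota.
      * eapply runs_le; [apply runs_pop_nil; [now rewrite upd_same|]|].
        -- replace (upd s f (U 0)) with s; [apply H1; [exact Hi|exact Hs]|]. store_ext; try (rewrite Hf by lia); easy.
        -- lia.
      * eapply runs_conv; [eapply runs_le; [apply (runs_pop_cons _ _ _ _ true (U v)); [now rewrite upd_same|]|]|].
        -- eapply runs_seq; [apply runs_clear|].
           replace (upd (upd (upd s f (U (S v))) f (U v)) f []) with s; [apply H2; [exact Hi|exact Hs]|].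
           store_ext; try (rewrite Hf by lia); easy.
        -- rewrite upd_same, repeat_length. lia.
        -- reflexivity.
    + lia.
  - destruct (IH rho (f + 3) f) as (F & P & H);
      [apply (rho_ok_le _ f); [easy | lia] | eapply acc_fresh; [exact Hr | lia] |].
    destruct (eval_bounded e) as [k E].
    exists (fun B => 20 + F B + 10 * B + 3 * (B + 2) ^ k).
    split; [poly_bound|]. intros x env s B Hi Hs. specialize (E x env B Hs). simpl eval.
    assert (Hf : forall r, f <= r -> s r = []) by apply Hi.
    assert (Hx : s 0 = x) by apply Hi. assert (Hl : length x <= B) by apply Hs.
    set (v := eval x env e) in *.
    (* Moving and forking reverse the input twice, so both register 0 and [f + 2] hold it in order;
       the loop drops one bit of the latter per unit of the index. *)
    set (st := fun k => upd (upd s f (U (v - k))) (f + 2) (skipn k x)).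
    eapply runs_conv; [eapply runs_le; [eapply runs_seq;
      [apply H; [apply (inv_le _ _ _ f); [exact Hi|lia]|exact Hs]|
      eapply runs_seq; [apply runs_move; lia|eapply runs_seq; [apply runs_fork; lia|
      eapply runs_seq; [|eapply runs_seq; [|apply runs_clear]]]]]|]|].
    + fold v.
      match goal with |- runs _ ?S _ _ => replace S with (st 0) end.
      2: { unfold st. rewrite Nat.sub_0_r. simpl skipn.
           pose proof (Hf f ltac:(lia)) as E0. pose proof (Hf (f + 1) ltac:(lia)) as E1.
           pose proof (Hf (f + 2) ltac:(lia)) as E2.
           store_ext; rewrite ?E0, ?E1, ?E2, ?app_nil_r, ?rev_involutive; easy. }
      apply (runs_loop _ _ st v 2).
      * intros j Hj. exists (U (v - S j)). unfold st at 1. rewrite upd_other, upd_same by lia. split.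
        { now replace (v - j) with (S (v - S j)) by lia. }
        destruct (skipn j x) as [|b w] eqn:Ek.
        -- eapply runs_conv; [apply runs_pop_nil; [|apply runs_skip]|].
           ++ unfold st. now rewrite upd_other, upd_same by lia.
           ++ assert (Ek' : skipn (S j) x = []).
              { replace (S j) with (1 + j) by lia. rewrite <- skipn_skipn, Ek. easy. }
              unfold st. rewrite Ek, Ek'. store_ext.
        -- eapply runs_conv; [apply (runs_pop_cons _ _ _ _ b w); [|apply runs_if_skip]|].
           ++ unfold st. now rewrite upd_other, upd_same by lia.
           ++ assert (Ek' : skipn (S j) x = w).
              { replace (S j) with (1 + j) by lia. rewrite <- skipn_skipn, Ek. easy. }
              unfold st. rewrite Ek, Ek'. store_ext.
      * unfold st. rewrite upd_other, upd_same by lia. now rewrite Nat.sub_diag.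
    + instantiate (1 := 2).
      instantiate (1 := upd (upd s (f + 2) (skipn (S v) x)) acc (U (if nth v x false then 1 else 0) ++ s acc)).
      unfold st. rewrite Nat.sub_diag.
      assert (En : nth v x false = hd false (skipn v x) /\ skipn (S v) x = tl (skipn v x)).
      { split; [|replace (S v) with (1 + v) by lia; rewrite <- skipn_skipn; now destruct (skipn v x)].
        rewrite <- (Nat.add_0_r v) at 1. rewrite <- nth_skipn. now destruct (skipn v x). }
      destruct En as [-> ->]. destruct (skipn v x) as [|b w] eqn:Ek.
      * eapply runs_conv; [apply runs_pop_nil; [|apply runs_skip]|].
        -- now rewrite upd_same.
        -- store_ext; simpl; try (rewrite Hf by lia); easy.
      * eapply runs_conv with (s1 := upd (upd (upd (upd s f (U 0)) (f + 2) (b :: w)) (f + 2) w) acc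
           (U (if b then 1 else 0) ++ s acc)).
        -- eapply (runs_pop_cons _ _ _ _ b w); [now rewrite upd_same|]. destruct b; simpl.
           ++ eapply runs_conv; [apply runs_push|]. store_ext.
           ++ eapply runs_conv; [apply runs_skip|]. store_ext.
        -- store_ext; simpl; try (rewrite Hf by lia); easy.
    + rewrite ?upd_same. rewrite (upd_other _ acc) by lia. rewrite ?upd_same.
      rewrite !(upd_other s f) by lia. rewrite Hx, !Hf, app_nil_r, length_rev by lia.
      rewrite length_skipn. lia.
    + fold v. store_ext; try (rewrite Hf by lia); easy.
Qed.

Lemma runs_halve f : forall n s, s f = U n ->
  runs (halve f) s
    (upd (upd (upd s f []) (f + 1) (U (Nat.div2 n) ++ s (f + 1))) (f + 2)
      (U (Nat.b2n (Nat.odd n)) ++ s (f + 2))) (3 * n + 1).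
Proof.
  intros n. induction n as [n IH] using lt_wf_ind. intros s Hs.
  destruct n as [|[|n]].
  - eapply runs_conv; [now apply runs_while_nil|]. store_ext; now rewrite Hs.
  - eapply runs_conv; [eapply runs_le; [eapply (runs_while_cons f _ _ true []); [exact Hs| |]|]|].
    + apply runs_pop_nil; [apply upd_same | apply runs_push].
    + apply runs_while_nil. now rewrite upd_other, upd_same by lia.
    + simpl. lia.
    + store_ext.
  - eapply runs_conv; [eapply runs_le; [eapply (runs_while_cons f _ _ true (U (S n))); [exact Hs| |]|]|].
    + eapply (runs_pop_cons _ _ _ _ true (U n)); [apply upd_same | apply runs_push].
    + apply (IH n); [lia|]. now rewrite upd_other, upd_same by lia.
    + simpl. lia.
    + change (Nat.div2 (S (S n))) with (S (Nat.div2 n)).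
      change (Nat.odd (S (S n))) with (Nat.odd n). store_ext. simpl. now rewrite U_app.
Qed.

Definition delimit (l : list bool) : list bool := flat_map (fun b => [true; b]) l.

Lemma nat_bits_step n : 0 < n -> nat_bits n = Nat.odd n :: nat_bits (Nat.div2 n).
Proof.
  intros Hn. rewrite (Nat.div2_odd n) at 1. unfold nat_bits.
  assert (Hd : Nat.div2 n < n) by (apply Nat.lt_div2; lia).
  destruct (Nat.odd n) eqn:Eo; simpl Nat.b2n.
  - replace (N.of_nat (2 * Nat.div2 n + 1)) with (2 * N.of_nat (Nat.div2 n) + 1)%N by lia.
    now destruct (N.of_nat (Nat.div2 n)).
  - replace (N.of_nat (2 * Nat.div2 n + 0)) with (2 * N.of_nat (Nat.div2 n))%N by lia.
    destruct (N.of_nat (Nat.div2 n)) eqn:E; [|easy].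
    pose proof (Nat.div2_odd n) as E2. rewrite Eo in E2. simpl in E2. lia.
Qed.

(** A round is linear in the current value, which it halves, so the costs form a geometric series
    and the total stays linear. *)
Lemma runs_emit_bits f : 3 < f -> forall n s, s f = U n -> s (f + 1) = [] -> s (f + 2) = [] ->
  runs (emit_bits f) s (upd (upd s f []) 2 (rev (delimit (nat_bits n)) ++ s 2)) (40 * n + 1).
Proof.
  intros Hf n. induction n as [n IH] using lt_wf_ind. intros s H0 H1 H2.
  destruct n as [|n].
  - eapply runs_conv; [now apply runs_while_nil|]. store_ext; now rewrite H0.
  - set (h := Nat.div2 (S n)).
    assert (Hh : h < S n) by (apply Nat.lt_div2; lia).
    assert (Hh2 : 2 * h <= S n).
    { pose proof (Nat.div2_odd (S n)) as E. fold h in E. lia. }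
    set (b := Nat.odd (S n)).
    set (s1 := upd (upd s f (U h)) 2 (b :: true :: s 2)).
    eapply runs_conv; [eapply runs_le; [eapply (runs_while_cons f _ _ true (U n) _ s1);
      [exact H0| |]|]|].
    + eapply runs_conv; [eapply runs_seq; [apply runs_push|eapply runs_seq; [apply runs_push|
        eapply runs_seq; [apply (runs_halve f (S n))|eapply runs_seq]]]|].
      * rewrite upd_other, !upd_same by lia. easy.
      * instantiate (1 := 2).
        instantiate (1 := upd (upd (upd s f []) (f + 1) (U h)) 2 (b :: true :: s 2)).
        fold h b. destruct b; simpl Nat.b2n.
        -- eapply runs_conv; [apply (runs_pop_cons _ _ _ _ true []); [|apply runs_push]|].
           ++ rewrite upd_same, !upd_other by lia. now rewrite H2.
           ++ store_ext; simpl; now rewrite H1, app_nil_r.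
        -- eapply runs_conv; [apply runs_pop_nil; [|apply runs_push]|].
           ++ rewrite upd_same, !upd_other by lia. now rewrite H2.
           ++ store_ext; simpl; now rewrite ?H1, ?app_nil_r.
      * set (st := fun k => upd (upd (upd s f (U k)) (f + 1) (U (h - k))) 2 (b :: true :: s 2)).
        replace (upd (upd (upd s f []) (f + 1) (U h)) 2 (b :: true :: s 2)) with (st 0)
          by (unfold st; now rewrite Nat.sub_0_r).
        apply (runs_loop _ _ st h 1); unfold st.
        -- intros k Hk. exists (U (h - S k)). rewrite upd_other, upd_same by lia. split.
           { now replace (h - k) with (S (h - S k)) by lia. }
           eapply runs_conv; [apply runs_push|]. store_ext.
        -- rewrite upd_other, upd_same by lia. now rewrite Nat.sub_diag.
      * unfold s1. rewrite Nat.sub_diag. store_ext. now rewrite H1.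
    + apply (IH h Hh); unfold s1; rewrite !upd_other by lia; try easy. apply upd_same.
    + lia.
    + rewrite (nat_bits_step (S n)) by lia. fold h b. unfold s1. store_ext.
      simpl. now rewrite <- !app_assoc.
Qed.

Lemma runs_comp_gen g : forall rho f, rho_ok rho f ->
  exists F, poly_bounded F /\ forall x env s B, inv x env rho f s -> small B x env ->
  runs (comp_gen g rho f) s (upd s 2 (rev (emit x env g) ++ s 2)) (F B).
Proof.
  assert (A2 : forall rho f, rho_ok rho f -> acc_ok rho f 2).
  { intros rho f [H1 H2]. repeat split; try lia. intros E.
    rewrite Forall_forall in H1. specialize (H1 2 E). lia. }
  induction g as [|e|g1 IH1 g2 IH2|e g IH]; intros rho f Hr.
  - exists (fun _ => 1). split; [poly_bound|]. intros x env s B _ _.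
    eapply runs_conv; [apply runs_skip|]. store_ext.
  - destruct (runs_comp e rho (f + 3) f) as (F & P & H);
      [apply (rho_ok_le _ f); [easy | lia] | eapply acc_fresh; [exact Hr | lia] |].
    destruct (eval_bounded e) as [k E].
    exists (fun B => F B + 40 * (B + 2) ^ k + 4). split; [poly_bound|].
    intros x env s B Hi Hs. specialize (E x env B Hs).
    assert (Hf : forall r, f <= r -> s r = []) by apply Hi. destruct Hr as [_ Hr].
    eapply runs_conv; [eapply runs_le; [eapply runs_seq;
      [apply H; [apply (inv_le _ _ _ f); [exact Hi|lia]|exact Hs]|
       eapply runs_seq; [apply (runs_emit_bits f Hr)|apply runs_push]]|]|].
    + rewrite upd_same, Hf, app_nil_r by lia. reflexivity.
    + rewrite upd_other by lia. apply Hf. lia.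
    + rewrite upd_other by lia. apply Hf. lia.
    + lia.
    + simpl emit. unfold enc_nat. store_ext.
      * rewrite rev_app_distr. reflexivity.
      * now rewrite Hf.
  - destruct (IH1 rho f Hr) as (F1 & P1 & H1). destruct (IH2 rho f Hr) as (F2 & P2 & H2).
    exists (fun B => 1 + F1 B + F2 B). split; [poly_bound|]. intros x env s B Hi Hs.
    eapply runs_conv; [eapply runs_seq; [apply H1; [exact Hi|exact Hs]|apply H2; [|exact Hs]]|].
    + apply inv_acc; [exact Hi | now apply A2].
    + store_ext. simpl. now rewrite rev_app_distr, <- app_assoc.
  - destruct (runs_comp e rho (f + 2) f) as (F1 & P1 & H1);
      [apply (rho_ok_le _ f); [easy | lia] | eapply acc_fresh; [exact Hr | lia] |].
    destruct (IH (rho ++ [f + 1]) (f + 2)) as (F2 & [k2 P2] & H2);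
      [apply (rho_ok_bind _ f); [easy | lia] |].
    destruct (eval_bounded e) as [k1 E1].
    exists (fun B => 3 + F1 B + ((B + 2) ^ k1 * ((2 + (B + (B + 2) ^ k1 + 2) ^ k2) + 1) + 1)
      + (2 * (B + 2) ^ k1 + 1)).
    split; [poly_bound|]. intros x env s B Hi Hs.
    specialize (E1 x env B Hs). simpl emit.
    assert (Hf : forall r, f <= r -> s r = []) by apply Hi.
    assert (Hf3 : 3 < f) by apply Hr.
    set (v1 := eval x env e) in *.
    set (sm := fun k => flat_map (fun v => emit x (env ++ [v]) g) (seq 0 k)).
    set (st := fun k => upd (upd (upd s f (U (v1 - k))) (f + 1) (U k)) 2 (rev (sm k) ++ s 2)).
    eapply runs_conv; [eapply runs_le; [eapply runs_seq;
      [apply H1; [apply (inv_le _ _ _ f); [exact Hi|lia]|exact Hs]|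
      eapply runs_seq; [|apply runs_clear]]|]|].
    + fold v1. rewrite Hf, app_nil_r by lia.
      replace (upd s f (U v1)) with (st 0).
      2: { unfold st, sm. simpl. rewrite Nat.sub_0_r. store_ext; try (rewrite Hf by lia); easy. }
      apply (runs_loop _ _ st v1 (2 + (B + (B + 2) ^ k1 + 2) ^ k2)).
      * intros k Hk. exists (U (v1 - S k)). unfold st at 1. rewrite !upd_other, upd_same by lia. split.
        { now replace (v1 - k) with (S (v1 - S k)) by lia. }
        eapply runs_conv; [eapply runs_le; [eapply runs_seq; [apply (H2 x (env ++ [k]))|apply runs_push]|]|].
        -- replace (upd (st k) f (U (v1 - S k)))
             with (upd (upd (upd s f (U (v1 - S k))) 2 (rev (sm k) ++ s 2)) (f + 1) (U k)).
           ++ apply (inv_bind _ _ _ (f + 1)); [|lia].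
              apply inv_acc; [|now apply (acc_ok_le _ f); [apply A2|lia]].
              apply (inv_upd _ _ _ f); [exact Hi | lia].
           ++ unfold st. store_ext.
        -- apply small_snoc with (B := B + (B + 2) ^ k1); [|lia].
           apply (small_le B); [easy | lia].
        -- specialize (P2 (B + (B + 2) ^ k1)). lia.
        -- unfold st. store_ext.
           unfold sm. rewrite seq_S, flat_map_app, rev_app_distr. simpl.
           now rewrite app_nil_r, <- app_assoc.
      * unfold st. rewrite !upd_other, upd_same by lia. now rewrite Nat.sub_diag.
    + unfold st. rewrite upd_other, upd_same, repeat_length by lia. nia.
    + unfold st. rewrite Nat.sub_diag. fold (sm v1). store_ext; try (rewrite Hf by lia); easy.
Qed.

(** Bounds the reversed output in register 2 by the time spent producing it, and thereby the cost of
    the final reversal. *)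
Lemma exec_reg_length c s s' t : exec c s s' t -> forall i, length (s' i) <= length (s i) + t.
Proof.
  induction 1; intros r; try specialize (IHexec r); try specialize (IHexec1 r);
    try specialize (IHexec2 r); try lia.
  - unfold upd. destruct (Nat.eqb_spec r i); subst; simpl; lia.
  - revert IHexec. unfold upd. destruct (Nat.eqb_spec r i); subst; rewrite ?H; simpl; lia.
  - revert IHexec1. unfold upd. destruct (Nat.eqb_spec r i); subst; rewrite ?H; simpl; lia.
Qed.

Theorem emit_polytime g : polytime_computable (fun x => emit x [] g).
Proof.
  destruct (runs_comp_gen g [] 4) as (F & P & H); [split; [constructor | lia]|].
  apply (exec_polytime (gen_cmd g) _ (fun n => 2 + F n + 2 * F n)); [poly_bound|].
  intros x. destruct (H x [] (init_store x) (length x)) as [t [He Ht]].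
  - repeat split; try lia; try easy.
    + intros [|l]; reflexivity.
    + intros r Hr. unfold init_store. destruct (Nat.eqb_spec r 0); [lia | easy].
  - split; [easy | constructor].
  - pose proof (exec_reg_length _ _ _ _ He 2) as Hl.
    destruct (runs_seq _ _ _ _ _ _ _ (ex_intro _ t (conj He Ht)) (runs_move 2 1 _ ltac:(lia)))
      as [t' [He' Ht']].
    eexists. exists t'. split; [exact He'|]. split.
    + rewrite !upd_same. rewrite upd_other by lia. unfold init_store. simpl.
      now rewrite !app_nil_r, rev_involutive.
    + change (init_store x 2) with (@nil bool) in *. simpl length in Hl. lia.
Qed.

(** * The clause game as a synthesis instance *)

Lemma block_index_inj g p a p' a' : a < g -> a' < g -> p * g + a = p' * g + a' -> p = p' /\ a = a'.
Proof.
  intros Ha Ha' E. rewrite !(Nat.mul_comm _ g) in E.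
  destruct (Nat.div_mod_unique g p p' a a' Ha Ha' E). easy.
Qed.

Lemma nth_map_seq {A} (f : nat -> A) n i d : i < n -> nth i (map f (seq 0 n)) d = f i.
Proof.
  intros H. rewrite (nth_indep _ d (f 0)) by (now rewrite length_map, length_seq).
  now rewrite map_nth, seq_nth.
Qed.

Lemma nth_flat_map_blocks {A} (f : nat -> list A) n g d : (forall p, length (f p) = g) ->
  forall k p a, p < n -> a < g -> nth (p * g + a) (flat_map f (seq k n)) d = nth a (f (k + p)) d.
Proof.
  intros Hf. induction n as [|n IH]; intros k p a Hp Ha; [lia|]. simpl. destruct p as [|p].
  - rewrite app_nth1 by (rewrite Hf; easy). now rewrite Nat.add_0_r.
  - rewrite app_nth2 by (rewrite Hf; simpl; lia). rewrite Hf.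
    replace (S p * g + a - g) with (p * g + a) by (simpl; lia).
    rewrite IH by lia. f_equal. f_equal. lia.
Qed.

Lemma length_flat_map_blocks {A} (f : nat -> list A) n g : (forall p, length (f p) = g) ->
  forall k, length (flat_map f (seq k n)) = n * g.
Proof.
  intros Hf. induction n as [|n IH]; intros k; simpl; [easy|]. now rewrite length_app, Hf, IH.
Qed.

(** * Plays, and deviations that leave them unchanged *)

Section Plays.
Context (G : Game) (f : profile).

Lemma hist_last n : last (hist G f n) (g_v0 G) = play G f n.
Proof. reflexivity. Qed.

Lemma hist_map n : hist G f n = map (play G f) (seq 0 (S n)).
Proof.
  induction n as [|n IH]; [reflexivity|].
  rewrite seq_S, map_app, <- IH. simpl map. unfold play. cbn [hist Nat.add].
  now rewrite last_last.
Qed.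

Lemma play_S n :
  play G f (S n) = f (owner G (play G f n)) (map (play G f) (seq 0 n)) (play G f n).
Proof.
  unfold play at 1. cbn [hist]. rewrite last_last, hist_last. f_equal.
  rewrite hist_map, seq_S, map_app. simpl map. now rewrite removelast_last.
Qed.

Context (Hwf : wf_game G).
Context (Hleg : forall i, i <= g_k G -> legal_strategy G i (f i)).

Lemma play_vertices n : Forall (is_vertex G) (map (play G f) (seq 0 (S n))).
Proof.
  destruct Hwf as (_ & H2 & H3 & _ & H5 & _).
  induction n as [|n IH].
  - repeat constructor. exact H5.
  - rewrite seq_S, map_app. apply Forall_app. split; [exact IH|]. constructor; [|constructor].
    simpl. rewrite seq_S, map_app in IH. apply Forall_app in IH. destruct IH as [IH1 IH2].
    simpl in IH2. apply Forall_inv in IH2. rewrite play_S.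
    eapply (H3 (play G f n)), Hleg; auto.
Qed.

Lemma play_edge n : edge G (play G f n) (play G f (S n)).
Proof.
  rewrite play_S. pose proof (play_vertices n) as H. rewrite seq_S, map_app in H.
  apply Forall_app in H. destruct H as [H1 H2]. apply Forall_inv in H2. simpl in H2.
  apply Hleg; auto. now apply Hwf.
Qed.
End Plays.

(** A play consults only the owners of the vertices it visits, so changing the strategy of a player
    who has not yet been on move cannot show. *)
Lemma play_agree G f f' n : (forall m, m < n -> f' (owner G (play G f m)) = f (owner G (play G f m))) ->
  forall m, m <= n -> play G f' m = play G f m.
Proof.
  intros H m. induction m as [m IH] using lt_wf_ind. intros Hm. destruct m as [|m]; [reflexivity|].
  rewrite !play_S, (IH m) by lia. rewrite H by lia. f_equal.
  apply map_ext_in. intros j Hj. apply in_seq in Hj. apply IH; lia.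
Qed.

(* [P] moves with values below [g] are made in turn, move [p] by the system iff [own p]; the
   system must end with a history meeting all [C] clauses, where [lit c p a] says that choosing
   value [a] in move [p] meets clause [c]. *)
Section ClauseGame.
Context (P g C : nat) (own : nat -> bool) (lit : nat -> nat -> nat -> bool).
Context (Hg : 0 < g) (HC : 0 < C).

Definition clause_met (h : list nat) (c : nat) : bool :=
  existsb (fun p => lit c p (nth p h 0)) (seq 0 P).

Definition all_met (h : list nat) : bool := forallb (clause_met h) (seq 0 C).

Fixpoint win (n : nat) (h : list nat) : bool :=
  match n with
  | 0 => all_met h
  | S n' =>
      if own (length h) then existsb (fun a => win n' (h ++ [a])) (seq 0 g)
      else forallb (fun a => win n' (h ++ [a])) (seq 0 g)
  end.

Definition cv (p : nat) : nat := 1 + C + p.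
Definition vv (p a : nat) : nat := 2 + C + P + (p * g + a).

(* Vertex 0 is the exit, vertex [1 + c] the terminal of clause [c], [cv p] the vertex of move
   [p] (player 1 picks a clause at [cv P]), and [vv p a] the record of value [a] in move [p].
   The latter belongs to a player of its own, who wins at the exit and at the terminals of the
   clauses that this choice does not meet. *)
Definition clause_game : Game := {|
  g_nv := 2 + C + P + P * g;
  g_k := 1 + P * g;
  g_owner := repeat 0 (1 + C) ++ map (fun p => if own p then 0 else 1) (seq 0 P) ++ [1] ++
             map (fun i => 2 + i) (seq 0 (P * g));
  g_edges := map (fun c => (c, c)) (seq 0 (1 + C)) ++
             flat_map (fun p => map (fun a => (cv p, vv p a)) (seq 0 g)) (seq 0 P) ++
             map (fun c => (cv P, 1 + c)) (seq 0 C) ++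
             flat_map (fun p => flat_map (fun a => [(vv p a, cv (S p)); (vv p a, 0)]) (seq 0 g))
               (seq 0 P);
  g_v0 := cv 0;
  g_targets := [0] :: map S (seq 0 C) ::
             flat_map (fun p => map (fun a =>
               0 :: map (fun c => if lit c p a then 0 else S c) (seq 0 C)) (seq 0 g)) (seq 0 P)
|}.

Notation G := clause_game.

Definition clause_instance : Instance :=
  {| i_game := clause_game; i_mu := 1; i_t := g_nv clause_game |}.

Lemma edge_iff v w : edge G v w <->
  (v <= C /\ w = v) \/
  (exists p a, p < P /\ a < g /\ v = cv p /\ w = vv p a) \/
  (exists c, c < C /\ v = cv P /\ w = 1 + c) \/
  (exists p a, p < P /\ a < g /\ v = vv p a /\ (w = cv (S p) \/ w = 0)).
Proof.
  unfold edge. cbn [g_edges clause_game]. rewrite !in_app_iff, !in_flat_map, !in_map_iff.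
  split.
  - intros [(c & E & H)|[(p & H & H')|[(c & E & H)|(p & H & H')]]].
    + apply in_seq in H. injection E as -> ->. left. split; [lia | easy].
    + apply in_seq in H. apply in_map_iff in H'. destruct H' as (a & E & H').
      apply in_seq in H'. injection E as <- <-. right. left. exists p, a. repeat split; lia.
    + apply in_seq in H. injection E as <- <-. right. right. left. exists c. repeat split; lia.
    + apply in_seq in H. apply in_flat_map in H'. destruct H' as (a & H' & E).
      apply in_seq in H'. right. right. right. exists p, a.
      destruct E as [E|[E|[]]]; injection E as <- <-; repeat split; auto; lia.
  - intros [[H ->]|[(p & a & H1 & H2 & -> & ->)|[(c & H & -> & ->)|(p & a & H1 & H2 & -> & E)]]].
    + left. exists v. split; [easy|]. apply in_seq. lia.
    + right. left. exists p. split; [apply in_seq; lia|]. apply in_map_iff. exists a.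
      split; [easy | apply in_seq; lia].
    + right. right. left. exists c. split; [easy | apply in_seq; lia].
    + right. right. right. exists p. split; [apply in_seq; lia|]. apply in_flat_map. exists a.
      split; [apply in_seq; lia|]. simpl. destruct E as [-> | ->]; auto.
Qed.

Lemma owner_low v : v <= C -> owner G v = 0.
Proof.
  intros H. unfold owner. cbn [g_owner clause_game]. rewrite app_nth1 by (rewrite repeat_length; lia).
  apply nth_repeat_lt. lia.
Qed.

Lemma owner_cv p : p < P -> owner G (cv p) = if own p then 0 else 1.
Proof.
  intros H. unfold owner, cv. cbn [g_owner clause_game].
  rewrite app_nth2 by (rewrite repeat_length; lia). rewrite repeat_length.
  rewrite app_nth1 by (rewrite length_map, length_seq; lia).
  replace (1 + C + p - (1 + C)) with p by lia.
  now rewrite nth_map_seq.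
Qed.

Lemma owner_cvP : owner G (cv P) = 1.
Proof.
  unfold owner, cv. cbn [g_owner clause_game].
  rewrite app_nth2 by (rewrite repeat_length; lia). rewrite repeat_length.
  rewrite app_nth2 by (rewrite length_map, length_seq; lia).
  rewrite length_map, length_seq. now replace (1 + C + P - (1 + C) - P) with 0 by lia.
Qed.

Lemma owner_high i : i < P * g -> owner G (2 + C + P + i) = 2 + i.
Proof.
  intros H. unfold owner. cbn [g_owner clause_game].
  rewrite app_nth2 by (rewrite repeat_length; lia). rewrite repeat_length.
  rewrite app_nth2 by (rewrite length_map, length_seq; lia). rewrite length_map, length_seq.
  rewrite app_nth2 by (cbn [length]; lia). cbn [length].
  replace (2 + C + P + i - (1 + C) - P - 1) with i by lia.
  now rewrite nth_map_seq.
Qed.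

Lemma index_lt p a : p < P -> a < g -> p * g + a < P * g.
Proof. intros H1 H2. nia. Qed.

Lemma owner_vv p a : p < P -> a < g -> owner G (vv p a) = 2 + (p * g + a).
Proof. intros H1 H2. apply owner_high. now apply index_lt. Qed.

Lemma index_split i : i < P * g -> exists p a, p < P /\ a < g /\ i = p * g + a.
Proof.
  intros H. exists (i / g), (i mod g). repeat split.
  - apply Nat.Div0.div_lt_upper_bound. lia.
  - apply Nat.mod_upper_bound. lia.
  - rewrite (Nat.div_mod_eq i g) at 1. lia.
Qed.

Lemma vertex_cases v : is_vertex G v ->
  v <= C \/ (exists p, p < P /\ v = cv p) \/ v = cv P \/ exists p a, p < P /\ a < g /\ v = vv p a.
Proof.
  unfold is_vertex. cbn [g_nv clause_game]. intros H.
  destruct (le_lt_dec v C); [auto|]. right.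
  destruct (lt_eq_lt_dec v (cv P)) as [[H1| ->]|H1]; unfold cv in *.
  - left. exists (v - (1 + C)). split; lia.
  - auto.
  - right. right. destruct (index_split (v - (2 + C + P))) as (p & a & H2 & H3 & H4); [lia|].
    exists p, a. unfold vv. repeat split; lia.
Qed.

Lemma target_0 : target G 0 = [0].
Proof. reflexivity. Qed.

Lemma target_1 : target G 1 = map S (seq 0 C).
Proof. reflexivity. Qed.

Lemma target_vv p a : p < P -> a < g ->
  target G (2 + (p * g + a)) = 0 :: map (fun c => if lit c p a then 0 else S c) (seq 0 C).
Proof.
  intros Hp Ha. unfold target. cbn [g_targets clause_game Nat.add nth].
  rewrite (nth_flat_map_blocks _ P g) by (try easy; intros; now rewrite length_map, length_seq).
  now rewrite nth_map_seq.
Qed.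

Lemma target_low i v : i <= g_k G -> In v (target G i) -> v <= C.
Proof.
  cbn [g_k clause_game]. intros Hi H. destruct i as [|[|i]].
  - rewrite target_0 in H. destruct H as [<-|[]]. lia.
  - rewrite target_1, in_map_iff in H. destruct H as (c & <- & H). apply in_seq in H. lia.
  - destruct (index_split i) as (p & a & H1 & H2 & ->); [lia|].
    change (S (S (p * g + a))) with (2 + (p * g + a)) in H.
    rewrite (target_vv p a H1 H2) in H. destruct H as [<-|H]; [lia|].
    apply in_map_iff in H. destruct H as (c & <- & H). apply in_seq in H.
    destruct (lit c p a); lia.
Qed.

Lemma clause_game_wf : wf_game G.
Proof.
  assert (Hn : g_nv G = 2 + C + P + P * g) by reflexivity.
  repeat split.
  - cbn [g_owner g_nv clause_game]. rewrite !length_app, !length_map, !length_seq, repeat_length.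
    simpl. lia.
  - intros v Hv. cbn [g_k clause_game].
    destruct (vertex_cases v Hv) as [H|[(p & H & ->)|[->|(p & a & H1 & H2 & ->)]]].
    + rewrite owner_low by easy. lia.
    + rewrite owner_cv by easy. destruct (own p); lia.
    + rewrite owner_cvP. lia.
    + rewrite owner_vv by easy. pose proof (index_lt p a H1 H2). lia.
  - apply edge_iff in H. unfold is_vertex. rewrite Hn. unfold cv, vv in *.
    destruct H as [H|[(p & a & H1 & H2 & -> & ->)|[(c & H & -> & ->)|(p & a & H1 & H2 & -> & E)]]];
      try pose proof (index_lt p a H1 H2); lia.
  - apply edge_iff in H. unfold is_vertex. rewrite Hn. unfold cv, vv in *.
    destruct H as [H|[(p & a & H1 & H2 & -> & ->)|[(c & H & -> & ->)|(p & a & H1 & H2 & -> & E)]]];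
      try pose proof (index_lt p a H1 H2); lia.
  - intros v Hv.
    destruct (vertex_cases v Hv) as [H|[(p & H & ->)|[->|(p & a & H1 & H2 & ->)]]].
    + exists v. apply edge_iff. auto.
    + exists (vv p 0). apply edge_iff. right. left. exists p, 0. auto.
    + exists 1. apply edge_iff. right. right. left. exists 0. auto.
    + exists 0. apply edge_iff. right. right. right. exists p, a. auto.
  - unfold is_vertex. simpl. unfold cv. lia.
  - cbn [g_targets g_k clause_game length].
    rewrite (length_flat_map_blocks _ P g); [lia|]. intros p. now rewrite length_map, length_seq.
  - enough (v <= C) by (unfold is_vertex; simpl; lia). now apply (target_low i).
  - apply edge_iff. left. split; [|easy]. now apply (target_low i).
  - intros w Hw. apply target_low in H0; [|easy]. apply edge_iff in Hw. unfold cv, vv in Hw.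
    destruct Hw as [?|[(p & a & ?)|[(c & ?)|(p & a & ?)]]]; lia.
Qed.

Definition record (h : list nat) (n : nat) : list nat :=
  flat_map (fun i => [cv i; vv i (nth i h 0)]) (seq 0 n).

Definition follows (f : profile) (h : list nat) (n : nat) : Prop :=
  (forall i, i < n -> play G f (2 * i) = cv i /\ play G f (2 * i + 1) = vv i (nth i h 0)) /\
  play G f (2 * n) = cv n.

Lemma follows_record f h n : follows f h n -> map (play G f) (seq 0 (2 * n)) = record h n.
Proof.
  intros [H _]. induction n as [|n IH]; [reflexivity|].
  replace (2 * S n) with (2 * n + 2) by lia. unfold record.
  rewrite seq_app, map_app, (seq_S n), flat_map_app, IH by (intros; apply H; lia).
  fold (record h n). f_equal. destruct (H n ltac:(lia)) as [H1 H2]. simpl map. simpl flat_map.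
  simpl in H1, H2. rewrite !Nat.add_0_r in *. rewrite H1.
  replace (S (n + n)) with (n + n + 1) by lia. now rewrite H2.
Qed.

Lemma record_ext h h' n : (forall i, i < n -> nth i h 0 = nth i h' 0) -> record h n = record h' n.
Proof.
  intros H. unfold record.
  induction n as [|n IH]; [reflexivity|]. rewrite seq_S, !flat_map_app, IH by (intros; apply H; lia).
  simpl. now rewrite H by lia.
Qed.

(** Exactly the record vertices have numbers from [2 + C + P] on, and their offset modulo [g] is the
    value; the order of the visits is the order of the moves. *)
Definition decode (x : list nat) : list nat :=
  map (fun v => (v - (2 + C + P)) mod g) (filter (fun v => 2 + C + P <=? v) x).

Lemma decode_record h n : n <= P -> length h = n -> Forall (fun a => a < g) h -> decode (record h n) = h.
Proof.
  intros Hn Hl Hh. transitivity (firstn n h); [|subst n; apply firstn_all].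
  assert (Hm : n <= length h) by lia. clear Hl. revert Hm.
  induction n as [|n IH]; intros Hm; [reflexivity|].
  unfold record. rewrite seq_S, flat_map_app. fold (record h n). simpl flat_map. unfold decode.
  rewrite filter_app, map_app. fold (decode (record h n)). rewrite IH by lia.
  rewrite <- (firstn_skipn n h) at 3.
  rewrite firstn_app, firstn_firstn, length_firstn, Nat.min_r, Nat.min_l by lia.
  replace (S n - n) with 1 by lia. f_equal.
  assert (Ha : nth n h 0 < g) by (rewrite Forall_forall in Hh; apply Hh, nth_In; lia).
  cbn [filter app].
  destruct (Nat.leb_spec (2 + C + P) (cv n)) as [L|L]; [unfold cv in L; lia|].
  destruct (Nat.leb_spec (2 + C + P) (vv n (nth n h 0))) as [L'|L']; [|unfold vv in L'; lia].
  cbn [map]. replace (vv n (nth n h 0) - (2 + C + P)) with (nth n h 0 + n * g) by (unfold vv; lia).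
  rewrite Nat.Div0.mod_add, Nat.mod_small by easy.
  replace (nth n h 0) with (nth 0 (skipn n h) 0) by (rewrite nth_skipn; f_equal; lia).
  destruct (skipn n h) eqn:E; [|reflexivity].
  apply (f_equal (@length nat)) in E. rewrite length_skipn in E. simpl in E. lia.
Qed.

Definition best (h : list nat) : nat :=
  match find (fun a => win (P - length h - 1) (h ++ [a])) (seq 0 g) with
  | Some a => a
  | None => 0
  end.

Lemma best_lt h : best h < g.
Proof.
  unfold best. destruct (find _ _) eqn:E; [|easy]. apply find_some in E.
  destruct E as [E _]. apply in_seq in E. lia.
Qed.

Lemma best_win n h : P = length h + S n -> own (length h) = true -> win (S n) h = true ->
  win n (h ++ [best h]) = true.
Proof.
  intros HP Ho Hw. simpl in Hw. rewrite Ho in Hw. apply existsb_exists in Hw.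
  destruct Hw as (a & Ha & Hw). unfold best.
  replace (P - length h - 1) with n by lia.
  destruct (find _ _) eqn:E.
  - now apply find_some in E.
  - rewrite (find_none _ _ E a Ha) in Hw. discriminate.
Qed.

Definition sys_choice (x : list nat) (v : nat) : nat :=
  if v <=? C then v else vv (v - (1 + C)) (best (decode x)).

(** Truncating the history first makes any strategy [t]-memory by construction. Nothing is lost at a
    move vertex of a play following the moves: the history there has length at most [2 * P], less
    than [g_nv]. *)
Definition window (t : nat) (x : list nat) : list nat :=
  if t <? length x then skipn (length x - t) x else x.

Definition sys_strategy : strategy := fun x v => sys_choice (window (g_nv G) x) v.

Lemma sys_strategy_ok : pure_tmem_strategy G (g_nv G) 0 sys_strategy.
Proof.
  split.
  - intros x v _ Hv Ho. unfold sys_strategy, sys_choice. apply edge_iff.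
    destruct (vertex_cases v Hv) as [H|[(p & H & ->)|[->|(p & a & H1 & H2 & ->)]]].
    + left. destruct (Nat.leb_spec v C); [easy | lia].
    + right. left. destruct (Nat.leb_spec (cv p) C) as [L|L]; [unfold cv in L; lia|].
      replace (cv p - (1 + C)) with p by (unfold cv; lia).
      eexists p, _. split; [easy|]. split; [apply best_lt | easy].
    + rewrite owner_cvP in Ho. discriminate.
    + rewrite owner_vv in Ho by easy. discriminate.
  - intros x v _ _ _ Hl. unfold sys_strategy, window. rewrite length_skipn.
    destruct (Nat.ltb_spec (g_nv G) (length x)); [|lia].
    destruct (Nat.ltb_spec (g_nv G) (length x - (length x - g_nv G))); [lia | easy].
Qed.

Lemma pay_cases (H : Game) f i : (wins H f i /\ Pay H f i = 1%Q) \/ (~ wins H f i /\ Pay H f i = 0%Q).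
Proof. unfold Pay. destruct (ClassicalDescription.excluded_middle_informative _); auto. Qed.

Lemma win_answer : win P [] = true -> NNCRSP_answer clause_instance.
Proof.
  intros Hw. exists sys_strategy. split; [apply sys_strategy_ok|].
  intros env Henv HNE. cbn [i_game i_mu i_t clause_instance] in *.
  set (f := Defs.combine sys_strategy env) in *.
  destruct (pay_cases G f 0) as [[_ ->]|[Hn _]]; [apply Qle_refl|]. exfalso.
  pose proof clause_game_wf as Hwf.
  assert (Hleg : forall i, i <= g_k G -> legal_strategy G i (f i)).
  { intros [|i] Hi; [apply sys_strategy_ok|]. apply (Henv (S i)). lia. }
  (* The exit is the only target of the system, so an unpaid system means that it is never taken and
     every record vertex passes on to the next move. *)
  assert (H0 : forall n, play G f n <> 0).
  { intros n E. apply Hn. exists n. rewrite target_0, E. now left. }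
  assert (Hf : forall n, n <= P -> exists h, length h = n /\ Forall (fun a => a < g) h /\
    win (P - n) h = true /\ follows f h n).
  { induction n as [|n IH]; intros Hle.
    - exists []. rewrite Nat.sub_0_r. repeat split; auto; lia.
    - destruct IH as (h & Hl & Hh & Hwin & Hfol); [lia|].
      pose proof (follows_record _ _ _ Hfol) as Hrec. destruct Hfol as [Hf1 Hf2].
      assert (Ha : exists a, a < g /\ win (P - S n) (h ++ [a]) = true /\
                     play G f (2 * n + 1) = vv n a).
      { replace (P - n) with (S (P - S n)) in Hwin by lia.
        destruct (own n) eqn:Eo.
        - exists (best h). split; [apply best_lt|]. split.
          + apply best_win; [lia | now rewrite Hl | easy].
          + rewrite Nat.add_1_r, play_S, Hf2, owner_cv, Eo, Hrec by lia.
            change (f 0) with sys_strategy. unfold sys_strategy, window.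
            destruct (Nat.ltb_spec (g_nv G) (length (record h n))) as [L|L].
            { rewrite <- Hrec, length_map, length_seq in L. simpl in L. nia. }
            unfold sys_choice.
            destruct (Nat.leb_spec (cv n) C) as [L'|L']; [unfold cv in L'; lia|].
            rewrite decode_record by (easy || lia).
            f_equal. unfold cv. lia.
        - simpl in Hwin. rewrite Hl, Eo, forallb_forall in Hwin.
          pose proof (play_edge G f Hwf Hleg (2 * n)) as He. rewrite Hf2 in He.
          apply edge_iff in He. unfold cv, vv in He.
          destruct He as [?|[(p & a & H1 & H2 & H3 & H4)|[(c & ?)|(p & a & ?)]]]; try lia.
          assert (p = n) by lia. subst p. exists a. split; [easy|]. split.
          + apply Hwin. apply in_seq. lia.
          + rewrite Nat.add_1_r. exact H4. }
      destruct Ha as (a & Ha & Hwa & Hpa). exists (h ++ [a]).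
      split; [rewrite length_app; simpl; lia|].
      split; [apply Forall_app; auto|]. split; [easy|]. split.
      + intros i Hi. destruct (Nat.eq_dec i n) as [->|Hne].
        * rewrite app_nth2, Hl, Nat.sub_diag by lia. easy.
        * rewrite app_nth1 by lia. apply Hf1. lia.
      + pose proof (play_edge G f Hwf Hleg (2 * n + 1)) as He. rewrite Hpa in He.
        replace (2 * S n) with (S (2 * n + 1)) by lia. pose proof (H0 (S (2 * n + 1))) as Hz.
        apply edge_iff in He. unfold cv, vv in He |- *.
        destruct He as [?|[(p & a' & ?)|[(c & ?)|(p & a' & H1 & H2 & H3 & H4)]]]; try lia.
        destruct (block_index_inj g n a p a' Ha H2 ltac:(lia)) as [<- <-]. lia. }
  destruct (Hf P ltac:(lia)) as (h & Hl & Hh & Hwin & Hfol). rewrite Nat.sub_diag in Hwin.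
  destruct Hfol as [Hf1 Hf2].
  assert (Hc : exists c, c < C /\ play G f (2 * P + 1) = S c).
  { pose proof (play_edge G f Hwf Hleg (2 * P)) as He. rewrite Hf2, <- Nat.add_1_r in He.
    apply edge_iff in He. unfold cv, vv in He.
    destruct He as [?|[(p & a & ?)|[(c & H1 & H2 & H3)|(p & a & ?)]]]; try lia.
    now exists c. }
  destruct Hc as (c & Hc & Hpc).
  assert (Hend : forall n, play G f (2 * P + 1 + n) = S c).
  { induction n as [|n IH]; [now rewrite Nat.add_0_r|]. rewrite Nat.add_succ_r.
    pose proof (play_edge G f Hwf Hleg (2 * P + 1 + n)) as He. rewrite IH in He.
    apply edge_iff in He. unfold cv, vv in He.
    destruct He as [?|[(p & a & ?)|[(c' & ?)|(p & a & ?)]]]; lia. }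
  simpl in Hwin. unfold all_met in Hwin. rewrite forallb_forall in Hwin.
  specialize (Hwin c ltac:(apply in_seq; lia)). unfold clause_met in Hwin.
  apply existsb_exists in Hwin. destruct Hwin as (p & Hp & Hlit). apply in_seq in Hp.
  assert (Ha : nth p h 0 < g) by (rewrite Forall_forall in Hh; apply Hh, nth_In; lia).
  set (a := nth p h 0) in *. set (i := 2 + (p * g + a)).
  pose proof (index_lt p a ltac:(lia) Ha) as Hlt.
  assert (Hi : 1 <= i <= g_k G) by (unfold i; simpl; lia).
  (* Player [i] owns record vertices only, and each of them has an edge to the exit, so always going
     there is legal. *)
  assert (Htau : pure_tmem_strategy G (g_nv G) i (fun _ _ => 0)).
  { split; [|easy]. intros x v _ Hv Ho. apply edge_iff.
    destruct (vertex_cases v Hv) as [H|[(p' & H & ->)|[->|(p' & a' & H1 & H2 & ->)]]].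
    - rewrite owner_low in Ho by easy. discriminate.
    - rewrite owner_cv in Ho by easy. unfold i in Ho. destruct (own p'); discriminate.
    - rewrite owner_cvP in Ho. discriminate.
    - right. right. right. exists p', a'. auto. }
  specialize (HNE i Hi _ Htau).
  destruct (pay_cases G (update f i (fun _ _ => 0)) i) as [[_ E1]|[E1 _]].
  - rewrite E1 in HNE. destruct (pay_cases G f i) as [[[n Hwn] _]|[_ E2]].
    2: { rewrite E2 in HNE. revert HNE. unfold Qle. simpl. lia. }
    unfold i in Hwn. rewrite target_vv in Hwn by (easy || lia).
    destruct Hwn as [E|Hwn]; [now apply (H0 n)|].
    apply in_map_iff in Hwn. destruct Hwn as (c' & E & Hc'). apply in_seq in Hc'.
    destruct (lit c' p a) eqn:El; [now apply (H0 n)|].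
    destruct (le_lt_dec (2 * P + 1) n) as [Ln|Ln].
    + replace n with (2 * P + 1 + (n - (2 * P + 1))) in E by lia. rewrite Hend in E.
      injection E as ->. congruence.
    + destruct (Nat.Even_or_Odd n) as [[q Hq]|[q Hq]]; rewrite Hq in E.
      * destruct (Nat.eq_dec q P) as [->|]; [rewrite Hf2 in E|rewrite (proj1 (Hf1 q ltac:(lia))) in E];
          unfold cv in E; lia.
      * rewrite (proj2 (Hf1 q ltac:(lia))) in E. unfold vv in E. lia.
  - apply E1. exists (2 * p + 2). unfold i. rewrite target_vv by (easy || lia). fold i. left.
    (* Record vertices come in the order of the moves, so player [i] is first on move at time
       [2 * p + 1], and the deviation leaves the play alone up to there. *)
    assert (Hag : forall m, m <= 2 * p + 1 -> play G (update f i (fun _ _ => 0)) m = play G f m).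
    { intros m Hm. apply (play_agree _ _ _ (2 * p + 1)); [|easy]. intros m' Hm'. unfold update.
      destruct (Nat.eqb_spec (owner G (play G f m')) i) as [E|]; [exfalso|easy].
      destruct (Nat.Even_or_Odd m') as [[q Hq]|[q Hq]]; rewrite Hq in E.
      - rewrite (proj1 (Hf1 q ltac:(lia))), owner_cv in E by lia. unfold i in E.
        destruct (own q); discriminate.
      - assert (Haq : nth q h 0 < g) by (rewrite Forall_forall in Hh; apply Hh, nth_In; lia).
        rewrite (proj2 (Hf1 q ltac:(lia))), owner_vv in E by (easy || lia). unfold i in E.
        destruct (block_index_inj g q (nth q h 0) p a Haq Ha ltac:(lia)). lia. }
    replace (2 * p + 2) with (S (2 * p + 1)) by lia. rewrite play_S, Hag by lia.
    rewrite (proj2 (Hf1 p ltac:(lia))), owner_vv by (easy || lia). fold a i.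
    unfold update. now rewrite Nat.eqb_refl.
Qed.

(** Memoryless, since the refuting history [h] and the clause [c] are fixed beforehand and the
    number of a vertex tells which move it belongs to. *)
Definition env_strategy (h : list nat) (c : nat) : profile := fun i _ v =>
  if Nat.eqb i 1 then (if Nat.eqb v (cv P) then S c else vv (v - (1 + C)) (nth (v - (1 + C)) h 0))
  else cv (S ((v - (2 + C + P)) / g)).

Lemma env_strategy_ok h c i t : c < C -> length h = P -> Forall (fun a => a < g) h ->
  1 <= i -> pure_tmem_strategy G t i (env_strategy h c i).
Proof.
  intros Hc Hl Hh Hi. split; [|easy]. intros x v _ Hv Ho. unfold env_strategy. apply edge_iff.
  destruct (vertex_cases v Hv) as [H|[(p & H & ->)|[->|(p & a & H1 & H2 & ->)]]].
  - rewrite owner_low in Ho by easy. lia.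
  - rewrite owner_cv in Ho by easy. destruct (own p); [lia|]. subst i. change (1 =? 1) with true. cbv iota.
    destruct (Nat.eqb_spec (cv p) (cv P)) as [E|_]; [unfold cv in E; lia|].
    replace (cv p - (1 + C)) with p by (unfold cv; lia).
    right. left. exists p, (nth p h 0). repeat split; auto.
    rewrite Forall_forall in Hh. apply Hh, nth_In. lia.
  - rewrite owner_cvP in Ho. subst i. rewrite !Nat.eqb_refl. right. right. left. now exists c.
  - rewrite owner_vv in Ho by easy. subst i.
    change (2 + (p * g + a) =? 1) with false. cbv iota. right. right. right.
    exists p, a. repeat split; auto. left. f_equal. f_equal.
    replace (vv p a - (2 + C + P)) with (p * g + a) by (unfold vv; lia).
    rewrite Nat.div_add_l by lia. rewrite Nat.div_small by easy. lia.
Qed.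

(** The strategy of the system is given first, so its answers can be traced. At a move of the system
    every value loses, in particular the one that [s0] picks after the history so far; at a move of
    the environment some value loses. *)
Lemma losing_history s0 : legal_strategy G 0 s0 -> win P [] = false ->
  forall n, n <= P -> exists h, length h = n /\ Forall (fun a => a < g) h /\
    win (P - n) h = false /\
    forall i, i < n -> own i = true -> s0 (record h i) (cv i) = vv i (nth i h 0).
Proof.
  intros Hs Hw. induction n as [|n IH]; intros Hn.
  - exists []. rewrite Nat.sub_0_r. repeat split; auto. lia.
  - destruct IH as (h & Hl & Hh & Hwin & Hc); [lia|].
    assert (Ha : exists a, a < g /\ win (P - S n) (h ++ [a]) = false /\
      (own n = true -> s0 (record h n) (cv n) = vv n a)).
    { replace (P - n) with (S (P - S n)) in Hwin by lia. simpl in Hwin. rewrite Hl in Hwin.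
      destruct (own n) eqn:Eo.
      - assert (He : edge G (cv n) (s0 (record h n) (cv n))).
        { apply Hs.
          - unfold history. apply Forall_forall.
            intros v Hv. apply in_flat_map in Hv. destruct Hv as (j & Hj & Hv). apply in_seq in Hj.
            unfold is_vertex. cbn [g_nv clause_game]. destruct Hv as [<-|[<-|[]]].
            + unfold cv. lia.
            + assert (nth j h 0 < g) by (rewrite Forall_forall in Hh; apply Hh, nth_In; lia).
              pose proof (index_lt j (nth j h 0) ltac:(lia) H). unfold vv. lia.
          - unfold is_vertex, cv. cbn [g_nv clause_game]. lia.
          - rewrite owner_cv by lia. now rewrite Eo. }
        apply edge_iff in He.
        destruct He as [?|[(p & a & H1 & H2 & H3 & H4)|[(c & ?)|(p & a & ?)]]];
          try (unfold cv, vv in *; lia).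
        assert (p = n) by (unfold cv in H3; lia). subst p. exists a. repeat split; auto.
        destruct (win (P - S n) (h ++ [a])) eqn:E; [|easy].
        rewrite <- Hwin. symmetry. apply existsb_exists. exists a. split; [apply in_seq; lia | easy].
      - apply not_true_iff_false in Hwin. rewrite forallb_forall in Hwin.
        apply not_all_ex_not in Hwin. destruct Hwin as [a Ha]. exists a.
        apply imply_to_and in Ha. destruct Ha as [Ha1 Ha2]. apply in_seq in Ha1.
        repeat split; [lia | now apply not_true_iff_false | easy]. }
    destruct Ha as (a & Ha & Hwa & Hsa). exists (h ++ [a]).
    split; [rewrite length_app; simpl; lia|]. split; [apply Forall_app; auto|]. split; [easy|].
    intros i Hi Ho.
    rewrite (record_ext (h ++ [a]) h) by (intros j Hj; rewrite app_nth1; [easy | lia]).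
    destruct (Nat.eq_dec i n) as [->|Hne].
    + rewrite app_nth2, Hl, Nat.sub_diag by lia. now apply Hsa.
    + rewrite app_nth1 by lia. apply Hc; [lia | easy].
Qed.

Lemma answer_win : NNCRSP_answer clause_instance -> win P [] = true.
Proof.
  intros (s0 & Hs0 & Hall). cbn [i_game i_mu i_t clause_instance] in *.
  apply not_false_iff_true. intros Hw.
  destruct (losing_history s0 (proj1 Hs0) Hw P ltac:(lia)) as (h & Hl & Hh & Hwin & Hcons).
  rewrite Nat.sub_diag in Hwin. simpl in Hwin. unfold all_met in Hwin.
  apply not_true_iff_false in Hwin. rewrite forallb_forall in Hwin.
  apply not_all_ex_not in Hwin. destruct Hwin as [c Hc]. apply imply_to_and in Hc.
  destruct Hc as [Hc Hlit]. apply in_seq in Hc.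
  assert (Hlit' : forall p, p < P -> lit c p (nth p h 0) = false).
  { intros p Hp. destruct (lit c p (nth p h 0)) eqn:E; [|easy]. exfalso. apply Hlit.
    apply existsb_exists. exists p. split; [apply in_seq; lia | easy]. }
  assert (Hlt : forall p, p < P -> nth p h 0 < g).
  { intros p Hp. rewrite Forall_forall in Hh. apply Hh, nth_In. lia. }
  set (env := env_strategy h c). specialize (Hall env).
  set (f := Defs.combine s0 env) in *.
  assert (Hf0 : forall i, f (S i) = env (S i)) by reflexivity.
  assert (Hfol : forall n, n <= P -> follows f h n).
  { induction n as [|n IH]; intros Hn.
    - split; [lia | reflexivity].
    - specialize (IH ltac:(lia)). pose proof (follows_record _ _ _ IH) as Hrec.
      destruct IH as [H1 H2].
      assert (E1 : play G f (2 * n + 1) = vv n (nth n h 0)).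
      { rewrite Nat.add_1_r, play_S, H2, Hrec, owner_cv by lia. destruct (own n) eqn:Eo.
        - apply Hcons; [lia | easy].
        - rewrite Hf0. unfold env, env_strategy. change (1 =? 1) with true. cbv iota.
          destruct (Nat.eqb_spec (cv n) (cv P)) as [E|_]; [unfold cv in E; lia|].
          now replace (cv n - (1 + C)) with n by (unfold cv; lia). }
      split.
      + intros i Hi. destruct (Nat.eq_dec i n) as [->|Hne]; [easy|]. apply H1. lia.
      + replace (2 * S n) with (S (2 * n + 1)) by lia.
        rewrite play_S, E1, owner_vv by (auto; lia).
        change (f (2 + (n * g + nth n h 0))) with (env (2 + (n * g + nth n h 0))).
        unfold env, env_strategy. change (2 + (n * g + nth n h 0) =? 1) with false. cbv iota.
        replace (vv n (nth n h 0) - (2 + C + P)) with (n * g + nth n h 0) by (unfold vv; lia).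
        rewrite Nat.div_add_l, Nat.div_small by (auto; lia). now rewrite Nat.add_0_r. }
  destruct (Hfol P ltac:(lia)) as [Hf1 Hf2]. clear Hfol.
  assert (Hend : forall n, play G f (2 * P + 1 + n) = S c).
  { induction n as [|n IH].
    - rewrite Nat.add_0_r, Nat.add_1_r, play_S, Hf2, owner_cvP, Hf0.
      unfold env, env_strategy. now rewrite !Nat.eqb_refl.
    - rewrite Nat.add_succ_r, play_S, IH, owner_low by lia. change (f 0) with s0.
      (* The terminals belong to the system; the arbitrary strategy [s0] is held there by legality,
         since the loop is the only edge. *)
      assert (He : edge G (S c) (s0 (map (play G f) (seq 0 (2 * P + 1 + n))) (S c))).
      { apply Hs0.
        - unfold history.
          assert (Hfl : forall i, i <= g_k G -> legal_strategy G i (f i)).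
          { intros [|i] Hi; [apply Hs0|]. rewrite Hf0. apply (env_strategy_ok h c (S i) 0); auto; lia. }
          pose proof (play_vertices G f clause_game_wf Hfl (2 * P + 1 + n)) as Hv.
          rewrite seq_S, map_app in Hv. now apply Forall_app in Hv.
        - unfold is_vertex. cbn [g_nv clause_game]. lia.
        - apply owner_low. lia. }
      apply edge_iff in He. unfold cv, vv in He.
      destruct He as [?|[(p & a & ?)|[(c' & ?)|(p & a & ?)]]]; lia. }
  assert (Hcases : forall n, (exists p, p <= P /\ play G f n = cv p) \/
    (exists p, p < P /\ play G f n = vv p (nth p h 0)) \/ play G f n = S c).
  { intros n. destruct (le_lt_dec (2 * P + 1) n) as [Ln|Ln].
    - right. right. replace n with (2 * P + 1 + (n - (2 * P + 1))) by lia. apply Hend.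
    - destruct (Nat.Even_or_Odd n) as [[q Hq]|[q Hq]]; rewrite Hq.
      + left. exists q. split; [lia|].
        destruct (Nat.eq_dec q P) as [->|]; [easy|]. apply Hf1. lia.
      + right. left. exists q. split; [lia|]. apply Hf1. lia. }
  assert (HNE : zero_fixed_NE G (g_nv G) f).
  { intros i Hi tau Htau.
    assert (Hin : In (S c) (target G i) -> Qle (Pay G (update f i tau) i) (Pay G f i)).
    { intros Ht. destruct (pay_cases G f i) as [[_ ->]|[Hn _]].
      - destruct (pay_cases G (update f i tau) i) as [[_ ->]|[_ ->]]; unfold Qle; simpl; lia.
      - exfalso. apply Hn. exists (2 * P + 1 + 0). now rewrite Hend. }
    destruct i as [|[|i]]; [lia| |].
    - apply Hin. rewrite target_1. apply in_map. apply in_seq. lia.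
    - simpl in Hi. destruct (index_split i) as (p & a & H1 & H2 & ->); [lia|].
      destruct (lit c p a) eqn:El.
      (* All values on the play miss clause [c], whereas the value of this player meets it. So this
         player is never on move, and no deviation has an effect. *)
      + assert (Hag : forall n, play G (update f (2 + (p * g + a)) tau) n = play G f n).
        { intros n. apply (play_agree _ _ _ n); [|easy]. intros m _. unfold update.
          destruct (Nat.eqb_spec (owner G (play G f m)) (2 + (p * g + a))) as [E|]; [exfalso|easy].
          destruct (Hcases m) as [(q & Hq & Em)|[(q & Hq & Em)|Em]]; rewrite Em in E.
          - destruct (Nat.eq_dec q P) as [->|]; [rewrite owner_cvP in E; lia|].
            rewrite owner_cv in E by lia. destruct (own q); discriminate.
          - rewrite owner_vv in E by auto.
            destruct (block_index_inj g q (nth q h 0) p a (Hlt q Hq) H2 ltac:(lia)) as [<- <-].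
            rewrite Hlit' in El by easy. discriminate.
          - rewrite owner_low in E by lia. discriminate. }
        change (S (S (p * g + a))) with (2 + (p * g + a)).
        assert (Hiff : wins G (update f (2 + (p * g + a)) tau) (2 + (p * g + a)) ->
                       wins G f (2 + (p * g + a))).
        { intros [n Hn]. exists n. now rewrite <- Hag. }
        destruct (pay_cases G f (2 + (p * g + a))) as [[_ ->]|[Hn ->]];
          destruct (pay_cases G (update f (2 + (p * g + a)) tau) (2 + (p * g + a))) as [[Hn' ->]|[_ ->]];
          try (unfold Qle; simpl; lia). tauto.
      + apply Hin. change (S (S (p * g + a))) with (2 + (p * g + a)). rewrite target_vv by easy.
        right. apply in_map_iff. exists c. rewrite El. split; [easy | apply in_seq; lia]. }
  specialize (Hall (fun i Hi => env_strategy_ok h c i _ (proj2 Hc) Hl Hh (proj1 Hi)) HNE).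
  destruct (pay_cases G f 0) as [[[n Hn] _]|[_ E]].
  - rewrite target_0 in Hn. destruct Hn as [Hn|[]].
    destruct (Hcases n) as [(p & _ & E)|[(p & _ & E)|E]]; rewrite E in Hn; discriminate.
  - rewrite E in Hall. revert Hall. unfold Qle. simpl. lia.
Qed.

Theorem clause_instance_answer : NNCRSP_answer clause_instance <-> win P [] = true.
Proof. split; [apply answer_win | apply win_answer]. Qed.

End ClauseGame.

(** * Midpoint games *)

Lemma iter_add_nat {A} (f : A -> A) m n x : Nat.iter (m + n) f x = Nat.iter m f (Nat.iter n f x).
Proof. induction m; simpl; congruence. Qed.

Section Blocks.
Context (g W m : nat) (T : list nat -> list nat) (initw : list nat) (ok : nat -> bool).

Definition is_word (u : list nat) : Prop := length u = W /\ Forall (fun a => a < g) u.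

Context (Hg : 1 < g) (HW : 0 < W).
Context (HT : forall u, is_word u -> is_word (T u)) (Hinit : is_word initw).

(* Round [r] occupies blocks [4r .. 4r+3]: start, middle and end of a claimed run of length
   [2^(m-r)], then the opponent's choice of half, read off the first symbol of its block. *)
Definition link (r : nat) (bs : list (list nat)) (A B : list nat) : Prop :=
  match r with
  | 0 => A = initw /\ forallb ok B = true
  | S r' =>
      if Nat.eqb (nth 0 (nth (4 * r' + 3) bs []) 0) 0
      then A = nth (4 * r') bs [] /\ B = nth (4 * r' + 1) bs []
      else A = nth (4 * r' + 1) bs [] /\ B = nth (4 * r' + 2) bs []
  end.

(** Round [m] claims a run of a single step, the one place where words are compared through [T]. *)
Definition valid (bs : list (list nat)) : Prop :=
  (forall r, r <= m -> link r bs (nth (4 * r) bs []) (nth (4 * r + 2) bs [])) /\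
  nth (4 * m + 2) bs [] = T (nth (4 * m) bs []).

(** The choice of half fills a whole word so that all blocks have the same length, and division by
    [W] finds the block of a single move. *)
Fixpoint bwin (n : nat) (bs : list (list nat)) : Prop :=
  match n with
  | 0 => valid bs
  | S n' =>
      if Nat.eqb (length bs mod 4) 3 then forall u, is_word u -> bwin n' (bs ++ [u])
      else exists u, is_word u /\ bwin n' (bs ++ [u])
  end.

Lemma link_app r bs ext A B : 4 * r <= length bs -> link r (bs ++ ext) A B <-> link r bs A B.
Proof.
  intros H. destruct r as [|r]; [easy|]. unfold link. now rewrite !app_nth1 by lia.
Qed.

Lemma bwin_round n bs r : length bs = 4 * r -> bwin (4 + n) bs <->
  exists A M B, is_word A /\ is_word M /\ is_word B /\
    forall D, is_word D -> bwin n (bs ++ [A; M; B; D]).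
Proof.
  intros Hl. cbn [bwin Nat.add].
  assert (Hmod : forall i, i < 4 -> (length bs + i) mod 4 = i).
  { intros i Hi. rewrite Hl, Nat.add_comm, Nat.mul_comm, Nat.Div0.mod_add. now apply Nat.mod_small. }
  assert (E : forall i (l : list (list nat)), length l = i -> i < 4 -> length (bs ++ l) mod 4 = i).
  { intros i l <- Hi. rewrite length_app. now apply Hmod. }
  pose proof (Hmod 0 ltac:(lia)) as E0. rewrite Nat.add_0_r in E0. rewrite E0.
  change (0 =? 3) with false. cbv iota.
  split.
  - intros (A & HA & H). rewrite (E 1) in H by (simpl; auto; lia).
    change (1 =? 3) with false in H. cbv iota in H.
    destruct H as (M & HM & H). rewrite <- app_assoc in H. rewrite (E 2) in H by (simpl; auto; lia).
    change (2 =? 3) with false in H. cbv iota in H.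
    destruct H as (B & HB & H). exists A, M, B. split; [easy|]. split; [easy|]. split; [easy|].
    rewrite <- app_assoc in H. rewrite (E 3) in H by (simpl; auto; lia).
    intros D HD. specialize (H D HD). now rewrite <- app_assoc in H.
  - intros (A & M & B & HA & HM & HB & H).
    exists A. split; [easy|]. rewrite (E 1) by (simpl; auto; lia).
    exists M. split; [easy|]. rewrite <- app_assoc, (E 2) by (simpl; auto; lia).
    exists B. split; [easy|]. rewrite <- app_assoc, (E 3) by (simpl; auto; lia).
    intros D HD. rewrite <- app_assoc. now apply H.
Qed.

Lemma const_word a : a < g -> is_word (repeat a W).
Proof.
  intros Ha. split; [apply repeat_length|]. apply Forall_forall. intros b Hb.
  apply repeat_spec in Hb. now subst b.
Qed.

Lemma hd_const a : nth 0 (repeat a W) 0 = a.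
Proof. destruct W; [lia | easy]. Qed.

(** Let the opponent answer with zeros throughout. The validity condition is tested only at the end
    of the game, yet the links of the rounds already played depend on the prefix alone; any
    completion reveals them. *)
Lemma bwin_extend n : forall bs, bwin n bs -> exists ext, valid (bs ++ ext).
Proof.
  induction n as [|n IH]; intros bs H.
  - exists []. now rewrite app_nil_r.
  - assert (E : exists u, bwin n (bs ++ [u])).
    { simpl in H. destruct (Nat.eqb _ _).
      - exists (repeat 0 W). apply H, const_word. lia.
      - destruct H as (u & _ & H). eauto. }
    destruct E as [u Hu]. destruct (IH _ Hu) as [ext He]. rewrite <- app_assoc in He. eauto.
Qed.

Lemma nth_round (bs : list (list nat)) r A M B D ext i d : length bs = 4 * r -> i < 4 ->
  nth (4 * r + i) (bs ++ [A; M; B; D] ++ ext) d = nth i [A; M; B; D] d.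
Proof.
  intros Hl Hi. rewrite app_nth2, Hl by lia. replace (4 * r + i - 4 * r) with i by lia.
  apply app_nth1. easy.
Qed.

Lemma valid_link bs r A M B D ext : r <= m -> length bs = 4 * r ->
  valid (bs ++ [A; M; B; D] ++ ext) -> link r bs A B.
Proof.
  intros Hr Hl [H _]. specialize (H r Hr). rewrite link_app in H by lia.
  rewrite nth_round in H by (easy || lia).
  rewrite <- (Nat.add_0_r (4 * r)), nth_round in H by (easy || lia). exact H.
Qed.

Lemma bwin_run k : forall r bs, r + k = m -> length bs = 4 * r -> bwin (4 * S k) bs ->
  exists A B, B = Nat.iter (2 ^ k) T A /\ link r bs A B.
Proof.
  induction k as [|k IH]; intros r bs Hr Hl H.
  - apply (bwin_round 0 bs r Hl) in H. destruct H as (A & M & B & HA & HM & HB & H).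
    specialize (H (repeat 0 W) (const_word 0 ltac:(lia))). simpl in H.
    rewrite <- (app_nil_r [A; M; B; _]) in H. exists A, B. split.
    + destruct H as [_ H]. rewrite Nat.add_0_r in Hr. subst r.
      rewrite nth_round in H by (easy || lia).
      rewrite <- (Nat.add_0_r (4 * m)), nth_round in H by (easy || lia). exact H.
    + eapply valid_link; [|exact Hl|exact H]. lia.
  - replace (4 * S (S k)) with (4 + 4 * S k) in H by lia.
    apply (bwin_round _ bs r Hl) in H. destruct H as (A & M & B & HA & HM & HB & H).
    exists A, B.
    (* The three words are on the table before the opponent chooses, so both choices speak of the
       same midpoint; 0 and 1 are available as answers because [1 < g]. *)
    assert (G : forall a, a < g -> exists A' B', B' = Nat.iter (2 ^ k) T A' /\
      if Nat.eqb a 0 then A' = A /\ B' = M else A' = M /\ B' = B).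
    { intros a Ha. specialize (H (repeat a W) (const_word a Ha)).
      apply IH with (r := S r) in H; [|lia|rewrite length_app, Hl; simpl; lia].
      destruct H as (A' & B' & E & Hlk). exists A', B'. split; [easy|].
      unfold link in Hlk. rewrite <- (app_nil_r [A; M; B; _]) in Hlk.
      rewrite !nth_round in Hlk by (easy || lia).
      rewrite <- (Nat.add_0_r (4 * r)), nth_round in Hlk by (easy || lia).
      cbn [nth] in Hlk. now rewrite hd_const in Hlk. }
    split.
    + destruct (G 0 ltac:(lia)) as (A1 & B1 & E1 & -> & ->).
      destruct (G 1 ltac:(lia)) as (A2 & B2 & E2 & -> & ->).
      simpl Nat.pow. now rewrite Nat.add_0_r, iter_add_nat, <- E1.
    + specialize (H (repeat 0 W) (const_word 0 ltac:(lia))).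
      apply bwin_extend in H. destruct H as [ext H]. rewrite <- app_assoc in H.
      eapply valid_link; [|exact Hl|exact H]. lia.
Qed.

Lemma iter_word n u : is_word u -> is_word (Nat.iter n T u).
Proof. intros H. induction n; simpl; auto. Qed.

Lemma run_bwin k : forall r bs A B, r + k = m -> length bs = 4 * r ->
  (forall r', r' < r -> link r' bs (nth (4 * r') bs []) (nth (4 * r' + 2) bs [])) ->
  is_word A -> link r bs A B -> B = Nat.iter (2 ^ k) T A -> bwin (4 * S k) bs.
Proof.
  induction k as [|k IH]; intros r bs A B Hr Hl Hp HA Hlk EB.
  - apply (bwin_round 0 bs r Hl). exists A, A, B.
    assert (HB : is_word B) by (subst B; now apply iter_word).
    repeat split; try apply HA; try apply HB.
    + rewrite <- (app_nil_r [A; A; B; D]).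
      intros r' Hr'. rewrite link_app by lia. destruct (Nat.eq_dec r' r) as [->|Hne].
      * rewrite nth_round by (easy || lia).
        rewrite <- (Nat.add_0_r (4 * r)), nth_round by (easy || lia). exact Hlk.
      * rewrite !app_nth1 by lia. apply Hp. lia.
    + rewrite <- (app_nil_r [A; A; B; D]). rewrite Nat.add_0_r in Hr. subst r.
      rewrite nth_round by (easy || lia).
      rewrite <- (Nat.add_0_r (4 * m)), nth_round by (easy || lia). exact EB.
  - replace (4 * S (S k)) with (4 + 4 * S k) by lia. apply (bwin_round _ bs r Hl).
    (* The midpoint of the true run withstands either choice. *)
    set (M := Nat.iter (2 ^ k) T A).
    assert (HM : is_word M) by now apply iter_word.
    assert (EM : B = Nat.iter (2 ^ k) T M).
    { rewrite EB. simpl Nat.pow. now rewrite Nat.add_0_r, iter_add_nat. }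
    exists A, M, B.
    assert (HB : is_word B) by (rewrite EB; now apply iter_word).
    split; [easy|]. split; [easy|]. split; [easy|]. intros D HD.
    rewrite <- (app_nil_r [A; M; B; D]).
    assert (Hp' : forall r', r' < S r -> link r' (bs ++ [A; M; B; D] ++ [])
       (nth (4 * r') (bs ++ [A; M; B; D] ++ []) []) (nth (4 * r' + 2) (bs ++ [A; M; B; D] ++ []) [])).
    { intros r' Hr'. rewrite link_app by lia. destruct (Nat.eq_dec r' r) as [->|Hne].
      - rewrite nth_round by (easy || lia).
        rewrite <- (Nat.add_0_r (4 * r)), nth_round by (easy || lia). exact Hlk.
      - rewrite !app_nth1 by lia. apply Hp. lia. }
    assert (Hlk' : forall A' B', (if Nat.eqb (nth 0 D 0) 0 then A' = A /\ B' = M else A' = M /\ B' = B) ->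
       link (S r) (bs ++ [A; M; B; D] ++ []) A' B').
    { intros A' B' H. unfold link. rewrite !nth_round by (easy || lia).
      rewrite <- (Nat.add_0_r (4 * r)), nth_round by (easy || lia). exact H. }
    destruct (Nat.eqb (nth 0 D 0) 0).
    + apply (IH (S r) _ A M); auto; [lia|rewrite length_app, Hl; simpl; lia].
    + apply (IH (S r) _ M B); auto; [lia|rewrite length_app, Hl; simpl; lia].
Qed.

Theorem bwin_iff : bwin (4 * S m) [] <-> forallb ok (Nat.iter (2 ^ m) T initw) = true.
Proof.
  split.
  - intros H. apply (bwin_run m 0) in H; [|easy|easy]. now destruct H as (A & B & -> & -> & H).
  - intros H. apply (run_bwin m 0 [] initw (Nat.iter (2 ^ m) T initw)); try easy.
Qed.
End Blocks.

(** * From moves that are words to moves that are symbols *)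

Section Flatten.
Context (P g C : nat) (own : nat -> bool) (lit : nat -> nat -> nat -> bool).
Notation cwin := (win P g C own lit).

Lemma win_sys_block w : forall n h, (forall i, i < w -> own (length h + i) = true) ->
  cwin (w + n) h = true <->
  exists u, length u = w /\ Forall (fun a => a < g) u /\ cwin n (h ++ u) = true.
Proof.
  induction w as [|w IH]; intros n h Ho.
  - simpl. split.
    + intros H. exists []. now rewrite app_nil_r.
    + intros ([|] & H1 & H2 & H3); [|easy]. now rewrite app_nil_r in H3.
  - cbn [Nat.add win]. specialize (Ho 0 ltac:(lia)) as Ho0. rewrite Nat.add_0_r in Ho0.
    rewrite Ho0, existsb_exists.
    assert (Ho' : forall a i, i < w -> own (length (h ++ [a]) + i) = true).
    { intros a i Hi. rewrite length_app. simpl. rewrite <- Nat.add_assoc. apply Ho. lia. }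
    split.
    + intros (a & Ha & H). apply in_seq in Ha. apply IH in H; [|auto].
      destruct H as (u & H1 & H2 & H3). exists (a :: u). simpl. rewrite <- app_assoc in H3.
      split; [lia|]. split; [constructor; [lia | easy] | easy].
    + intros ([|a u] & H1 & H2 & H3); [easy|]. inversion H2; subst. exists a.
      split; [apply in_seq; lia|]. apply IH; [auto|]. exists u. rewrite <- app_assoc. simpl in H1.
      auto.
Qed.

Lemma win_env_block w : forall n h, (forall i, i < w -> own (length h + i) = false) ->
  cwin (w + n) h = true <->
  forall u, length u = w -> Forall (fun a => a < g) u -> cwin n (h ++ u) = true.
Proof.
  induction w as [|w IH]; intros n h Ho.
  - simpl. split.
    + intros H [|] H1 H2; [|easy]. now rewrite app_nil_r.
    + intros H. specialize (H [] eq_refl (Forall_nil _)). now rewrite app_nil_r in H.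
  - cbn [Nat.add win]. specialize (Ho 0 ltac:(lia)) as Ho0. rewrite Nat.add_0_r in Ho0.
    rewrite Ho0, forallb_forall.
    assert (Ho' : forall a i, i < w -> own (length (h ++ [a]) + i) = false).
    { intros a i Hi. rewrite length_app. simpl. rewrite <- Nat.add_assoc. apply Ho. lia. }
    split.
    + intros H [|a u] H1 H2; [easy|]. inversion H2; subst.
      specialize (H a ltac:(apply in_seq; lia)). rewrite (IH n (h ++ [a])) in H by auto.
      specialize (H u ltac:(simpl in H1; lia) H5). now rewrite <- app_assoc in H.
    + intros H a Ha. apply in_seq in Ha. rewrite (IH n (h ++ [a])) by auto.
      intros u H1 H2. rewrite <- app_assoc. apply (H (a :: u)); [simpl; lia|].
      constructor; [lia | easy].
Qed.
End Flatten.

Definition block_owner (W p : nat) : bool := negb (Nat.eqb ((p / W) mod 4) 3).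

Lemma length_concat_words g W bs : Forall (is_word g W) bs -> length (concat bs) = length bs * W.
Proof.
  induction 1 as [|u bs [Hu _] _ IH]; simpl; [easy|]. now rewrite length_app, Hu, IH.
Qed.

Lemma win_bwin P g C lit W m T initw ok : 0 < W ->
  (forall bs, Forall (is_word g W) bs -> length bs = 4 * S m ->
     all_met P C lit (concat bs) = true <-> valid m T initw ok bs) ->
  forall n bs, Forall (is_word g W) bs -> length bs + n = 4 * S m ->
  win P g C (block_owner W) lit (n * W) (concat bs) = true <-> bwin g W m T initw ok n bs.
Proof.
  intros HW Hv. induction n as [|n IH]; intros bs Hbs Hl.
  - apply Hv; [easy | lia].
  - assert (Hown : forall i, i < W -> block_owner W (length (concat bs) + i) =
       negb (Nat.eqb (length bs mod 4) 3)).
    { intros i Hi. unfold block_owner. rewrite (length_concat_words _ _ _ Hbs).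
      rewrite Nat.div_add_l, Nat.div_small, Nat.add_0_r by lia. easy. }
    assert (Hc : forall u, concat bs ++ u = concat (bs ++ [u])).
    { intros u. now rewrite concat_app; simpl; rewrite app_nil_r. }
    assert (Hs : forall u, is_word g W u -> Forall (is_word g W) (bs ++ [u])).
    { intros u Hu. apply Forall_app. auto. }
    assert (IH' : forall u, is_word g W u ->
      win P g C (block_owner W) lit (n * W) (concat bs ++ u) = true <->
      bwin g W m T initw ok n (bs ++ [u])).
    { intros u Hu. rewrite Hc. apply IH; [now apply Hs | rewrite length_app; simpl; lia]. }
    cbn [bwin Nat.mul]. destruct (Nat.eqb (length bs mod 4) 3).
    + rewrite win_env_block by (intros i Hi; now rewrite Hown). split.
      * intros H u Hu. apply IH'; [easy|]. apply H; apply Hu.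
      * intros H u H1 H2. apply IH'; [now split|]. apply H. now split.
    + rewrite win_sys_block by (intros i Hi; now rewrite Hown). split.
      * intros (u & H1 & H2 & H3). exists u. split; [now split|]. apply IH'; [now split | easy].
      * intros (u & Hu & H). exists u. split; [apply Hu|]. split; [apply Hu|]. now apply IH'.
Qed.

(** * Clauses for a cellular automaton *)

Definition edist (a b : expr) : expr := EAdd (ESub a b) (ESub b a).

Lemma eval_edist x env a b : eval x env (edist a b) = 0 <-> eval x env a = eval x env b.
Proof. simpl. lia. Qed.

(** Tests are expressions with 0 for truth: [EAdd] is then conjunction, and [EIfZ] branches on a
    test. *)
Definition eflag (b : bool) : expr := ECst (if b then 0 else 1).

Lemma eval_eflag x env b : eval x env (eflag b) = 0 <-> b = true.
Proof. destruct b; simpl; split; easy. Qed.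

(* The literals "block kind [pk] of round [pr] has at position [pj] a value [v] with
   [pv v = 0]", where variables 2 and 3 are the round and the position the clause is about. *)
Record pattern := { pk : nat; pv : nat -> expr; pr : expr; pj : expr }.

Definition ptest (p : pattern) (v : nat) : expr :=
  EAdd (pv p v) (EAdd (edist (EVar 0) (pr p)) (edist (EVar 1) (pj p))).

Definition cell (w : list nat) (j : nat) : nat := nth j w 0.

(** The cells form a cycle, so that the border needs no rule of its own. *)
Definition prv (W j : nat) : nat := if j =? 0 then W - 1 else j - 1.
Definition nxt (W j : nat) : nat := if W - (j + 1) =? 0 then 0 else j + 1.

Definition ca_step (delta : nat -> nat -> nat -> nat) (W : nat) (w : list nat) : list nat :=
  map (fun j => delta (cell w (prv W j)) (cell w j) (cell w (nxt W j))) (seq 0 W).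
Definition ca_init (W : nat) (init : nat -> nat) : list nat := map init (seq 0 W).

Lemma prv_lt W j : j < W -> prv W j < W.
Proof. intros H. unfold prv. destruct (Nat.eqb_spec j 0); lia. Qed.

Lemma nxt_lt W j : j < W -> nxt W j < W.
Proof. intros H. unfold nxt. destruct (Nat.eqb_spec (W - (j + 1)) 0); lia. Qed.

Lemma word_ext W u v : length u = W -> length v = W -> (forall j, j < W -> cell u j = cell v j) -> u = v.
Proof. intros Hu Hv H. apply (nth_ext _ _ 0 0); [lia|]. intros j Hj. apply H. lia. Qed.

Lemma div_mod_block n a b : b < n -> (a * n + b) / n = a /\ (a * n + b) mod n = b.
Proof.
  intros H. rewrite Nat.div_add_l, Nat.div_small, Nat.add_0_r by lia. split; [easy|].
  rewrite Nat.add_comm, Nat.Div0.mod_add. now apply Nat.mod_small.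
Qed.

(** * Clauses that express the validity of a midpoint game *)

Section Templates.
Context (g : nat) (delta : nat -> nat -> nat -> nat) (ok : nat -> bool) (einit eW em : expr).

Definition tm_init : list pattern :=
  [{| pk := 0; pv := fun v => edist einit (ECst v); pr := ECst 0; pj := EVar 3 |}].

Definition tm_ok : list pattern :=
  [{| pk := 2; pv := fun v => eflag (ok v); pr := ECst 0; pj := EVar 3 |}].

(** An implication written as a disjunction: if this half is chosen and the source symbol is [a],
    the target symbol is [a]. The first literal holds when the other half is chosen. One clause per
    symbol turns equality of two words into literals about single moves. *)
Definition tm_copy (right : bool) (src dst a : nat) : list pattern :=
  [{| pk := 3; pv := fun v => eflag (eqb right (v =? 0)); pr := EVar 2; pj := ECst 0 |};
   {| pk := src; pv := fun v => eflag (negb (v =? a)); pr := EVar 2; pj := EVar 3 |};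
   {| pk := dst; pv := fun v => eflag (v =? a); pr := EAdd (EVar 2) (ECst 1); pj := EVar 3 |}].

Definition eprev : expr := EIfZ (EVar 3) (ESub eW (ECst 1)) (ESub (EVar 3) (ECst 1)).
Definition enext : expr :=
  EIfZ (ESub eW (EAdd (EVar 3) (ECst 1))) (ECst 0) (EAdd (EVar 3) (ECst 1)).

Definition tm_step (a b c : nat) : list pattern :=
  [{| pk := 0; pv := fun v => eflag (negb (v =? a)); pr := em; pj := eprev |};
   {| pk := 0; pv := fun v => eflag (negb (v =? b)); pr := em; pj := EVar 3 |};
   {| pk := 0; pv := fun v => eflag (negb (v =? c)); pr := em; pj := enext |};
   {| pk := 2; pv := fun v => eflag (v =? delta a b c); pr := em; pj := EVar 3 |}].

Definition copy_clauses (a : nat) : list (list pattern) :=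
  [tm_copy false 0 0 a; tm_copy false 1 2 a; tm_copy true 1 0 a; tm_copy true 2 2 a].

(** Each template is instantiated for all rounds [r < m] and positions [j < W]. The copy clauses for
    [r] relate rounds [r] and [r + 1]; the clauses about the start, acceptance and the single step
    name a fixed round and are repeated for every [r], which keeps the numbering uniform. *)
Definition templates : list (list pattern) :=
  tm_init :: tm_ok ::
  flat_map copy_clauses (seq 0 g) ++
  flat_map (fun a => flat_map (fun b => map (fun c => tm_step a b c) (seq 0 g)) (seq 0 g)) (seq 0 g).

Context (x : list bool) (W m : nat) (init : nat -> nat).
Context (HeW : forall env, eval x env eW = W) (Hem : forall env, eval x env em = m).
Context (Heinit : forall r' j' r j, eval x [r'; j'; r; j] einit = init j).
Context (HW : 0 < W) (Hm : 0 < m).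

Notation K := (length templates).

(** Moves are numbered [(r' * 4 + k) * W + j'] and clauses [(r * W + j) * K + t]; the quotients and
    remainders read these digits back. *)
Definition template_lit (c p v : nat) : bool :=
  existsb (fun q => (pk q =? (p / W) mod 4) &&
    (eval x [p / W / 4; p mod W; c / K / W; (c / K) mod W] (ptest q v) =? 0))
    (nth (c mod K) templates []).

Notation Pn := (S m * 4 * W).
Notation Cn := (m * W * K).

Definition holds (h : list nat) (r j : nat) (q : pattern) : Prop :=
  exists r' j', r' <= m /\ j' < W /\ pk q < 4 /\
    eval x [r'; j'; r; j] (pr q) = r' /\ eval x [r'; j'; r; j] (pj q) = j' /\
    eval x [r'; j'; r; j] (pv q (nth ((r' * 4 + pk q) * W + j') h 0)) = 0.

Lemma templates_pos : 0 < K.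
Proof. apply Nat.lt_0_succ. Qed.

Lemma template_lit_iff r j t r' k j' v : j < W -> t < K -> k < 4 -> j' < W ->
  template_lit ((r * W + j) * K + t) ((r' * 4 + k) * W + j') v =
  existsb (fun q => (pk q =? k) && (eval x [r'; j'; r; j] (ptest q v) =? 0)) (nth t templates []).
Proof.
  intros Hj Ht Hk Hj'. unfold template_lit.
  destruct (div_mod_block K (r * W + j) t Ht) as [-> ->].
  destruct (div_mod_block W r j Hj) as [-> ->].
  destruct (div_mod_block W (r' * 4 + k) j' Hj') as [-> ->].
  destruct (div_mod_block 4 r' k Hk) as [-> ->]. reflexivity.
Qed.

Lemma all_met_holds h : all_met Pn Cn template_lit h = true <->
  forall r j t, r < m -> j < W -> In t templates -> exists q, In q t /\ holds h r j q.
Proof.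
  pose proof templates_pos as HK. unfold all_met. rewrite forallb_forall. split.
  - intros H r j t Hr Hj Ht. apply (In_nth _ _ []) in Ht. destruct Ht as (k & Hk & <-).
    assert (Hc : (r * W + j) * K + k < Cn).
    { assert (r * W + j < m * W) by nia. nia. }
    specialize (H _ (proj2 (in_seq _ _ _) (conj (Nat.le_0_l _) Hc))).
    apply existsb_exists in H. destruct H as (p & Hp & H). apply in_seq in Hp.
    set (j' := p mod W) in *. set (r' := p / W / 4). set (kk := (p / W) mod 4).
    assert (Hj' : j' < W) by (apply Nat.mod_upper_bound; lia).
    assert (Hkk : kk < 4) by (apply Nat.mod_upper_bound; lia).
    assert (Ep : p = (r' * 4 + kk) * W + j').
    { unfold r', kk, j'. rewrite (Nat.mul_comm _ 4), <- Nat.div_mod_eq.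
      rewrite (Nat.mul_comm _ W). apply Nat.div_mod_eq. }
    assert (Hr' : r' <= m).
    { destruct (le_lt_dec r' m); [easy|]. exfalso.
      assert (S m * 4 <= r' * 4 + kk) by lia. nia. }
    rewrite Ep, template_lit_iff in H by easy. apply existsb_exists in H.
    destruct H as (q & Hq & H). apply andb_prop in H. destruct H as [H1 H2].
    apply Nat.eqb_eq in H1, H2. exists q. split; [easy|]. exists r', j'.
    unfold ptest in H2. cbn [eval] in H2. rewrite <- H1 in H2. subst kk.
    apply Nat.eq_add_0 in H2. destruct H2 as [H2 H3]. apply Nat.eq_add_0 in H3.
    destruct H3 as [H3 H4]. cbn [eval edist nth] in H3, H4. rewrite H1. rewrite H1 in H2.
    repeat split; auto; lia.
  - intros H c Hc. apply in_seq in Hc.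
    set (k := c mod K). set (j := (c / K) mod W). set (r := c / K / W).
    assert (Hk : k < K) by (apply Nat.mod_upper_bound; lia).
    assert (Hj : j < W) by (apply Nat.mod_upper_bound; lia).
    assert (Ec : c = (r * W + j) * K + k).
    { unfold r, j, k. rewrite (Nat.mul_comm _ W), <- Nat.div_mod_eq.
      rewrite (Nat.mul_comm _ K). apply Nat.div_mod_eq. }
    assert (Hr : r < m).
    { destruct (le_lt_dec m r); [|easy]. exfalso. assert (m * W <= r * W + j) by nia. nia. }
    destruct (H r j (nth k templates []) Hr Hj (nth_In _ _ Hk)) as (q & Hq & Hh).
    destruct Hh as (r' & j' & H1 & H2 & H3 & H4 & H5 & H6).
    apply existsb_exists. exists ((r' * 4 + pk q) * W + j'). split.
    + apply in_seq. assert (r' * 4 + pk q < S m * 4) by lia. nia.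
    + rewrite Ec, template_lit_iff by easy. apply existsb_exists. exists q. split; [easy|].
      rewrite Nat.eqb_refl. apply Nat.eqb_eq. unfold ptest. cbn [eval edist nth].
      rewrite H4, H5, H6. lia.
Qed.

Lemma nth_concat_words bs : Forall (is_word g W) bs -> forall k j, j < W ->
  nth (k * W + j) (concat bs) 0 = nth j (nth k bs []) 0.
Proof.
  induction 1 as [|u bs [Hu _] _ IH]; intros k j Hj; simpl.
  - destruct (k * W + j), k, j; reflexivity.
  - destruct k as [|k].
    + now rewrite app_nth1 by lia.
    + rewrite app_nth2 by (simpl; lia). rewrite Hu.
      replace (S k * W + j - W) with (k * W + j) by (simpl; lia). now apply IH.
Qed.

Lemma valid_templates bs : Forall (is_word g W) bs -> length bs = 4 * S m ->
  all_met Pn Cn template_lit (concat bs) = true <-> valid m (ca_step delta W) (ca_init W init) ok bs.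
Proof.
  intros Hbs Hl. rewrite all_met_holds.
  assert (Hw : forall k, k < 4 * S m -> is_word g W (nth k bs [])).
  { intros k Hk. rewrite Forall_forall in Hbs. apply Hbs, nth_In. lia. }
  assert (Hcell : forall k j, k < 4 * S m -> j < W -> cell (nth k bs []) j < g).
  { intros k j Hk Hj. destruct (Hw k Hk) as [H1 H2]. rewrite Forall_forall in H2.
    apply H2, nth_In. lia. }
  (* Within a clause a pattern points at one move: its round and position depend on the clause only,
     so the existential in [holds] has a single candidate. *)
  assert (Hh : forall r j q r' j', r' <= m -> j' < W -> pk q < 4 ->
    (forall a b, eval x [a; b; r; j] (pr q) = r') -> (forall a b, eval x [a; b; r; j] (pj q) = j') ->
    (holds (concat bs) r j q <->
     eval x [r'; j'; r; j] (pv q (cell (nth (4 * r' + pk q) bs []) j')) = 0)).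
  { intros r j q r' j' Hr Hj Hk E1 E2. unfold holds, cell. split.
    - intros (a & b & H1 & H2 & H3 & H4 & H5 & H6). rewrite E1 in H4. rewrite E2 in H5. subst a b.
      rewrite nth_concat_words in H6 by easy. now rewrite (Nat.mul_comm 4).
    - intros H. exists r', j'. rewrite nth_concat_words by easy. rewrite (Nat.mul_comm 4) in H.
      repeat split; auto. }
  assert (Hcopy : forall right src dst, src < 4 -> dst < 4 ->
    (forall r j a, r < m -> j < W -> a < g -> exists q, In q (tm_copy right src dst a) /\
       holds (concat bs) r j q) <->
    (forall r, r < m -> eqb right (cell (nth (4 * r + 3) bs []) 0 =? 0) = true \/
       nth (4 * S r + dst) bs [] = nth (4 * r + src) bs [])).
  { intros right src dst Hs Hd.
    assert (Hq : forall r j a, r < m -> j < W ->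
      (exists q, In q (tm_copy right src dst a) /\ holds (concat bs) r j q) <->
      eqb right (cell (nth (4 * r + 3) bs []) 0 =? 0) = true \/
      cell (nth (4 * r + src) bs []) j <> a \/ cell (nth (4 * S r + dst) bs []) j = a).
    { intros r j a Hr Hj.
      transitivity (holds (concat bs) r j (nth 0 (tm_copy right src dst a) (Build_pattern 0 ECst ELen ELen)) \/
        holds (concat bs) r j (nth 1 (tm_copy right src dst a) (Build_pattern 0 ECst ELen ELen)) \/
        holds (concat bs) r j (nth 2 (tm_copy right src dst a) (Build_pattern 0 ECst ELen ELen))).
      - simpl. split.
        + intros (q & [<-|[<-|[<-|[]]]] & H); auto.
        + intros [H|[H|H]]; eexists; (split; [|exact H]); auto.
      - cbn [nth tm_copy].
        rewrite (Hh r j _ r 0) by (simpl; auto; lia).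
        rewrite (Hh r j _ r j) by (simpl; auto; lia).
        rewrite (Hh r j _ (S r) j) by (intros; simpl; auto; lia).
        cbn [pv pk]. rewrite !eval_eflag, negb_true_iff, Nat.eqb_neq, Nat.eqb_eq. tauto. }
    split.
    - intros H r Hr. destruct (eqb right _) eqn:E; [now left|]. right.
      apply (word_ext W); [apply Hw; lia|apply Hw; lia|]. intros j Hj.
      (* The clause for the symbol that the source really has rules out the second literal. *)
      specialize (H r j (cell (nth (4 * r + src) bs []) j) Hr Hj (Hcell (4 * r + src) j ltac:(lia) Hj)).
      apply Hq in H; [|easy|easy]. rewrite E in H. destruct H as [H|[H|H]]; easy.
    - intros H r j a Hr Hj Ha. apply Hq; [easy|easy|].
      destruct (H r Hr) as [E|E]; [now left|]. rewrite E.
      destruct (Nat.eq_dec (cell (nth (4 * r + src) bs []) j) a); auto. }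
  assert (Hinit : (forall r j, r < m -> j < W -> exists q, In q tm_init /\ holds (concat bs) r j q) <->
    nth 0 bs [] = (ca_init W init)).
  { assert (Hq : forall r j, r < m -> j < W ->
      (exists q, In q tm_init /\ holds (concat bs) r j q) <-> cell (nth 0 bs []) j = init j).
    { intros r j Hr Hj. transitivity (holds (concat bs) r j (hd (Build_pattern 0 ECst ELen ELen) tm_init)).
      - simpl. split; [now intros (q & [<-|[]] & H) | intros H; eexists; split; [|exact H]; auto].
      - cbn [hd tm_init]. rewrite (Hh r j _ 0 j) by (simpl; auto; lia). cbn [pv pk].
        rewrite eval_edist, Heinit. cbn [eval]. simpl (4 * 0 + 0). split; auto. }
    split.
    - intros H. apply (word_ext W); [apply Hw; lia|unfold ca_init; now rewrite length_map, length_seq|].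
      intros j Hj. unfold cell at 2, ca_init. rewrite nth_map_seq by easy. apply (Hq 0); auto.
    - intros E r j Hr Hj. apply Hq; auto. rewrite E. unfold cell, ca_init. now apply nth_map_seq. }
  assert (Hok : (forall r j, r < m -> j < W -> exists q, In q tm_ok /\ holds (concat bs) r j q) <->
    forallb ok (nth 2 bs []) = true).
  { assert (Hq : forall r j, r < m -> j < W ->
      (exists q, In q tm_ok /\ holds (concat bs) r j q) <-> ok (cell (nth 2 bs []) j) = true).
    { intros r j Hr Hj. transitivity (holds (concat bs) r j (hd (Build_pattern 0 ECst ELen ELen) tm_ok)).
      - simpl. split; [now intros (q & [<-|[]] & H) | intros H; eexists; split; [|exact H]; auto].
      - cbn [hd tm_ok]. rewrite (Hh r j _ 0 j) by (simpl; auto; lia). cbn [pv pk].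
        now rewrite eval_eflag. }
    destruct (Hw 2 ltac:(lia)) as [Hw2 _].
    rewrite forallb_forall. split.
    - intros H v Hv. apply (In_nth _ _ 0) in Hv. destruct Hv as (j & Hj & <-).
      apply (Hq 0); [easy|lia|]. apply H; [easy | lia].
    - intros H r j Hr Hj. apply Hq; auto. apply H, nth_In. lia. }
  assert (Hstep : (forall r j a b c, r < m -> j < W -> a < g -> b < g -> c < g ->
      exists q, In q (tm_step a b c) /\ holds (concat bs) r j q) <->
    nth (4 * m + 2) bs [] = (ca_step delta W) (nth (4 * m) bs [])).
  { set (A := nth (4 * m) bs []).
    assert (HA : A = nth (4 * m + 0) bs []) by (unfold A; now rewrite Nat.add_0_r).
    assert (Hep : forall j a b r, j < W -> eval x [a; b; r; j] eprev = prv W j).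
    { intros j a b r Hj. cbn [eval eprev nth]. now rewrite HeW. }
    assert (Hen : forall j a b r, j < W -> eval x [a; b; r; j] enext = nxt W j).
    { intros j a b r Hj. cbn [eval enext nth]. now rewrite HeW. }
    assert (Hq : forall r j a b c, r < m -> j < W ->
      (exists q, In q (tm_step a b c) /\ holds (concat bs) r j q) <->
      cell A (prv W j) <> a \/ cell A j <> b \/ cell A (nxt W j) <> c \/
      cell (nth (4 * m + 2) bs []) j = delta a b c).
    { intros r j a b c Hr Hj. set (d := Build_pattern 0 ECst ELen ELen).
      transitivity (holds (concat bs) r j (nth 0 (tm_step a b c) d) \/
        holds (concat bs) r j (nth 1 (tm_step a b c) d) \/
        holds (concat bs) r j (nth 2 (tm_step a b c) d) \/
        holds (concat bs) r j (nth 3 (tm_step a b c) d)).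
      - simpl. split.
        + intros (q & [<-|[<-|[<-|[<-|[]]]]] & H); auto.
        + intros [H|[H|[H|H]]]; eexists; (split; [|exact H]); auto.
      - cbn [nth tm_step]. pose proof (prv_lt W j Hj). pose proof (nxt_lt W j Hj).
        rewrite (Hh r j _ m (prv W j)) by (cbn [pk pr pj]; auto; lia).
        rewrite (Hh r j _ m j) by (cbn [pk pr pj]; auto; lia).
        rewrite (Hh r j _ m (nxt W j)) by (cbn [pk pr pj]; auto; lia).
        rewrite (Hh r j _ m j) by (cbn [pk pr pj]; auto; lia).
        cbn [pv pk]. rewrite <- HA.
        now rewrite !eval_eflag, !negb_true_iff, !Nat.eqb_neq, Nat.eqb_eq. }
    split.
    - intros H. apply (word_ext W); [apply Hw; lia|unfold ca_step; now rewrite length_map, length_seq|].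
      intros j Hj. unfold cell at 2, ca_step. rewrite nth_map_seq by easy.
      assert (Hc : forall i, i < W -> cell A i < g) by (intros i Hi; apply Hcell; [lia | easy]).
      (* The clause for the neighbourhood really present is the one that forces the new cell; the
         copy indexed by round 0 exists because [0 < m]. *)
      specialize (H 0 j (cell A (prv W j)) (cell A j) (cell A (nxt W j)) Hm Hj
        (Hc _ (prv_lt W j Hj)) (Hc _ Hj) (Hc _ (nxt_lt W j Hj))).
      apply Hq in H; [|easy|easy]. destruct H as [H|[H|[H|H]]]; easy.
    - intros E r j a b c Hr Hj _ _ _. apply Hq; auto. rewrite E. unfold cell at 4, ca_step.
      rewrite nth_map_seq by easy.
      destruct (Nat.eq_dec (cell A (prv W j)) a) as [->|]; auto.
      destruct (Nat.eq_dec (cell A j) b) as [->|]; auto.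
      destruct (Nat.eq_dec (cell A (nxt W j)) c) as [->|]; auto. }
  transitivity (nth 0 bs [] = (ca_init W init) /\ forallb ok (nth 2 bs []) = true /\
    (forall r, r < m -> link (ca_init W init) ok (S r) bs (nth (4 * S r) bs []) (nth (4 * S r + 2) bs [])) /\
    nth (4 * m + 2) bs [] = (ca_step delta W) (nth (4 * m) bs [])).
  - rewrite <- Hinit, <- Hok, <- Hstep.
    assert (Hlk : (forall r, r < m -> link (ca_init W init) ok (S r) bs
        (nth (4 * S r) bs []) (nth (4 * S r + 2) bs [])) <->
      (forall t r j, r < m -> j < W -> In t (flat_map copy_clauses (seq 0 g)) -> exists q, In q t /\ holds (concat bs) r j q)).
    { pose proof (Hcopy false 0 0 ltac:(lia) ltac:(lia)) as C1.
      pose proof (Hcopy false 1 2 ltac:(lia) ltac:(lia)) as C2.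
      pose proof (Hcopy true 1 0 ltac:(lia) ltac:(lia)) as C3.
      pose proof (Hcopy true 2 2 ltac:(lia) ltac:(lia)) as C4.
      split.
      - intros H t r j Hr Hj Ht. apply in_flat_map in Ht. destruct Ht as (a & Ha & Ht).
        apply in_seq in Ha. destruct Ha as [_ Ha]. simpl in Ha.
        assert (H' : forall r, r < m ->
          (cell (nth (4 * r + 3) bs []) 0 =? 0) = true /\
          nth (4 * S r + 0) bs [] = nth (4 * r + 0) bs [] /\ nth (4 * S r + 2) bs [] = nth (4 * r + 1) bs [] \/
          (cell (nth (4 * r + 3) bs []) 0 =? 0) = false /\
          nth (4 * S r + 0) bs [] = nth (4 * r + 1) bs [] /\ nth (4 * S r + 2) bs [] = nth (4 * r + 2) bs []).
        { intros r0 Hr0. specialize (H r0 Hr0). unfold link in H. fold (cell (nth (4 * r0 + 3) bs []) 0) in H.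
          rewrite !Nat.add_0_r. destruct (cell _ 0 =? 0); tauto. }
        destruct Ht as [<-|[<-|[<-|[<-|[]]]]];
          [apply C1|apply C2|apply C3|apply C4]; auto; intros r0 Hr0;
          destruct (H' r0 Hr0) as [(-> & E1 & E2)|(-> & E1 & E2)]; simpl eqb; auto.
      - intros H r Hr. unfold link. fold (cell (nth (4 * r + 3) bs []) 0).
        assert (G : forall right src dst, src < 4 -> dst < 4 ->
          (forall a, In a (seq 0 g) -> In (tm_copy right src dst a) (copy_clauses a)) ->
          eqb right (cell (nth (4 * r + 3) bs []) 0 =? 0) = true \/
          nth (4 * S r + dst) bs [] = nth (4 * r + src) bs []).
        { intros right src dst Hs Hd Hin. apply (Hcopy right src dst); auto.
          intros r0 j a Hr0 Hj Ha. apply H; auto. apply in_flat_map. exists a.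
          assert (Ha' : In a (seq 0 g)) by (apply in_seq; lia). auto. }
        destruct (G false 0 0) as [E|E1]; [lia|lia|simpl; auto| |].
        + destruct (cell _ 0 =? 0) eqn:Ec; [discriminate|].
          destruct (G true 1 0) as [E'|E1]; [lia|lia|simpl; auto|rewrite ?Ec in E'; discriminate|].
          destruct (G true 2 2) as [E'|E2]; [lia|lia|simpl; auto|rewrite ?Ec in E'; discriminate|].
          rewrite !Nat.add_0_r in E1. auto.
        + destruct (cell _ 0 =? 0) eqn:Ec.
          * destruct (G false 1 2) as [E'|E2]; [lia|lia|simpl; auto|rewrite ?Ec in E'; discriminate|].
            rewrite !Nat.add_0_r in E1. auto.
          * destruct (G true 1 0) as [E'|E1']; [lia|lia|simpl; auto|rewrite ?Ec in E'; discriminate|].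
            destruct (G true 2 2) as [E'|E2]; [lia|lia|simpl; auto|rewrite ?Ec in E'; discriminate|].
            rewrite !Nat.add_0_r in E1'. auto. }
    rewrite Hlk. unfold templates. split.
    + intros H. split; [|split; [|split]].
      * intros r j Hr Hj. apply (H r j); simpl; auto.
      * intros r j Hr Hj. apply (H r j); simpl; auto.
      * intros t r j Hr Hj Ht. apply (H r j); auto. right. right. apply in_or_app. now left.
      * intros r j a b c Hr Hj Ha Hb Hc. apply (H r j); auto. right. right. apply in_or_app. right.
        apply in_flat_map. exists a. split; [apply in_seq; lia|].
        apply in_flat_map. exists b. split; [apply in_seq; lia|].
        apply in_map_iff. exists c. split; [easy | apply in_seq; lia].
    + intros (H1 & H2 & H3 & H4) r j t Hr Hj [<-|[<-|Ht]]; auto.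
      apply in_app_or in Ht. destruct Ht as [Ht|Ht]; [eauto|].
      apply in_flat_map in Ht. destruct Ht as (a & Ha & Ht). apply in_seq in Ha.
      apply in_flat_map in Ht. destruct Ht as (b & Hb & Ht). apply in_seq in Hb.
      apply in_map_iff in Ht. destruct Ht as (c & <- & Hc). apply in_seq in Hc.
      apply H4; auto; lia.
  - unfold valid. split.
    + intros (H1 & H2 & H3 & H4). split; [|easy]. intros [|r] Hr; [easy|]. apply H3. lia.
    + intros [H1 H4]. destruct (H1 0 ltac:(lia)) as [E1 E2]. split; [easy|]. split; [easy|].
      split; [|easy]. intros r Hr. apply H1. lia.
Qed.
End Templates.

(** * Turing machines as cellular automata *)

Fixpoint all_words (g n : nat) : list (list nat) :=
  match n with
  | 0 => [[]]
  | S n' => flat_map (fun a => map (cons a) (all_words g n')) (seq 0 g)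
  end.

Lemma all_words_length g n : length (all_words g n) = g ^ n.
Proof.
  induction n as [|n IH]; [easy|]. simpl.
  rewrite (length_flat_map_blocks _ g (g ^ n)); [easy|]. intros a. now rewrite length_map.
Qed.

Lemma in_all_words g n u : is_word g n u -> In u (all_words g n).
Proof.
  revert u. induction n as [|n IH]; intros u [Hl Hf].
  - destruct u; [now left | easy].
  - destruct u as [|a u]; [easy|]. inversion Hf; subst. simpl. apply in_flat_map. exists a.
    split; [apply in_seq; lia|]. apply in_map, IH. split; [now injection Hl | easy].
Qed.

Lemma iter_swap {A} (f : A -> A) n x : Nat.iter n f (f x) = f (Nat.iter n f x).
Proof. induction n; simpl; congruence. Qed.

Lemma iter_fixed {A} (f : A -> A) n x : f x = x -> Nat.iter n f x = x.
Proof. intros H. induction n; simpl; congruence. Qed.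

(** Before its first fixed point the orbit does not repeat a word, so by counting it gets there
    within [g ^ W] steps; from then on nothing changes. *)
Lemma fixed_point_reached g W (T : list nat -> list nat) w :
  (forall u, is_word g W u -> is_word g W (T u)) -> is_word g W w ->
  forall n, T (Nat.iter n T w) = Nat.iter n T w ->
  forall N, g ^ W <= N -> Nat.iter N T w = Nat.iter n T w.
Proof.
  intros HT Hw n Hn N HN.
  assert (Hmin : exists n0, T (Nat.iter n0 T w) = Nat.iter n0 T w /\
    forall k, k < n0 -> T (Nat.iter k T w) <> Nat.iter k T w).
  { clear HN. induction n as [n IH] using lt_wf_ind.
    destruct (classic (exists k, k < n /\ T (Nat.iter k T w) = Nat.iter k T w)) as [(k & Hk & E)|H].
    - now apply (IH k).
    - exists n. split; [easy|]. intros k Hk E. apply H. eauto. }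
  destruct Hmin as (n0 & E0 & Hmin).
  assert (Hge : forall k, n0 <= k -> Nat.iter k T w = Nat.iter n0 T w).
  { intros k Hk. replace k with ((k - n0) + n0) by lia. rewrite iter_add_nat. now apply iter_fixed. }
  assert (Hn0 : n0 <= n).
  { destruct (le_lt_dec n0 n); [easy|]. now apply Hmin in Hn. }
  rewrite (Hge n Hn0). apply Hge. etransitivity; [|exact HN].
  set (l := map (fun k => Nat.iter k T w) (seq 0 n0)).
  assert (Hnd : NoDup l).
  { apply NoDup_nth with (d := w). unfold l. rewrite length_map, length_seq.
    assert (G : forall i j, i < j -> j < n0 -> Nat.iter i T w <> Nat.iter j T w).
    { intros i j Hij Hj E. apply (Hmin (n0 - (j - i)) ltac:(lia)).
      replace (Nat.iter (n0 - (j - i)) T w) with (Nat.iter n0 T w); [easy|].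
      transitivity (Nat.iter ((n0 - j) + j) T w); [f_equal; lia|]. rewrite iter_add_nat, <- E, <- iter_add_nat.
      f_equal. lia. }
    intros i j Hi Hj. rewrite !nth_map_seq by easy. intros E.
    destruct (lt_eq_lt_dec i j) as [[H|H]|H]; [|easy|].
    - now apply G in E.
    - symmetry in E. now apply G in E. }
  rewrite <- all_words_length. replace n0 with (length l) by (unfold l; now rewrite length_map, length_seq).
  apply NoDup_incl_length; [easy|]. intros u Hu. unfold l in Hu. apply in_map_iff in Hu.
  destruct Hu as (k & <- & _). apply in_all_words. clear - HT Hw. induction k; simpl; auto.
Qed.

Section Automaton.
Context (M : TM) (HM : wf_TM M).
Notation Q := (S (tm_nst M)).

Definition sym_code (a : option bool) : nat :=
  match a with None => 0 | Some false => 1 | Some true => 2 end.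

Definition sym_decode (n : nat) : option bool :=
  match n with 0 => None | 1 => Some false | _ => Some true end.

(* A tape cell is coded by its symbol and, if the head is there, the successor of the state;
   code 0 is reserved for the left end of the tape. *)
Definition alphabet : nat := 1 + 3 * Q.
Definition cell_code (a : option bool) (h : nat) : nat := S (sym_code a * Q + h).
Definition cell_sym (v : nat) : option bool := sym_decode ((v - 1) / Q).
Definition cell_head (v : nat) : nat := (v - 1) mod Q.

Lemma cell_sym_code a h : h < Q -> cell_sym (cell_code a h) = a.
Proof.
  intros H. unfold cell_sym, cell_code. rewrite Nat.sub_succ, Nat.sub_0_r.
  rewrite Nat.div_add_l, Nat.div_small, Nat.add_0_r by lia. now destruct a as [[]|].
Qed.

Lemma cell_head_code a h : h < Q -> cell_head (cell_code a h) = h.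
Proof.
  intros H. unfold cell_head, cell_code. rewrite Nat.sub_succ, Nat.sub_0_r.
  rewrite Nat.add_comm, Nat.Div0.mod_add. now apply Nat.mod_small.
Qed.

Lemma cell_code_lt a h : h < Q -> cell_code a h < alphabet.
Proof.
  intros H. unfold cell_code, alphabet. assert (sym_code a <= 2) by (destruct a as [[]|]; simpl; lia).
  nia.
Qed.

Lemma cell_head_lt v : cell_head v < Q.
Proof. apply Nat.mod_upper_bound. lia. Qed.

Definition incoming (v : nat) (right : bool) : option nat :=
  if v =? 0 then None else
  match cell_head v with
  | 0 => None
  | S q =>
      match tm_delta M q (cell_sym v) with
      | Some (q', _, d) => if eqb d right then Some q' else None
      | None => None
      end
  end.

(** A head that cannot move leaves its cell alone, so halted configurations are fixed points. A left
    move next to the marker 0 keeps the head in place, as [step] does at the end of the tape. The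
    marker also cuts the cycle of cells open: it never changes and sends no head to its
    neighbours. *)
Definition local_rule (a b c : nat) : nat :=
  if b =? 0 then 0 else
  match cell_head b with
  | S q =>
      match tm_delta M q (cell_sym b) with
      | None => b
      | Some (q', s, true) => cell_code s 0
      | Some (q', s, false) => cell_code s (if a =? 0 then S q' else 0)
      end
  | 0 =>
      match incoming a true with
      | Some q' => cell_code (cell_sym b) (S q')
      | None =>
          match incoming c false with
          | Some q' => cell_code (cell_sym b) (S q')
          | None => b
          end
      end
  end.

Lemma delta_state q a q' s d : q < tm_nst M -> tm_delta M q a = Some (q', s, d) -> S q' < Q.
Proof. intros Hq H. apply HM in H; [lia | easy]. Qed.

Lemma incoming_state v d q : incoming v d = Some q -> S q < Q.
Proof.
  unfold incoming. destruct (v =? 0); [easy|]. pose proof (cell_head_lt v) as Hv.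
  destruct (cell_head v) as [|p]; [easy|].
  destruct (tm_delta M p (cell_sym v)) as [[[q' s] d']|] eqn:E; [|easy].
  destruct (eqb d' d); [|easy]. intros H. injection H as <-. eapply delta_state; [|exact E]. lia.
Qed.

Lemma local_rule_lt a b c : b < alphabet -> local_rule a b c < alphabet.
Proof.
  intros Hb. unfold local_rule. destruct (b =? 0); [unfold alphabet; lia|].
  pose proof (cell_head_lt b) as Hv. destruct (cell_head b) as [|q].
  - destruct (incoming a true) eqn:E1; [eapply cell_code_lt, incoming_state, E1|].
    destruct (incoming c false) eqn:E2; [eapply cell_code_lt, incoming_state, E2|easy].
  - destruct (tm_delta M q (cell_sym b)) as [[[q' s] []]|] eqn:E; [| |easy].
    + apply cell_code_lt. lia.
    + apply cell_code_lt. destruct (a =? 0); [|lia]. eapply delta_state; [|exact E]. lia.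
Qed.

(** Acceptance as a condition on single cells: cells without a head pass, so a word that contains
    the head passes exactly if its state is the accepting one. *)
Definition accepting (v : nat) : bool :=
  (v =? 0) || (cell_head v =? 0) || (cell_head v =? S (tm_acc M)).

Definition word_at (t : nat -> option bool) (p q j : nat) : nat :=
  match j with 0 => 0 | S i => cell_code (t i) (if i =? p then S q else 0) end.

Definition tape_of (c : config) (i : nat) : option bool :=
  let '(_, L, R) := c in nth i (rev L ++ R) None.

Definition pos_of (c : config) : nat := length (snd (fst c)).

Lemma nth_write (L R : list (option bool)) a i :
  nth i (rev L ++ a :: tl R) None = if i =? length L then a else nth i (rev L ++ R) None.
Proof.
  destruct (Nat.eqb_spec i (length L)) as [->|Hne].
  - rewrite app_nth2, length_rev, Nat.sub_diag by (rewrite length_rev; lia). easy.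
  - destruct (le_lt_dec (length L) i).
    + rewrite !app_nth2, length_rev by (rewrite length_rev; lia).
      destruct (i - length L) eqn:E; [lia|]. simpl. now destruct R; [destruct n|].
    + now rewrite !app_nth1 by (rewrite length_rev; lia).
Qed.

(** With the tape as a function of the position, the two cases of a left move become one: at the end
    of the tape the truncated [0 - 1] keeps the head at 0. *)
Lemma step_view c c' : step M c = Some c' -> exists q' s d,
  tm_delta M (cstate c) (tape_of c (pos_of c)) = Some (q', s, d) /\ cstate c' = q' /\
  (forall i, tape_of c' i = if i =? pos_of c then s else tape_of c i) /\
  pos_of c' = if d then S (pos_of c) else pos_of c - 1.
Proof.
  destruct c as [[q L] R]. unfold step, cstate, tape_of, pos_of. cbn [fst snd].
  rewrite app_nth2, length_rev, Nat.sub_diag by (rewrite length_rev; lia).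
  replace (nth 0 R None) with (hd None R) by (now destruct R).
  destruct (tm_delta M q (hd None R)) as [[[q' s] []]|] eqn:E; [| |discriminate].
  - intros H. injection H as <-. exists q', s, true. repeat split; auto.
    intros i. cbn [rev]. rewrite <- app_assoc. apply nth_write.
  - destruct L as [|b L]; intros H; injection H as <-; exists q', s, false; repeat split; auto.
    + intros i. apply nth_write.
    + intros i. rewrite <- nth_write. cbn [rev]. now rewrite <- app_assoc.
    + cbn [fst snd length]. lia.
Qed.

Lemma halted_view c : step M c = None -> tm_delta M (cstate c) (tape_of c (pos_of c)) = None.
Proof.
  destruct c as [[q L] R]. unfold step, cstate, tape_of, pos_of. cbn [fst snd].
  rewrite app_nth2, length_rev, Nat.sub_diag by (rewrite length_rev; lia).
  replace (nth 0 R None) with (hd None R) by (now destruct R).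
  destruct (tm_delta M q (hd None R)) as [[[q' s] []]|]; [easy| |easy]. now destruct L.
Qed.

(** * One step of the automaton is one step of the machine *)

Section Width.
Context (W : nat).

Definition config_word (c : config) : list nat :=
  map (word_at (tape_of c) (pos_of c) (cstate c)) (seq 0 W).

Lemma incoming_word_at t p q j d : q < tm_nst M ->
  incoming (word_at t p q j) d =
  if j =? S p then
    match tm_delta M q (t p) with
    | Some (q', _, d') => if eqb d' d then Some q' else None
    | None => None
    end
  else None.
Proof.
  intros Hq. unfold incoming. destruct j as [|i]; [easy|]. unfold word_at.
  change (cell_code (t i) (if i =? p then S q else 0) =? 0) with false. cbv iota.
  change (S i =? S p) with (i =? p).
  destruct (Nat.eqb_spec i p) as [->|Hne].
  - rewrite cell_head_code, cell_sym_code by lia. reflexivity.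
  - rewrite cell_head_code by lia. reflexivity.
Qed.

Lemma ca_step_config c : cstate c < tm_nst M -> S (pos_of c) < W ->
  ca_step local_rule W (config_word c) =
  match step M c with
  | None => config_word c
  | Some c' => config_word c'
  end.
Proof.
  intros Hq Hp. unfold ca_step.
  set (t := tape_of c). set (p := pos_of c) in *. set (q := cstate c) in *.
  assert (Hcell : forall j, j < W -> cell (config_word c) j = word_at t p q j).
  { intros j Hj. unfold cell, config_word. now rewrite nth_map_seq. }
  assert (E : forall j, j < W -> 
    local_rule (cell (config_word c) (prv W j)) (cell (config_word c) j) (cell (config_word c) (nxt W j)) =
    match step M c with
    | None => word_at t p q j
    | Some c' => word_at (tape_of c') (pos_of c') (cstate c') j
    end).
  { intros j Hj. pose proof (prv_lt W j Hj). pose proof (nxt_lt W j Hj).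
    rewrite !Hcell by easy. destruct j as [|i].
    { unfold local_rule. simpl. now destruct (step M c). }
    unfold local_rule. rewrite !incoming_word_at by easy.
    unfold word_at at 1 2 3 4 5 6 7 8.
    change (cell_code (t i) (if i =? p then S q else 0) =? 0) with false. cbv iota.
    assert (Hh : (if i =? p then S q else 0) < Q) by (destruct (i =? p); lia).
    rewrite cell_head_code, cell_sym_code by easy.
    assert (Hprv : prv W (S i) = i) by (unfold prv; simpl; lia).
    (* The last cell has the marker as its right neighbour, which never carries the head; and the
       head is not in the cell after it, since [S p < W]. Both tests fail there. *)
    assert (Hnx : (nxt W (S i) =? S p) = (S i =? p)).
    { unfold nxt. destruct (Nat.eqb_spec (W - (S i + 1)) 0).
      - destruct (Nat.eqb_spec (S i) p); [lia|]. reflexivity.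
      - simpl. now rewrite Nat.add_1_r. }
    rewrite Hprv, Hnx.
    destruct (step M c) as [c'|] eqn:Es.
    - destruct (step_view c c' Es) as (q' & s & d & E1 & E2 & E3 & E4).
      fold t p q in E1, E3, E4. rewrite E1. unfold word_at. rewrite E3, E4, E2.
      destruct (Nat.eqb_spec i p) as [->|Hne].
      + rewrite E1. destruct d.
        * now destruct (Nat.eqb_spec p (S p)); [lia|].
        * destruct p as [|p']; [reflexivity|].
          change (cell_code (t p') (if p' =? S p' then S q else 0) =? 0) with false. cbv iota.
          now destruct (Nat.eqb_spec (S p') (S p' - 1)); [lia|].
      + destruct (Nat.eqb_spec i (S p)) as [->|Hne1].
        * destruct d; simpl eqb; cbv iota; [now rewrite Nat.eqb_refl|].
          destruct (Nat.eqb_spec (S (S p)) p); [lia|].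
          destruct (Nat.eqb_spec (S p) (p - 1)); [lia|easy].
        * destruct (Nat.eqb_spec (S i) p) as [<-|Hne2].
          -- destruct d; simpl eqb; cbv iota.
             ++ now destruct (Nat.eqb_spec i (S (S i))); [lia|].
             ++ simpl. now rewrite Nat.sub_0_r, Nat.eqb_refl.
          -- destruct d.
             ++ now destruct (Nat.eqb_spec i (S p)); [lia|].
             ++ now destruct (Nat.eqb_spec i (p - 1)); [lia|].
    - pose proof (halted_view c Es) as E1. fold t p q in E1. rewrite E1. unfold word_at.
      destruct (Nat.eqb_spec i p) as [->|Hne]; [now rewrite E1|].
      destruct (i =? S p), (S i =? p); reflexivity. }
  destruct (step M c); (unfold config_word at 4 || unfold config_word at 3); apply map_ext_in; intros j Hj;
    apply in_seq in Hj; apply E; lia.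
Qed.
Lemma run_word n : forall c0 c, steps M n c0 = Some c -> cstate c0 < tm_nst M ->
  (forall k c', k <= n -> steps M k c0 = Some c' -> S (pos_of c') < W) ->
  Nat.iter n (ca_step local_rule W) (config_word c0) = config_word c /\ cstate c < tm_nst M.
Proof.
  induction n as [|n IH]; intros c0 c H Hq Hp.
  - injection H as <-. easy.
  - cbn [steps] in H. destruct (step M c0) as [c1|] eqn:E; [|discriminate].
    simpl Nat.iter. rewrite <- iter_swap, ca_step_config, E;
      [|easy|apply (Hp 0); [lia | easy]].
    apply (IH c1 c H).
    + destruct (step_view c0 c1 E) as (q' & s & d & E1 & -> & _).
      pose proof (delta_state _ _ _ _ _ Hq E1). lia.
    + intros k c' Hk Hc'. apply (Hp (S k)); [lia|]. cbn [steps]. now rewrite E.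
Qed.

Lemma accepting_word c : cstate c < tm_nst M -> S (pos_of c) < W ->
  forallb accepting (config_word c) = true <-> cstate c = tm_acc M.
Proof.
  intros Hq Hp. rewrite forallb_forall. unfold config_word.
  assert (Hh : forall i, (if i =? pos_of c then S (cstate c) else 0) < Q)
    by (intros i; destruct (i =? pos_of c); lia).
  split.
  - intros H. specialize (H (word_at (tape_of c) (pos_of c) (cstate c) (S (pos_of c)))).
    unfold accepting, word_at in H. rewrite cell_head_code, Nat.eqb_refl in H by auto.
    simpl in H. apply Nat.eqb_eq, H. apply in_map_iff. exists (S (pos_of c)).
    split; [now rewrite Nat.eqb_refl | apply in_seq; lia].
  - intros E v Hv. apply in_map_iff in Hv. destruct Hv as (j & <- & Hj).
    destruct j as [|i]; [easy|]. unfold accepting, word_at. rewrite cell_head_code by auto.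
    destruct (i =? pos_of c); [|now rewrite orb_true_r].
    now rewrite E, Nat.eqb_refl, orb_true_r.
Qed.
End Width.

Definition init_cell (x : list bool) : nat -> nat :=
  word_at (fun i => nth i (map Some x) None) 0 0.

Lemma ca_word W u : is_word alphabet W u -> is_word alphabet W (ca_step local_rule W u).
Proof.
  intros [H1 H2]. unfold ca_step. split; [now rewrite length_map, length_seq|].
  apply Forall_forall. intros v Hv. apply in_map_iff in Hv. destruct Hv as (j & <- & Hj).
  apply in_seq in Hj. apply local_rule_lt. rewrite Forall_forall in H2. apply H2, nth_In. lia.
Qed.

Lemma init_word W x : is_word alphabet W (ca_init W (init_cell x)).
Proof.
  split; [unfold ca_init; now rewrite length_map, length_seq|].
  apply Forall_forall. intros v Hv. apply in_map_iff in Hv. destruct Hv as (j & <- & _).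
  destruct j as [|i]; [unfold alphabet; simpl; lia|]. apply cell_code_lt.
  destruct HM as [H _]. destruct (i =? 0); lia.
Qed.

Lemma automaton_decides L x n c s W : steps M n (init_config x) = Some c -> halted M c ->
  (cstate c = tm_acc M <-> L) ->
  (forall k c', k <= n -> steps M k (init_config x) = Some c' -> cspace c' <= s) ->
  W = s + 2 ->
  forallb accepting (Nat.iter (2 ^ (alphabet * W)) (ca_step local_rule W) (ca_init W (init_cell x)))
    = true <-> L.
Proof.
  intros Hs Hh HL Hsp ->.
  assert (Hpos : forall k c', k <= n -> steps M k (init_config x) = Some c' -> S (pos_of c') < s + 2).
  { intros k c' Hk Hc'. specialize (Hsp k c' Hk Hc'). destruct c' as [[q L1] R1].
    unfold cspace, pos_of in *. simpl in *. lia. }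
  destruct (run_word (s + 2) n _ _ Hs) as [E Hq]; [apply HM | exact Hpos |].
  rewrite (fixed_point_reached alphabet (s + 2)) with (n := n); [|apply ca_word|apply init_word| |].
  - change (ca_init (s + 2) (init_cell x)) with (config_word (s + 2) (init_config x)).
    rewrite E, <- HL. apply accepting_word; [easy|]. now apply (Hpos n).
  - change (ca_init (s + 2) (init_cell x)) with (config_word (s + 2) (init_config x)).
    rewrite E, ca_step_config; [|easy|now apply (Hpos n)]. unfold halted in Hh. now rewrite Hh.
  (* Since [alphabet <= 2 ^ alphabet], the number of steps is at least the number of words; the
     halting time [n] itself may be arbitrarily large. *)
  - rewrite Nat.pow_mul_r. apply Nat.pow_le_mono_l.
    pose proof (Nat.pow_gt_lin_r 2 alphabet ltac:(lia)). lia.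
Qed.

(** [cell_code] is additive in its head part, so the start state 0, coded as 1, is added to the code
    of the symbol in cell 1, the first cell after the marker. *)
Definition einit : expr :=
  EIfZ (EVar 3) (ECst 0)
    (EAdd (EIfZ (ESub (EVar 3) ELen)
             (EIfZ (EBit (ESub (EVar 3) (ECst 1)))
                (ECst (cell_code (Some false) 0)) (ECst (cell_code (Some true) 0)))
             (ECst (cell_code None 0)))
          (EIfZ (ESub (EVar 3) (ECst 1)) (ECst 1) (ECst 0))).

Lemma eval_einit x r' j' r j : eval x [r'; j'; r; j] einit = init_cell x j.
Proof.
  cbn [eval einit nth]. destruct j as [|i]; [easy|].
  change (S i =? 0) with false. cbv iota. unfold init_cell, word_at, cell_code.
  rewrite Nat.sub_succ, Nat.sub_0_r.
  replace (nth i (map Some x) None) with (if S i - length x =? 0 then Some (nth i x false) else None).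
  - destruct (Nat.eqb_spec (S i - length x) 0); [destruct (nth i x false)|];
      destruct (i =? 0); cbn [sym_code Nat.eqb]; lia.
  - destruct (Nat.eqb_spec (S i - length x) 0).
    + rewrite (nth_indep _ None (Some false)) by (rewrite length_map; lia). now rewrite map_nth.
    + rewrite nth_overflow; [easy|]. rewrite length_map. lia.
Qed.
End Automaton.

(** * Printing the instance *)

(** The language asks for some instance with the given encoding. Unique readability excludes that
    the printed word also encodes another instance with a positive answer. *)
Definition prefix_code {A} (e : A -> list bool) : Prop :=
  forall a b u v, e a ++ u = e b ++ v -> a = b /\ u = v.

Lemma pos_bits_inj p p' : pos_bits p = pos_bits p' -> p = p'.
Proof.
  revert p'. induction p as [p IH|p IH|]; intros [p'|p'|]; simpl; intros H; try discriminate.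
  - injection H as H. now rewrite (IH p').
  - injection H as H. now destruct p.
  - injection H as H. now rewrite (IH p').
  - injection H as H. now destruct p'.
  - reflexivity.
Qed.

Lemma nat_bits_inj n n' : nat_bits n = nat_bits n' -> n = n'.
Proof.
  unfold nat_bits. intros H. apply Nnat.Nat2N.inj.
  destruct (N.of_nat n) as [|p], (N.of_nat n') as [|p']; try reflexivity.
  - destruct p'; discriminate.
  - destruct p; discriminate.
  - f_equal. now apply pos_bits_inj.
Qed.

Lemma enc_nat_prefix : prefix_code enc_nat.
Proof.
  intros a b u v H. unfold enc_nat in H. rewrite <- !app_assoc in H.
  fold (delimit (nat_bits a)) in H. fold (delimit (nat_bits b)) in H.
  enough (nat_bits a = nat_bits b /\ u = v) as [E ->] by (split; [now apply nat_bits_inj | easy]).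
  revert H. generalize (nat_bits a) as s, (nat_bits b) as t.
  induction s as [|x s IH]; intros [|y t] H; simpl in H; try discriminate.
  - now injection H.
  - injection H as -> H. apply IH in H. now destruct H as [-> ->].
Qed.

Lemma enc_list_prefix {A} (e : A -> list bool) : prefix_code e -> prefix_code (enc_list e).
Proof.
  intros He l l' u v H. unfold enc_list in H. rewrite <- !app_assoc in H.
  apply enc_nat_prefix in H. destruct H as [Hl H].
  revert l' Hl H. induction l as [|a l IH]; intros [|b l'] Hl H; try discriminate.
  - easy.
  - simpl in H. rewrite <- !app_assoc in H. apply He in H. destruct H as [-> H].
    injection Hl as Hl. destruct (IH l' Hl H) as [-> ->]. easy.
Qed.

Lemma enc_pair_prefix : prefix_code enc_pair.
Proof.
  intros [a1 a2] [b1 b2] u v H. unfold enc_pair in H. simpl in H. rewrite <- !app_assoc in H.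
  apply enc_nat_prefix in H. destruct H as [-> H]. apply enc_nat_prefix in H.
  now destruct H as [-> ->].
Qed.

Lemma enc_Q_prefix : prefix_code enc_Q.
Proof.
  intros [n d] [n' d'] u v H. unfold enc_Q, enc_Z in H. simpl in H. rewrite <- !app_assoc in H.
  injection H as Hs H. apply enc_nat_prefix in H. destruct H as [Hn H].
  apply enc_nat_prefix in H. destruct H as [Hd ->]. apply Pos2Nat.inj in Hd. subst d'.
  assert (n = n') as ->; [|easy].
  destruct (Z.ltb_spec n 0), (Z.ltb_spec n' 0); try discriminate; lia.
Qed.

Lemma enc_game_prefix : prefix_code enc_game.
Proof.
  intros [n k o e s t] [n' k' o' e' s' t'] u v H. unfold enc_game in H. simpl in H.
  rewrite <- !app_assoc in H.
  apply enc_nat_prefix in H. destruct H as [-> H].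
  apply enc_nat_prefix in H. destruct H as [-> H].
  apply (enc_list_prefix _ enc_nat_prefix) in H. destruct H as [-> H].
  apply (enc_list_prefix _ enc_pair_prefix) in H. destruct H as [-> H].
  apply enc_nat_prefix in H. destruct H as [-> H].
  apply (enc_list_prefix _ (enc_list_prefix _ enc_nat_prefix)) in H. now destruct H as [-> ->].
Qed.

Lemma enc_instance_inj I I' : enc_instance I = enc_instance I' -> I = I'.
Proof.
  destruct I as [G q t], I' as [G' q' t']. unfold enc_instance. simpl. intros H.
  apply enc_game_prefix in H. destruct H as [-> H].
  apply enc_Q_prefix in H. destruct H as [-> H].
  rewrite <- (app_nil_r (enc_nat t)), <- (app_nil_r (enc_nat t')) in H.
  apply enc_nat_prefix in H. now destruct H as [-> _].
Qed.

Lemma list_sum_const (F : nat -> nat) l c : (forall v, F v = c) -> list_sum (map F l) = length l * c.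
Proof. intros H. induction l; simpl; rewrite ?H, ?IHl; lia. Qed.

Lemma flat_map_map {A B C} (f : B -> list C) (h : A -> B) l :
  flat_map f (map h l) = flat_map (fun a => f (h a)) l.
Proof. induction l; simpl; congruence. Qed.

Lemma flat_map_flat_map {A B C} (f : B -> list C) (h : A -> list B) l :
  flat_map f (flat_map h l) = flat_map (fun a => flat_map f (h a)) l.
Proof. induction l; simpl; rewrite ?flat_map_app; congruence. Qed.

Lemma flat_map_ext_in {A B} (f h : A -> list B) l :
  (forall a, In a l -> f a = h a) -> flat_map f l = flat_map h l.
Proof.
  induction l as [|a l IH]; intros H; simpl; [easy|].
  rewrite (H a), IH; simpl; auto. intros b Hb. apply H. now right.
Qed.

Lemma flat_map_seq_shift {A} (f : nat -> list A) k n :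
  flat_map f (seq k n) = flat_map (fun j => f (k + j)) (seq 0 n).
Proof.
  rewrite <- (Nat.add_0_r k) at 1. rewrite <- (flat_map_map f (fun j => k + j)).
  f_equal. revert k. generalize 0 as i. induction n as [|n IH]; intros i k; simpl; [easy|].
  f_equal. rewrite <- IH. f_equal. lia.
Qed.

Lemma flat_map_seq_mul {A} (f : nat -> list A) a b :
  flat_map f (seq 0 (a * b)) = flat_map (fun i => flat_map (fun j => f (i * b + j)) (seq 0 b)) (seq 0 a).
Proof.
  induction a as [|a IH]; [reflexivity|].
  replace (S a * b) with (a * b + b) by lia.
  rewrite seq_app, flat_map_app, IH, (seq_S a), flat_map_app. f_equal.
  simpl. rewrite app_nil_r. apply flat_map_seq_shift.
Qed.

Definition gcat (l : list gen) : gen := fold_right GSeq GNil l.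

Lemma emit_gcat {A} x env (f : A -> gen) l :
  emit x env (gcat (map f l)) = flat_map (fun a => emit x env (f a)) l.
Proof. induction l; simpl; congruence. Qed.

(** A product as a sum of equal terms. Variables are counted from the outermost loop, so existing
    references in [b] keep their meaning under the new binder. *)
Definition emul (a b : expr) : expr := ESum a b.

Lemma eval_emul x env a b c : (forall v, eval x (env ++ [v]) b = c) ->
  eval x env (emul a b) = eval x env a * c.
Proof. intros H. simpl. rewrite (list_sum_const _ _ c) by easy. now rewrite length_seq. Qed.

Fixpoint epow (k : nat) : expr :=
  match k with
  | 0 => ECst 1
  | S k' => emul ELen (epow k')
  end.

Lemma eval_epow x k : forall env, eval x env (epow k) = length x ^ k.
Proof.
  induction k as [|k IH]; intros env; [easy|]. cbn [epow].
  rewrite (eval_emul _ _ _ _ (length x ^ k)) by auto. reflexivity.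
Qed.

(** * The printing program and its output *)

Section Emission.
Context (g : nat) (delta : nat -> nat -> nat -> nat) (ok : nat -> bool) (ei eW em : expr).
Context (x : list bool) (W m : nat).
Context (HeW : forall env, eval x env eW = W) (Hem : forall env, eval x env em = m).
Context (Hg : 0 < g) (HW : 0 < W) (Hm : 0 < m).

Notation tpl := (templates g delta ok ei eW em).
Notation K := (length tpl).

Definition eP : expr := emul (emul (EAdd em (ECst 1)) (ECst 4)) eW.
Definition eC : expr := emul (emul em eW) (ECst K).
Definition ePg : expr := emul eP (ECst g).
Definition eNV : expr := EAdd (EAdd (EAdd (ECst 2) eC) eP) ePg.

Notation P := (S m * 4 * W).
Notation C := (m * W * K).
Notation lit := (template_lit g delta ok ei eW em x W).
Notation game := (clause_game P g C (block_owner W) lit).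

Lemma eval_eP env : eval x env eP = P.
Proof.
  unfold eP. rewrite (eval_emul _ _ _ _ W) by auto. rewrite (eval_emul _ _ _ _ 4) by auto.
  cbn [eval]. rewrite Hem. f_equal. f_equal. lia.
Qed.

Lemma eval_eC env : eval x env eC = C.
Proof.
  unfold eC. rewrite (eval_emul _ _ _ _ K) by auto. rewrite (eval_emul _ _ _ _ W) by auto.
  now rewrite Hem.
Qed.

Lemma eval_ePg env : eval x env ePg = P * g.
Proof. unfold ePg. rewrite (eval_emul _ _ _ _ g) by auto. now rewrite eval_eP. Qed.

Lemma eval_eNV env : eval x env eNV = g_nv game.
Proof. unfold eNV. cbn [eval]. now rewrite eval_eC, eval_eP, eval_ePg. Qed.

Definition gen_owner : gen :=
  gcat [GNat eNV; GFor (EAdd (ECst 1) eC) (GNat (ECst 0));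
    GFor (EAdd em (ECst 1)) (gcat (map (fun k => GFor eW (GNat (ECst (if k =? 3 then 1 else 0)))) (seq 0 4)));
    GNat (ECst 1); GFor ePg (GNat (EAdd (ECst 2) (EVar 0)))].

Lemma clause_count_pos : 0 < C.
Proof. pose proof (templates_pos g delta ok ei eW em). nia. Qed.

Lemma emit_owner : emit x [] gen_owner = enc_list enc_nat (g_owner game).
Proof.
  unfold enc_list.
  rewrite (proj1 (clause_game_wf P g C (block_owner W) lit Hg clause_count_pos)).
  cbn [g_owner clause_game]. rewrite !flat_map_app, !flat_map_map.
  cbn [gen_owner gcat fold_right emit]. rewrite eval_eNV. f_equal.
  rewrite app_nil_r. f_equal; [|f_equal; [|f_equal]].
  - cbn [eval]. rewrite eval_eC. generalize (1 + C) as n, 0 at 2 as i.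
    induction n as [|n IH]; intros i; [easy|]. simpl. f_equal. apply IH.
  - rewrite flat_map_seq_mul, flat_map_seq_mul. cbn [eval]. rewrite Hem, Nat.add_1_r.
    apply flat_map_ext. intros r.
    fold (gcat (map (fun k => GFor eW (GNat (ECst (if k =? 3 then 1 else 0)))) (seq 0 4))).
    rewrite emit_gcat. apply flat_map_ext_in. intros k Hk. apply in_seq in Hk. cbn [emit]. rewrite HeW.
    apply flat_map_ext_in. intros j Hj. apply in_seq in Hj. cbn [eval].
    unfold block_owner. destruct (div_mod_block W (r * 4 + k) j ltac:(lia)) as [-> _].
    destruct (div_mod_block 4 r k ltac:(lia)) as [_ ->]. now destruct (k =? 3).
  - cbn [eval]. rewrite eval_ePg. apply flat_map_ext. reflexivity.
Qed.

Definition ecv (p : expr) : expr := EAdd (EAdd (ECst 1) eC) p.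
Definition evv : expr :=
  EAdd (EAdd (EAdd (ECst 2) eC) eP) (EAdd (emul (EVar 0) (ECst g)) (EVar 1)).

Lemma eval_evv p a : eval x [p; a] evv = vv P g C p a.
Proof.
  unfold evv. cbn [eval]. rewrite eval_eC, eval_eP, (eval_emul _ _ _ _ g) by auto. reflexivity.
Qed.

Definition gen_edges : gen :=
  gcat [GNat (EAdd (EAdd (EAdd (EAdd (ECst 1) eC) ePg) eC) (emul eP (ECst (g * 2))));
    GFor (EAdd (ECst 1) eC) (GSeq (GNat (EVar 0)) (GNat (EVar 0)));
    GFor eP (GFor (ECst g) (GSeq (GNat (ecv (EVar 0))) (GNat evv)));
    GFor eC (GSeq (GNat (ecv eP)) (GNat (EAdd (ECst 1) (EVar 0))));
    GFor eP (GFor (ECst g) (gcat [GNat evv; GNat (ecv (EAdd (EVar 0) (ECst 1)));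
                                  GNat evv; GNat (ECst 0)]))].

Lemma emit_edges : emit x [] gen_edges = enc_list enc_pair (g_edges game).
Proof.
  unfold enc_list. cbn [g_edges clause_game].
  rewrite !flat_map_app, !flat_map_map, !length_app, !length_map, !length_seq.
  rewrite (length_flat_map_blocks _ P g) by (intros; now rewrite length_map, length_seq).
  rewrite (length_flat_map_blocks _ P (g * 2)) by (intros; now apply length_flat_map_blocks).
  cbn [gen_edges gcat fold_right emit]. cbn [eval].
  rewrite eval_ePg, eval_eC, eval_eP, (eval_emul _ _ _ _ (g * 2)), eval_eP by auto.
  rewrite app_nil_r. apply f_equal2; [f_equal; lia|].
  apply f_equal2; [|apply f_equal2; [|apply f_equal2]].
  - apply flat_map_ext. reflexivity.
  - rewrite flat_map_flat_map. apply flat_map_ext. intros p. rewrite flat_map_map.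
    apply flat_map_ext. intros a. cbn [app]. rewrite eval_evv. cbn [eval nth ecv].
    now rewrite eval_eC.
  - apply flat_map_ext. intros c. cbn [eval ecv nth app]. now rewrite eval_eC, eval_eP.
  - rewrite flat_map_flat_map. apply flat_map_ext. intros p. rewrite flat_map_flat_map.
    apply flat_map_ext. intros a. cbn [app]. rewrite eval_evv. cbn [eval nth ecv flat_map].
    rewrite eval_eC. unfold enc_pair. cbn [fst snd]. rewrite !app_nil_r, <- !app_assoc.
    unfold cv. now rewrite Nat.add_1_r.
Qed.

(** The kind [k] and the value [v] are known when the program is written, so kinds are compared
    here; round and position vary with the loops and are left to [ptest] at run time. *)
Definition elit (k v : nat) (els : expr) (qs : list pattern) : expr :=
  fold_right (fun q e => if pk q =? k then EIfZ (ptest q v) (ECst 0) e else e) els qs.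

Lemma eval_elit env k v els qs : eval x env (elit k v els qs) =
  if existsb (fun q => (pk q =? k) && (eval x env (ptest q v) =? 0)) qs then 0 else eval x env els.
Proof.
  induction qs as [|q qs IH]; [easy|]. cbn [elit fold_right existsb].
  fold (elit k v els qs). destruct (pk q =? k); [|exact IH].
  cbn [andb]. cbn [eval]. destruct (eval x env (ptest q v) =? 0); [easy | exact IH].
Qed.

Definition eclause (t : nat) : expr :=
  EAdd (ECst 1) (EAdd (emul (EAdd (emul (EVar 2) eW) (EVar 3)) (ECst K)) (ECst t)).

Lemma eval_eclause r' j' r j t : eval x [r'; j'; r; j] (eclause t) = S ((r * W + j) * K + t).
Proof.
  unfold eclause. cbn [eval]. rewrite (eval_emul _ _ _ _ K) by auto.
  cbn [eval]. rewrite (eval_emul _ _ _ _ W) by auto. reflexivity.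
Qed.

(** Runs inside two loops that bind round and position of the move, so its own loops bind variables
    2 and 3, the ones the patterns use for the clause. The nesting visits the clauses in numerical
    order. *)
Definition gen_marker (k v : nat) : gen :=
  GSeq (GNat (EAdd (ECst 1) eC)) (GSeq (GNat (ECst 0))
    (GFor em (GFor eW (gcat (map (fun t => GNat (elit k v (eclause t) (nth t tpl []))) (seq 0 K)))))).

Lemma emit_marker r' k j' v : k < 4 -> j' < W -> emit x [r'; j'] (gen_marker k v) =
  enc_list enc_nat (0 :: map (fun c => if lit c ((r' * 4 + k) * W + j') v then 0 else S c) (seq 0 C)).
Proof.
  intros Hk Hj'. unfold enc_list. cbn [length flat_map]. rewrite length_map, length_seq, flat_map_map.
  cbn [gen_marker emit]. cbn [eval]. rewrite eval_eC. f_equal. f_equal.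
  rewrite flat_map_seq_mul, flat_map_seq_mul, Hem. apply flat_map_ext. intros r. cbn [emit].
  rewrite HeW. apply flat_map_ext_in. intros j Hj. apply in_seq in Hj. rewrite emit_gcat.
  apply flat_map_ext_in. intros t Ht. apply in_seq in Ht. cbn [emit app].
  rewrite eval_elit, eval_eclause, template_lit_iff by lia. reflexivity.
Qed.

Definition gen_targets : gen :=
  gcat [GNat (EAdd (ECst 2) ePg); GNat (ECst 1); GNat (ECst 0);
    GNat eC; GFor eC (GNat (EAdd (ECst 1) (EVar 0)));
    GFor (EAdd em (ECst 1)) (gcat (map (fun k => GFor eW (gcat (map (gen_marker k) (seq 0 g)))) (seq 0 4)))].

Lemma emit_targets : emit x [] gen_targets = enc_list (enc_list enc_nat) (g_targets game).
Proof.
  unfold enc_list at 1. cbn [g_targets clause_game length flat_map].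
  rewrite (length_flat_map_blocks _ P g) by (intros; now rewrite length_map, length_seq).
  cbn [gen_targets gcat fold_right emit]. cbn [eval]. rewrite eval_ePg, eval_eC.
  f_equal. unfold enc_list at 1. cbn [length flat_map]. rewrite <- app_assoc. f_equal.
  rewrite app_nil_r. f_equal. unfold enc_list at 1. rewrite length_map, length_seq, <- app_assoc.
  f_equal. f_equal; [now rewrite flat_map_map|].
  rewrite ?app_nil_r, flat_map_flat_map, flat_map_seq_mul, flat_map_seq_mul, Hem, Nat.add_1_r.
  apply flat_map_ext. intros r'.
  fold (gcat (map (fun k => GFor eW (gcat (map (gen_marker k) (seq 0 g)))) (seq 0 4))).
  rewrite emit_gcat. apply flat_map_ext_in. intros k Hk. apply in_seq in Hk. cbn [emit]. rewrite HeW.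
  apply flat_map_ext_in. intros j' Hj'. apply in_seq in Hj'. rewrite emit_gcat, flat_map_map.
  apply flat_map_ext. intros v. cbn [app]. apply emit_marker; lia.
Qed.

(** The entries 0, 1, 1 print the threshold 1: [enc_nat 0] is the single bit [false], which serves
    as the sign bit, followed by numerator and denominator. *)
Definition gen_instance : gen :=
  gcat [GNat eNV; GNat (EAdd (ECst 1) ePg); gen_owner; gen_edges; GNat (ecv (ECst 0)); gen_targets;
    GNat (ECst 0); GNat (ECst 1); GNat (ECst 1); GNat eNV].

Lemma emit_instance : emit x [] gen_instance =
  enc_instance (clause_instance P g C (block_owner W) lit).
Proof.
  unfold enc_instance, enc_game. cbn [i_game i_mu i_t clause_instance].
  cbn [gen_instance gcat fold_right emit].
  rewrite emit_owner, emit_edges, emit_targets, eval_eNV. rewrite <- !app_assoc. cbn [eval ecv].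
  now rewrite eval_ePg, eval_eC, app_nil_r.
Qed.
End Emission.

Theorem theorem5 : exists c : nat, PSPACE_hard (tmem_TR_NNCRSP c).
Proof.
  (* The memory of the printed instance equals its number of vertices, hence the factor 1. *)
  exists 1. intros L (M & k & HM & HL).
  set (g := alphabet M). set (eW := EAdd (epow k) (ECst (k + 2))). set (em := emul (ECst g) eW).
  set (delta := local_rule M). set (ok := accepting M). set (ei := einit M).
  exists (fun x => emit x [] (gen_instance g delta ok ei eW em)). split; [apply emit_polytime|].
  intros x. set (W := poly k (length x) + 2). set (m := g * W).
  assert (HeW : forall env, eval x env eW = W).
  { intros env. unfold eW, W, poly. cbn [eval]. rewrite eval_epow. lia. }
  assert (Hem : forall env, eval x env em = m).
  { intros env. unfold em. rewrite (eval_emul _ _ _ _ W) by auto. reflexivity. }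
  assert (Hg : 1 < g) by (unfold g, alphabet; lia).
  assert (HW : 0 < W) by (unfold W; lia).
  assert (Hm : 0 < m) by (unfold m; nia).
  rewrite (emit_instance g delta ok ei eW em x W m) by (auto; lia).
  pose proof (clause_count_pos g delta ok ei eW em W m ltac:(lia) HW Hm) as HC.
  set (C := m * W * length (templates g delta ok ei eW em)) in *.
  set (lit := template_lit g delta ok ei eW em x W) in *.
  set (I := clause_instance (S m * 4 * W) g C (block_owner W) lit).
  assert (HI : NNCRSP_answer I <-> L x).
  { unfold I. rewrite clause_instance_answer by lia.
    pose proof (win_bwin (S m * 4 * W) g C lit W m (ca_step delta W) (ca_init W (init_cell M x)) ok HW
      (valid_templates g delta ok ei eW em x W m (init_cell M x) HeW Hem (eval_einit M x) HW Hm)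
      (4 * S m) [] (Forall_nil _) eq_refl) as Hwin.
    replace (4 * S m * W) with (S m * 4 * W) in Hwin by lia. simpl concat in Hwin. rewrite Hwin.
    rewrite bwin_iff; [|easy|easy|apply (ca_word M HM)|apply (init_word M HM)].
    destruct (HL x) as (n & c & H1 & H2 & H3 & H4).
    now apply (automaton_decides M HM (L x) x n c (poly k (length x)) W). }
  rewrite <- HI. split.
  - intros H. exists I. split; [easy|]. split; [|split; [|easy]].
    + split; [apply clause_game_wf; lia|]. split; unfold Qle; simpl; lia.
    + unfold I. cbn [i_t i_game clause_instance]. lia.
  (* The instance that witnesses membership of the printed word can only be [I]. *)
  - intros (I' & HI' & _ & _ & H). apply enc_instance_inj in HI'. now subst I'.
Qed.
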